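(* Let $\mathbb{D}=\{z\in\mathbb{C}:|z|<1\}$ and let $h:\mathbb{D}\rightarrow\mathbb{C}$ be a holomorphic univalent map. Then every harmonic mapping $f=h+\overline{g}$, with $g$ holomorphic in $\mathbb{D}$ and $|g'(z)|<|h'(z)|$ for all $z\in\mathbb{D}$, is univalent in $\mathbb{D}$ if and only if $h(\mathbb{D})$ is a convex domain.
   Context: Univalent means injective. A planar harmonic mapping is a complex-valued harmonic function on a domain in $\mathbb{C}$; on $\mathbb{D}$ it can be written $f=h+\overline{g}$ with $h,g$ holomorphic. *)

(* Defs.v *)
(* Stdlib reals with Coquelicot's complex numbers. A map on a set [U] of
   complex numbers is given by a total function [C -> C], of which only the
   values on [U] matter. *)
From Stdlib Require Import Reals.
From Coquelicot Require Import Coquelicot.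

Definition unit_disk (z : C) : Prop := (Cmod z < 1)%R.

Definition image_set (f : C -> C) (U : C -> Prop) (w : C) : Prop :=
  exists z : C, U z /\ w = f z.

Definition connected_set (U : C -> Prop) : Prop :=
  forall A B : C -> Prop,
    open A -> open B ->
    (forall z : C, U z -> A z \/ B z) ->
    (exists z : C, U z /\ A z) ->
    (exists z : C, U z /\ B z) ->
    exists z : C, U z /\ A z /\ B z.

Definition domain (U : C -> Prop) : Prop :=
  (exists z : C, U z) /\ open U /\ connected_set U.

Definition convex_set (U : C -> Prop) : Prop :=
  forall (p q : C) (t : R), U p -> U q -> (0 <= t <= 1)%R ->
    U (RtoC (1 - t) * p + RtoC t * q)%C.

Definition convex_domain (U : C -> Prop) : Prop :=
  domain U /\ convex_set U.

(* Differentiability is over the complex field: [C_AbsRing] is the scalar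
   ring, as opposed to [R_AbsRing]. *)
Definition holomorphic_on (U : C -> Prop) (f : C -> C) : Prop :=
  forall z : C, U z -> @ex_derive C_AbsRing C_NormedModule f z.

Definition univalent_on (U : C -> Prop) (f : C -> C) : Prop :=
  forall z1 z2 : C, U z1 -> U z2 -> f z1 = f z2 -> z1 = z2.

(* [ex_diff_n u 2 x y] only asks for continuity of the partial derivatives at
   the point (x, y); required at every point of an open [U], it says that [u]
   is of class C^2 on [U]. *)
Definition real_harmonic_on (U : C -> Prop) (u : R -> R -> R) : Prop :=
  forall x y : R, U (x, y) ->
    ex_diff_n u 2 x y /\
    (partial_derive 2 0 u x y + partial_derive 0 2 u x y = 0)%R.

Definition harmonic_mapping_on (U : C -> Prop) (f : C -> C) : Prop :=
  domain U /\
  real_harmonic_on U (fun x y : R => Re (f (x, y))) /\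
  real_harmonic_on U (fun x y : R => Im (f (x, y))).

(* Main.v *)
Require Import Defs.
From Stdlib Require Import Reals Lra Lia ClassicalEpsilon Classical FunctionalExtensionality.
From Coquelicot Require Import Coquelicot.

(** If f = h + conj g takes the same value at z and w, then
    h z - h w = - conj (g z - g w); and replacing g by mu g with |mu| <= 1 keeps
    |g'| < |h'|.  Both implications compare |g z - g w| with |h z - h w|.

    When h(D) is convex, the map g o h^-1 has a derivative of modulus less than 1
    on the segment between two values of h, so the mean value inequality gives
    |g z - g w| < |h z - h w| and f is injective ([convex_univalent]).  That
    h^-1 is differentiable rests on the openness of injective holomorphic maps
    ([inj_open]).

    Conversely, if all the maps f are injective, then |g z - g w| <= |h z - h w|
    whenever |g'| < |h'| on D ([univalent_dominates]).  This property descends to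
    smaller disks.  Let |z1| <= |zeta| = rho < 1 and let om be holomorphic with
    |om| < 1 on a disk slightly larger than rho D.  The quotient of
    [int om(tau) h'(lam tau) dtau] (from z1 to zeta, through 0) by
    (h(lam zeta) - h(lam z1)) / lam is holomorphic in lam for |lam| < 1 / rho.
    On a circle |lam| = r1 > 1 the function t |-> om(t / lam) lives on all of D,
    so the quotient has modulus at most 1 there, hence also at lam = 1, by the
    maximum principle.  With om(tau) = 1 - 2 e / (A - tau / zeta) the bound at
    lam = 1 becomes
      Re (conj (h zeta - h z1) int h'(tau) / (A - tau / zeta) dtau) >= 0
    for A > 1 close to 1 ([kernel_dot_ge_0]).  As A tends to 1 the integral grows
    like zeta h'(zeta) log (1 / (A - 1)) ([log_divergence]), so
      Re (conj (h zeta - h z1) zeta h'(zeta)) >= 0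
    ([support_line]).  The tangent to the curve h(|z| = rho) at h zeta is thus a
    support line of h(|z| <= rho), and a compact set with interior points and a
    support line at every boundary point is convex ([dominates_convex]).

    An injective holomorphic h has h' <> 0 ([inj_derive_neq_0]), by an argument of
    Hurwitz.  All the function theory is obtained from Goursat's theorem through
    the Cauchy formula; only holomorphic functions on disks centred at 0 occur,
    which keeps paths to segments and circles. *)

Open Scope R_scope.

(** * Continuity and derivatives along a parameter *)

(** Continuity and differentiability of a complex function of a parameter x which is
    read as a complex number through e: e = zid for functions on C, e = RtoC for
    curves.  One calculus then serves both, and mixed compositions as well. *)
Definition cont {X : Type} (e : X -> C) (f : X -> C) (x : X) : Prop :=
  forall eps, 0 < eps -> exists del, 0 < del /\
    forall y, Cmod (e y - e x) < del -> Cmod (f y - f x) < eps.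

Definition der {X : Type} (e : X -> C) (f : X -> C) (x : X) (l : C) : Prop :=
  forall eps, 0 < eps -> exists del, 0 < del /\
    forall y, Cmod (e y - e x) < del ->
      Cmod (f y - f x - l * (e y - e x)) <= eps * Cmod (e y - e x).

Definition zid (z : C) : C := z.

Lemma Cmod_minus_sym a b : Cmod (a - b) = Cmod (b - a).
Proof. rewrite <- Cmod_opp. f_equal. ring. Qed.

Lemma Cmod_tri3 a b c : Cmod (a - c) <= Cmod (a - b) + Cmod (b - c).
Proof. replace (a - c)%C with ((a - b) + (b - c))%C by ring. apply Cmod_triangle. Qed.

Lemma Cmod_triangle_minus a b : Cmod (a - b) <= Cmod a + Cmod b.
Proof. unfold Cminus. rewrite <- (Cmod_opp b). apply Cmod_triangle. Qed.

Lemma Cmod_rev_triangle a b : Cmod a - Cmod b <= Cmod (a - b).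
Proof.
  assert (H := Cmod_triangle (a - b) b).
  replace (a - b + b)%C with a in H by ring. lra.
Qed.

Lemma RtoC_neq (x y : R) : x <> y -> RtoC x <> RtoC y.
Proof. intros N E. apply N. now apply RtoC_inj. Qed.

Lemma Cminus_eq_0 a b : (a - b)%C = 0 -> a = b.
Proof. intros E. replace a with (a - b + b)%C by ring. rewrite E. ring. Qed.

Lemma cont_const {X} (e : X -> C) c x : cont e (fun _ => c) x.
Proof.
  intros eps He. exists 1. split; [lra|]. intros y _.
  replace (c - c)%C with (RtoC 0) by ring. rewrite Cmod_0. lra.
Qed.

Lemma cont_param {X} (e : X -> C) x : cont e e x.
Proof. intros eps He. exists eps. auto. Qed.

Lemma cont_plus {X} (e : X -> C) f g x :
  cont e f x -> cont e g x -> cont e (fun y => (f y + g y)%C) x.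
Proof.
  intros Hf Hg eps He.
  destruct (Hf (eps / 2)) as [d1 [P1 H1]]; [lra|].
  destruct (Hg (eps / 2)) as [d2 [P2 H2]]; [lra|].
  exists (Rmin d1 d2). split; [now apply Rmin_pos|]. intros y Hy.
  replace (f y + g y - (f x + g x))%C with ((f y - f x) + (g y - g x))%C by ring.
  eapply Rle_lt_trans; [apply Cmod_triangle|].
  assert (A := Rmin_l d1 d2). assert (B := Rmin_r d1 d2).
  specialize (H1 y ltac:(lra)). specialize (H2 y ltac:(lra)). lra.
Qed.

Lemma cont_mult {X} (e : X -> C) f g x :
  cont e f x -> cont e g x -> cont e (fun y => (f y * g y)%C) x.
Proof.
  intros Hf Hg eps He.
  set (M := Cmod (f x) + Cmod (g x) + 1).
  assert (HM : 0 < M) by (unfold M; generalize (Cmod_ge_0 (f x)) (Cmod_ge_0 (g x)); lra).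
  set (k := Rmin 1 (eps / (2 * M))).
  assert (Hk : 0 < k) by (apply Rmin_pos; [lra|apply Rdiv_lt_0_compat; lra]).
  destruct (Hf k Hk) as [d1 [P1 H1]]. destruct (Hg k Hk) as [d2 [P2 H2]].
  exists (Rmin d1 d2). split; [now apply Rmin_pos|]. intros y Hy.
  assert (A := Rmin_l d1 d2). assert (B := Rmin_r d1 d2).
  specialize (H1 y ltac:(lra)). specialize (H2 y ltac:(lra)).
  replace (f y * g y - f x * g x)%C with
    ((f y - f x) * (g y - g x) + ((f y - f x) * g x + f x * (g y - g x)))%C by ring.
  eapply Rle_lt_trans; [apply Cmod_triangle|].
  eapply Rle_lt_trans; [apply Rplus_le_compat_l, Cmod_triangle|].
  rewrite !Cmod_mult.
  assert (K1 := Rmin_l 1 (eps / (2 * M))). assert (K2 := Rmin_r 1 (eps / (2 * M))).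
  fold k in K1, K2.
  assert (K3 : k * (2 * M) <= eps).
  { apply Rmult_le_compat_r with (r := 2 * M) in K2; [|lra].
    replace (eps / (2 * M) * (2 * M)) with eps in K2 by (field; lra). lra. }
  assert (F0 := Cmod_ge_0 (f x)). assert (G0 := Cmod_ge_0 (g x)).
  assert (F1 := Cmod_ge_0 (f y - f x)). assert (G1 := Cmod_ge_0 (g y - g x)).
  unfold M in K3.
  nra.
Qed.

Lemma cont_opp {X} (e : X -> C) f x : cont e f x -> cont e (fun y => (- f y)%C) x.
Proof.
  intros Hf eps He. destruct (Hf eps He) as [d [P H]]. exists d. split; auto. intros y Hy.
  replace (- f y - - f x)%C with (- (f y - f x))%C by ring. rewrite Cmod_opp. auto.
Qed.

Lemma cont_minus {X} (e : X -> C) f g x :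
  cont e f x -> cont e g x -> cont e (fun y => (f y - g y)%C) x.
Proof. intros Hf Hg. apply cont_plus; [exact Hf|]. now apply cont_opp. Qed.

Lemma cont_inv {X} (e : X -> C) f x :
  cont e f x -> f x <> 0 -> cont e (fun y => (/ f y)%C) x.
Proof.
  intros Hf Hx eps He.
  assert (m0 : 0 < Cmod (f x)) by now apply Cmod_gt_0.
  set (m := Cmod (f x)) in *.
  destruct (Hf (Rmin (m / 2) (eps * (m * m / 2)))) as [d [P H]].
  { apply Rmin_pos; [lra|]. apply Rmult_lt_0_compat; [lra|]. nra. }
  exists d. split; auto. intros y Hy. specialize (H y Hy).
  assert (A := Rmin_l (m / 2) (eps * (m * m / 2))).
  assert (B := Rmin_r (m / 2) (eps * (m * m / 2))).
  assert (Hm : m / 2 < Cmod (f y)).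
  { assert (T := Cmod_rev_triangle (f x) (f y)). rewrite Cmod_minus_sym in T.
    fold m in T. lra. }
  assert (Hy0 : f y <> 0) by (apply Cmod_gt_0; lra).
  replace (/ f y - / f x)%C with ((- (f y - f x)) / (f y * f x))%C by (field; auto).
  rewrite Cmod_div; [|now apply Cmult_neq_0]. rewrite Cmod_opp, Cmod_mult. fold m.
  apply Rmult_lt_reg_r with (Cmod (f y) * m); [nra|].
  unfold Rdiv. rewrite Rmult_assoc, Rinv_l, Rmult_1_r by nra.
  assert (m * (m / 2) < Cmod (f y) * m) by nra.
  nra.
Qed.

Lemma cont_div {X} (e : X -> C) f g x :
  cont e f x -> cont e g x -> g x <> 0 -> cont e (fun y => (f y / g y)%C) x.
Proof. intros Hf Hg H. apply cont_mult; [exact Hf|]. now apply cont_inv. Qed.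

Lemma cont_comp {X} (e : X -> C) f g x :
  cont zid f (g x) -> cont e g x -> cont e (fun y => f (g y)) x.
Proof.
  intros Hf Hg eps He. destruct (Hf eps He) as [d [P H]].
  destruct (Hg d P) as [d' [P' H']]. exists d'. split; auto.
  intros y Hy. exact (H _ (H' y Hy)).
Qed.

(** Caratheodory's form of the derivative: the slope extends continuously.  The rules
    of differentiation reduce to those of continuity. *)
Lemma der_slope {X} (e : X -> C) f x l :
  der e f x l <-> exists p, cont e p x /\ p x = l /\
    forall y, (f y - f x = p y * (e y - e x))%C.
Proof.
  split.
  - intros H.
    exists (fun y => if excluded_middle_informative (e y = e x) then l
                     else ((f y - f x) / (e y - e x))%C).
    split; [|split].
    + intros eps He. destruct (H (eps / 2)) as [d [P Hd]]; [lra|].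
      exists d. split; auto. intros y Hy.
      destruct (excluded_middle_informative (e x = e x)) as [_|n]; [|now destruct n].
      destruct (excluded_middle_informative (e y = e x)) as [E|n].
      * replace (l - l)%C with (RtoC 0) by ring. rewrite Cmod_0. lra.
      * specialize (Hd y Hy). assert (N := Cminus_eq_contra _ _ n).
        replace ((f y - f x) / (e y - e x) - l)%C with
          ((f y - f x - l * (e y - e x)) / (e y - e x))%C by (field; auto).
        rewrite Cmod_div by auto. apply Cmod_gt_0 in N.
        apply Rle_lt_trans with (eps / 2); [|lra].
        apply Rmult_le_reg_r with (Cmod (e y - e x)); auto.
        unfold Rdiv at 1. rewrite Rmult_assoc, Rinv_l by lra. lra.
    + destruct (excluded_middle_informative (e x = e x)) as [_|n]; [auto|now destruct n].
    + intros y. destruct (excluded_middle_informative (e y = e x)) as [E|n].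
      * rewrite E. replace (l * (e x - e x))%C with (RtoC 0) by ring.
        destruct (H 1) as [d [P Hd]]; [lra|]. specialize (Hd y).
        rewrite E in Hd. replace (e x - e x)%C with (RtoC 0) in Hd by ring.
        rewrite Cmod_0 in Hd. specialize (Hd P).
        apply Cmod_eq_0. apply Rle_antisym; [|apply Cmod_ge_0].
        replace (f y - f x - l * 0)%C with (f y - f x)%C in Hd by ring. lra.
      * field. now apply Cminus_eq_contra.
  - intros [p [Hp [E H]]] eps He. destruct (Hp eps He) as [d [P Hd]].
    exists d. split; auto. intros y Hy. rewrite H, <- E.
    replace (p y * (e y - e x) - p x * (e y - e x))%C with
      ((p y - p x) * (e y - e x))%C by ring.
    rewrite Cmod_mult. apply Rmult_le_compat_r; [apply Cmod_ge_0|]. left. auto.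
Qed.

Lemma der_cont {X} (e : X -> C) f x l : der e f x l -> cont e f x.
Proof.
  intros H. apply der_slope in H. destruct H as [p [Hp [E H]]].
  intros eps He.
  assert (K : cont e (fun y => f x + p y * (e y - e x))%C x).
  { apply cont_plus; [apply cont_const|]. apply cont_mult; [exact Hp|].
    apply cont_minus; [apply cont_param|apply cont_const]. }
  destruct (K eps He) as [d [P Hd]]. exists d. split; auto. intros y Hy.
  specialize (Hd y Hy). rewrite <- !H in Hd.
  replace (f y - f x)%C with (f x + (f y - f x) - (f x + (f x - f x)))%C by ring. exact Hd.
Qed.

Lemma der_const {X} (e : X -> C) c x : der e (fun _ => c) x 0.
Proof.
  apply der_slope. exists (fun _ => RtoC 0). split; [apply cont_const|]. split; [auto|].
  intros; ring.
Qed.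

Lemma der_param {X} (e : X -> C) x : der e e x 1.
Proof.
  apply der_slope. exists (fun _ => RtoC 1). split; [apply cont_const|]. split; [auto|].
  intros; ring.
Qed.

Lemma der_plus {X} (e : X -> C) f g x l m :
  der e f x l -> der e g x m -> der e (fun y => f y + g y)%C x (l + m)%C.
Proof.
  rewrite !der_slope. intros [p [Hp [E H]]] [q [Hq [F G]]].
  exists (fun y => p y + q y)%C. split; [now apply cont_plus|].
  split; [now rewrite E, F|]. intros y.
  replace (f y + g y - (f x + g x))%C with ((f y - f x) + (g y - g x))%C by ring.
  rewrite H, G. ring.
Qed.

Lemma der_mult {X} (e : X -> C) f g x l m :
  der e f x l -> der e g x m ->
  der e (fun y => f y * g y)%C x (l * g x + f x * m)%C.
Proof.
  intros Hf Hg. assert (Cg := der_cont _ _ _ _ Hg).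
  apply der_slope in Hf. apply der_slope in Hg. apply der_slope.
  destruct Hf as [p [Hp [E H]]]. destruct Hg as [q [Hq [F G]]].
  exists (fun y => p y * g y + f x * q y)%C. split; [|split].
  - apply cont_plus; apply cont_mult; auto. apply cont_const.
  - now rewrite E, F.
  - intros y. replace (f y * g y - f x * g x)%C with
      ((f y - f x) * g y + f x * (g y - g x))%C by ring.
    rewrite H, G. ring.
Qed.

Lemma der_scal {X} (e : X -> C) c f x l :
  der e f x l -> der e (fun y => c * f y)%C x (c * l)%C.
Proof.
  intros H. replace (c * l)%C with (0 * f x + c * l)%C by ring.
  apply der_mult; [apply der_const|exact H].
Qed.

Lemma der_opp {X} (e : X -> C) f x l : der e f x l -> der e (fun y => - f y)%C x (- l)%C.
Proof.
  rewrite !der_slope. intros [p [Hp [E H]]].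
  exists (fun y => - p y)%C. split; [now apply cont_opp|].
  split; [now rewrite E|]. intros y.
  replace (- f y - - f x)%C with (- (f y - f x))%C by ring. rewrite H. ring.
Qed.

Lemma der_minus {X} (e : X -> C) f g x l m :
  der e f x l -> der e g x m -> der e (fun y => f y - g y)%C x (l - m)%C.
Proof. intros Hf Hg. apply der_plus; [exact Hf|]. now apply der_opp. Qed.

Lemma der_inv {X} (e : X -> C) f x l :
  der e f x l -> f x <> 0 -> der e (fun y => / f y)%C x (- l / (f x * f x))%C.
Proof.
  intros Hf Hx. assert (Cf := der_cont _ _ _ _ Hf).
  intros eps He.
  apply der_slope in Hf. destruct Hf as [p [Hp [E H]]].
  assert (K : cont e (fun y => - p y / (f y * f x))%C x).
  { apply cont_div; [now apply cont_opp| |].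
    - apply cont_mult; auto. apply cont_const.
    - now apply Cmult_neq_0. }
  destruct (K eps He) as [d [P Hd]].
  destruct (Cf (Cmod (f x))) as [d' [P' Hd']]; [now apply Cmod_gt_0|].
  exists (Rmin d d'). split; [now apply Rmin_pos|]. intros y Hy.
  assert (A := Rmin_l d d'). assert (B := Rmin_r d d').
  specialize (Hd y ltac:(lra)). specialize (Hd' y ltac:(lra)).
  assert (Hy0 : f y <> 0).
  { intros Z. rewrite Z in Hd'. replace (0 - f x)%C with (- f x)%C in Hd' by ring.
    rewrite Cmod_opp in Hd'. lra. }
  replace (/ f y - / f x - - l / (f x * f x) * (e y - e x))%C with
    ((- p y / (f y * f x) - - p x / (f x * f x)) * (e y - e x))%C.
  { rewrite Cmod_mult. apply Rmult_le_compat_r; [apply Cmod_ge_0|]. lra. }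
  rewrite E. replace (/ f y - / f x)%C with (- (f y - f x) / (f y * f x))%C by (field; auto).
  rewrite H. field. auto.
Qed.

Lemma der_comp {X} (e : X -> C) f g x l m :
  der zid f (g x) l -> der e g x m -> der e (fun y => f (g y)) x (l * m)%C.
Proof.
  intros Hf Hg. assert (Cg := der_cont _ _ _ _ Hg).
  apply der_slope in Hf. apply der_slope in Hg. apply der_slope.
  destruct Hf as [p [Hp [E H]]]. destruct Hg as [q [Hq [F G]]].
  exists (fun y => p (g y) * q y)%C. split; [|split].
  - apply cont_mult; auto. now apply cont_comp.
  - now rewrite E, F.
  - intros y. rewrite H. unfold zid. rewrite G. ring.
Qed.

Lemma der_eq {X} (e : X -> C) f x l m : der e f x l -> l = m -> der e f x m.
Proof. now intros H <-. Qed.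

Lemma der_local {X} (e : X -> C) f g x l :
  der e f x l ->
  (exists d, 0 < d /\ forall y, Cmod (e y - e x) < d -> f y = g y) ->
  der e g x l.
Proof.
  intros H [d [P E]] eps He. destruct (H eps He) as [d' [P' H']].
  exists (Rmin d d'). split; [now apply Rmin_pos|]. intros y Hy.
  assert (A := Rmin_l d d'). assert (B := Rmin_r d d').
  rewrite <- (E y) by lra. rewrite <- (E x). apply H'; lra.
  replace (e x - e x)%C with (RtoC 0) by ring. rewrite Cmod_0. lra.
Qed.

Lemma cont_local {X} (e : X -> C) f g x :
  cont e f x ->
  (exists d, 0 < d /\ forall y, Cmod (e y - e x) < d -> f y = g y) ->
  cont e g x.
Proof.
  intros H [d [P E]] eps He. destruct (H eps He) as [d' [P' H']].
  exists (Rmin d d'). split; [now apply Rmin_pos|]. intros y Hy.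
  assert (A := Rmin_l d d'). assert (B := Rmin_r d d').
  rewrite <- (E y) by lra. rewrite <- (E x). apply H'; lra.
  replace (e x - e x)%C with (RtoC 0) by ring. rewrite Cmod_0. lra.
Qed.

Lemma der_unique_C f z l m : der zid f z l -> der zid f z m -> l = m.
Proof.
  intros Hl Hm. apply Cminus_eq_0. apply Cmod_eq_0.
  apply Rle_antisym; [|apply Cmod_ge_0].
  apply Rnot_lt_le. intros P. set (k := Cmod (l - m)) in *.
  destruct (Hl (k / 4)) as [d1 [P1 H1]]; [lra|].
  destruct (Hm (k / 4)) as [d2 [P2 H2]]; [lra|].
  set (s := Rmin d1 d2 / 2). assert (Hs : 0 < s) by (unfold s; generalize (Rmin_pos _ _ P1 P2); lra).
  assert (A := Rmin_l d1 d2). assert (B := Rmin_r d1 d2).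
  assert (S : Cmod (z + s - z) = s).
  { replace (z + s - z)%C with (RtoC s) by ring. rewrite Cmod_R. apply Rabs_pos_eq. lra. }
  specialize (H1 (z + s)%C). specialize (H2 (z + s)%C). unfold zid in *. rewrite S in H1, H2.
  specialize (H1 ltac:(unfold s in *; lra)). specialize (H2 ltac:(unfold s in *; lra)).
  assert (T := Cmod_tri3 (l * (z + s - z)) (f (z + s)%C - f z) (m * (z + s - z))).
  rewrite (Cmod_minus_sym (l * _) (f _ - _)) in T.
  replace (l * (z + s - z) - m * (z + s - z))%C with ((l - m) * (z + s - z))%C in T by ring.
  rewrite Cmod_mult, S in T. fold k in T. nra.
Qed.

Lemma der_is_derive f z l : der zid f z l <-> is_derive (K := C_AbsRing) (V := C_NormedModule) f z l.
Proof.
  split.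
  - intros H. split.
    + apply (is_linear_scal_l (K := C_AbsRing) (V := C_NormedModule)).
    + intros x Hx. assert (E : z = x) by exact (is_filter_lim_locally_unique (K := C_AbsRing)
        (V := AbsRing_NormedModule C_AbsRing) z x Hx). subst x.
      intros eps. destruct (H eps (cond_pos eps)) as [d [P Hd]].
      exists (mkposreal d P). intros y Hy.
      assert (Q := Hd y Hy). unfold zid in Q. rewrite Rmult_comm in Q.
      change (Cmod (f y - f z - (y - z) * l) <= eps * Cmod (y - z)).
      rewrite (Cmult_comm (y - z)). rewrite (Rmult_comm eps). exact Q.
  - intros [_ H] eps He.
    specialize (H z (fun P HP => HP) (mkposreal eps He)).
    destruct H as [d Hd]. exists d. split; [apply cond_pos|]. intros y Hy.
    specialize (Hd y Hy).
    change (Cmod (f y - f z - (y - z) * l) <= eps * Cmod (y - z)) in Hd.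
    rewrite (Cmult_comm (y - z)) in Hd. exact Hd.
Qed.

(** * Integrals of complex-valued functions on an interval *)

Definition Cint (f : R -> C) (a b : R) : C :=
  (RInt (fun t => Re (f t)) a b, RInt (fun t => Im (f t)) a b).

Definition cont_on (a b : R) (f : R -> C) : Prop := forall t, a <= t <= b -> cont RtoC f t.

Lemma im_le_Cmod c : Rabs (Im c) <= Cmod c.
Proof. eapply Rle_trans; [|apply Rmax_Cmod]. apply Rmax_r. Qed.

Lemma Cmod_le_sum c : Cmod c <= Rabs (Re c) + Rabs (Im c).
Proof.
  rewrite <- !Cmod_R. rewrite <- (Rmult_1_r (Cmod (Im c))), <- Cmod_Ci, <- Cmod_mult.
  eapply Rle_trans; [|apply Cmod_triangle]. right. f_equal.
  destruct c as [x y]. unfold RtoC, Cplus, Cmult, Re, Im; simpl. f_equal; ring.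
Qed.

Lemma cont_R_Re f t : cont RtoC f t -> continuous (fun t => Re (f t)) t.
Proof.
  intros H. apply (proj1 (continuity_pt_filterlim _ _)). intros eps He.
  destruct (H eps He) as [d [P Hd]]. exists d. split; [exact P|].
  intros s [_ Hs]. specialize (Hd s). rewrite <- RtoC_minus, Cmod_R in Hd.
  unfold dist, R_met, R_dist in *. simpl in *. unfold R_dist in *.
  eapply Rle_lt_trans; [|apply Hd; exact Hs].
  replace (Re (f s) - Re (f t)) with (Re (f s - f t)%C) by (unfold Re; simpl; ring).
  apply re_le_Cmod.
Qed.

Lemma cont_R_Im f t : cont RtoC f t -> continuous (fun t => Im (f t)) t.
Proof.
  intros H. apply (proj1 (continuity_pt_filterlim _ _)). intros eps He.
  destruct (H eps He) as [d [P Hd]]. exists d. split; [exact P|].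
  intros s [_ Hs]. specialize (Hd s). rewrite <- RtoC_minus, Cmod_R in Hd.
  unfold dist, R_met, R_dist in *. simpl in *. unfold R_dist in *.
  eapply Rle_lt_trans; [|apply Hd; exact Hs].
  replace (Im (f s) - Im (f t)) with (Im (f s - f t)%C) by (unfold Im; simpl; ring).
  apply im_le_Cmod.
Qed.

Lemma der_R_parts F t l :
  der RtoC F t l ->
  is_derive (fun t => Re (F t)) t (Re l) /\ is_derive (fun t => Im (F t)) t (Im l).
Proof.
  intros H. split; apply is_derive_Reals; intros eps He;
  (destruct (H (eps / 2)) as [d [P Hd]]; [lra|]); exists (mkposreal d P);
  intros h Hh Hhd; simpl in Hhd; specialize (Hd (t + h));
  (replace (RtoC (t + h) - t)%C with (RtoC h) in Hd by (rewrite RtoC_plus; ring));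
  rewrite Cmod_R in Hd; specialize (Hd Hhd);
  assert (P' := Rabs_pos_lt _ Hh).
  - replace ((Re (F (t + h)) - Re (F t)) / h - Re l) with
      (Re (F (t + h)%R - F t - l * h)%C / h)
      by (unfold Re, Im, RtoC, Cminus, Cplus, Copp, Cmult; simpl; field; auto).
    unfold Rdiv. rewrite Rabs_mult, Rabs_inv.
    apply Rmult_lt_reg_r with (Rabs h); auto. rewrite Rmult_assoc, Rinv_l by lra.
    assert (Q := re_le_Cmod (F (t + h)%R - F t - l * h)%C). nra.
  - replace ((Im (F (t + h)) - Im (F t)) / h - Im l) with
      (Im (F (t + h)%R - F t - l * h)%C / h)
      by (unfold Re, Im, RtoC, Cminus, Cplus, Copp, Cmult; simpl; field; auto).
    unfold Rdiv. rewrite Rabs_mult, Rabs_inv.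
    apply Rmult_lt_reg_r with (Rabs h); auto. rewrite Rmult_assoc, Rinv_l by lra.
    assert (Q := im_le_Cmod (F (t + h)%R - F t - l * h)%C). nra.
Qed.

Lemma parts_der_R (u v : R -> R) t l m :
  is_derive u t l -> is_derive v t m -> der RtoC (fun t => (u t, v t)) t (l, m).
Proof.
  rewrite !is_derive_Reals. intros Hu Hv eps He.
  destruct (Hu (eps / 2)) as [d1 H1]; [lra|]. destruct (Hv (eps / 2)) as [d2 H2]; [lra|].
  exists (Rmin d1 d2). split; [apply Rmin_pos; apply cond_pos|]. intros s Hs.
  rewrite <- RtoC_minus in *. rewrite Cmod_R in *.
  destruct (Req_dec s t) as [->|N].
  { replace (_ - _ - _)%C with (RtoC 0).
    - rewrite Cmod_0. apply Rmult_le_pos; [lra|apply Rabs_pos].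
    - unfold RtoC, Cminus, Cplus, Copp, Cmult; simpl. f_equal; ring. }
  assert (N' : s - t <> 0) by lra.
  assert (A := Rmin_l d1 d2). assert (B := Rmin_r d1 d2).
  specialize (H1 (s - t) N' ltac:(lra)). specialize (H2 (s - t) N' ltac:(lra)).
  replace (t + (s - t)) with s in H1, H2 by ring.
  eapply Rle_trans; [apply Cmod_le_sum|].
  assert (P' := Rabs_pos_lt _ N').
  assert (K1 : Rabs (u s - u t - l * (s - t)) <= eps / 2 * Rabs (s - t)).
  { replace (u s - u t - l * (s - t)) with (((u s - u t) / (s - t) - l) * (s - t)) by (field; auto).
    rewrite Rabs_mult. nra. }
  assert (K2 : Rabs (v s - v t - m * (s - t)) <= eps / 2 * Rabs (s - t)).
  { replace (v s - v t - m * (s - t)) with (((v s - v t) / (s - t) - m) * (s - t)) by (field; auto).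
    rewrite Rabs_mult. nra. }
  unfold Re, Im. simpl.
  replace (u s + - u t + - (l * (s - t) - m * 0)) with (u s - u t - l * (s - t)) by ring.
  replace (v s + - v t + - (l * 0 + m * (s - t))) with (v s - v t - m * (s - t)) by ring.
  lra.
Qed.

Lemma cont_on_Re a b f : a <= b -> cont_on a b f -> ex_RInt (fun t => Re (f t)) a b.
Proof.
  intros L H. apply (ex_RInt_continuous (V := R_CompleteNormedModule)). intros t Ht.
  rewrite Rmin_left, Rmax_right in Ht by lra. now apply cont_R_Re, H.
Qed.

Lemma cont_on_Im a b f : a <= b -> cont_on a b f -> ex_RInt (fun t => Im (f t)) a b.
Proof.
  intros L H. apply (ex_RInt_continuous (V := R_CompleteNormedModule)). intros t Ht.
  rewrite Rmin_left, Rmax_right in Ht by lra. now apply cont_R_Im, H.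
Qed.

Lemma Cint_ext a b f g :
  a <= b -> (forall t, a <= t <= b -> f t = g t) -> Cint f a b = Cint g a b.
Proof.
  intros L H. unfold Cint. f_equal; apply RInt_ext; intros t Ht;
    rewrite Rmin_left, Rmax_right in Ht by lra; rewrite H; auto; lra.
Qed.

Lemma Cint_scal a b c f : a <= b -> cont_on a b f ->
  Cint (fun t => c * f t)%C a b = (c * Cint f a b)%C.
Proof.
  intros L Hf. assert (HR := cont_on_Re _ _ _ L Hf). assert (HI := cont_on_Im _ _ _ L Hf).
  assert (S : forall k (u : R -> R), ex_RInt u a b -> RInt (fun t => k * u t) a b = k * RInt u a b)
    by (intros k u Hu; apply (RInt_scal (V := R_CompleteNormedModule)); auto).
  assert (S' : forall k (u : R -> R), ex_RInt u a b -> ex_RInt (fun t => k * u t) a b)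
    by (intros k u Hu; apply (ex_RInt_scal (V := R_CompleteNormedModule)); auto).
  unfold Cint, Cmult. simpl. f_equal.
  - rewrite <- (S (fst c)), <- (S (snd c)) by auto.
    apply (RInt_minus (V := R_CompleteNormedModule)); auto.
  - rewrite <- (S (fst c)), <- (S (snd c)) by auto.
    apply (RInt_plus (V := R_CompleteNormedModule)); auto.
Qed.

Lemma Cint_minus a b f g : a <= b -> cont_on a b f -> cont_on a b g ->
  Cint (fun t => f t - g t)%C a b = (Cint f a b - Cint g a b)%C.
Proof.
  intros L Hf Hg. unfold Cint, Cminus, Cplus, Copp. simpl. f_equal.
  - apply (RInt_minus (V := R_CompleteNormedModule)); auto using cont_on_Re.
  - apply (RInt_minus (V := R_CompleteNormedModule)); auto using cont_on_Im.
Qed.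

(** The factor 2 comes from estimating both components. *)
Lemma Cint_bound a b f M : a <= b -> cont_on a b f ->
  (forall t, a <= t <= b -> Cmod (f t) <= M) -> Cmod (Cint f a b) <= 2 * (b - a) * M.
Proof.
  intros L Hf HM.
  assert (B : forall u : R -> R, ex_RInt u a b -> (forall t, a <= t <= b -> Rabs (u t) <= M) ->
            Rabs (RInt u a b) <= (b - a) * M).
  { intros u Hu HuM. apply (norm_RInt_le_const (V := R_NormedModule)) with (f := u); auto.
    apply (RInt_correct (V := R_CompleteNormedModule)); auto. }
  eapply Rle_trans; [apply Cmod_le_sum|]. unfold Cint, Re at 1, Im at 2; simpl.
  assert (B1 := B _ (cont_on_Re _ _ _ L Hf)). assert (B2 := B _ (cont_on_Im _ _ _ L Hf)).
  simpl in B1, B2.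
  assert (K1 := B1 (fun t Ht => Rle_trans _ _ _ (re_le_Cmod _) (HM t Ht))).
  assert (K2 := B2 (fun t Ht => Rle_trans _ _ _ (im_le_Cmod _) (HM t Ht))).
  unfold Re, Im in *. lra.
Qed.

Lemma Cint_FTC a b F f : a <= b -> (forall t, a <= t <= b -> der RtoC F t (f t)) ->
  cont_on a b f -> Cint f a b = (F b - F a)%C.
Proof.
  intros L HF Hf. unfold Cint.
  assert (E1 : is_RInt (fun t => Re (f t)) a b (minus (Re (F b)) (Re (F a)))).
  { apply (is_RInt_derive (V := R_CompleteNormedModule) (fun t => Re (F t))).
    all: intros t Ht; rewrite Rmin_left, Rmax_right in Ht by lra.
    - now apply der_R_parts, HF.
    - now apply cont_R_Re, Hf. }
  assert (E2 : is_RInt (fun t => Im (f t)) a b (minus (Im (F b)) (Im (F a)))).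
  { apply (is_RInt_derive (V := R_CompleteNormedModule) (fun t => Im (F t))).
    all: intros t Ht; rewrite Rmin_left, Rmax_right in Ht by lra.
    - now apply der_R_parts, HF.
    - now apply cont_R_Im, Hf. }
  apply (is_RInt_unique (V := R_CompleteNormedModule)) in E1.
  apply (is_RInt_unique (V := R_CompleteNormedModule)) in E2.
  rewrite E1, E2. reflexivity.
Qed.

Lemma Cint_const a b c : a <= b -> Cint (fun _ => c) a b = ((b - a)%R * c)%C.
Proof.
  intros L. rewrite (Cint_FTC a b (fun t => c * t)%C).
  - rewrite RtoC_minus. ring.
  - exact L.
  - intros t _. eapply der_eq; [apply der_scal, der_param|]. ring.
  - intros t _. apply cont_const.
Qed.

Lemma RInt_halves (g : R -> R) : (forall t, 0 <= t <= 1 -> continuous g t) ->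
  RInt g 0 1 = / 2 * RInt (fun t => g (/ 2 * t)) 0 1 + / 2 * RInt (fun t => g (/ 2 * t + / 2)) 0 1.
Proof.
  intros Hg.
  assert (E : forall a b, 0 <= a -> a <= b -> b <= 1 -> ex_RInt g a b).
  { intros a b H1 H2 H3. apply (ex_RInt_continuous (V := R_CompleteNormedModule)).
    intros t Ht. rewrite Rmin_left, Rmax_right in Ht by lra. apply Hg. lra. }
  assert (K : forall v, (v = 0 \/ v = / 2) ->
    / 2 * RInt (fun t => g (/ 2 * t + v)) 0 1 = RInt g v (v + / 2)).
  { intros v Hv.
    assert (E1 : ex_RInt g (/ 2 * 0 + v) (/ 2 * 1 + v)) by (apply E; destruct Hv; subst; lra).
    assert (Q := RInt_comp_lin (V := R_CompleteNormedModule) g (/ 2) v 0 1 E1).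
    replace (RInt g v (v + / 2)) with (RInt g (/ 2 * 0 + v) (/ 2 * 1 + v))
      by (f_equal; ring).
    rewrite <- Q. symmetry.
    apply (RInt_scal (V := R_CompleteNormedModule) (fun t => g (/ 2 * t + v))).
    apply (ex_RInt_continuous (V := R_CompleteNormedModule)).
    intros t Ht. rewrite Rmin_left, Rmax_right in Ht by lra.
    apply continuous_comp.
    - apply (continuous_plus (V := R_NormedModule)); [|apply continuous_const].
      apply (continuous_mult (K := R_AbsRing)); [apply continuous_const|apply continuous_id].
    - apply Hg. destruct Hv; subst; lra. }
  rewrite (K (/ 2)) by auto.
  replace (RInt (fun t => g (/ 2 * t)) 0 1) with (RInt (fun t => g (/ 2 * t + 0)) 0 1)
    by (apply RInt_ext; intros; now rewrite Rplus_0_r).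
  rewrite (K 0) by auto.
  replace (0 + / 2) with (/ 2) by ring. replace (/ 2 + / 2) with 1 by field.
  symmetry. apply (RInt_Chasles (V := R_CompleteNormedModule)); apply E; lra.
Qed.

Lemma RInt_reverse (g : R -> R) : (forall t, 0 <= t <= 1 -> continuous g t) ->
  RInt (fun t => g (1 - t)) 0 1 = RInt g 0 1.
Proof.
  intros Hg.
  assert (E1 : ex_RInt g (-1 * 0 + 1) (-1 * 1 + 1)).
  { apply (ex_RInt_continuous (V := R_CompleteNormedModule)). intros t Ht. apply Hg.
    rewrite Rmin_right, Rmax_left in Ht by lra. lra. }
  assert (Q := RInt_comp_lin (V := R_CompleteNormedModule) g (-1) 1 0 1 E1).
  replace (-1 * 0 + 1) with 1 in Q by ring. replace (-1 * 1 + 1) with 0 in Q by ring.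
  rewrite <- (opp_RInt_swap (V := R_CompleteNormedModule) g 1 0) by
    (apply (ex_RInt_continuous (V := R_CompleteNormedModule)); intros t Ht;
     rewrite Rmin_right, Rmax_left in Ht by lra; apply Hg; lra).
  rewrite <- Q.
  rewrite <- (RInt_opp (V := R_CompleteNormedModule)).
  - apply RInt_ext. intros t _. unfold opp, scal; simpl. unfold mult; simpl.
    replace (-1 * t + 1) with (1 - t) by ring. ring.
  - apply (ex_RInt_continuous (V := R_CompleteNormedModule)).
    intros t Ht. rewrite Rmin_left, Rmax_right in Ht by lra.
    apply (continuous_scal (K := R_AbsRing) (V := R_NormedModule)); [apply continuous_const|].
    apply (continuous_comp (fun y => -1 * y + 1) g).
    + apply (continuous_plus (V := R_NormedModule)); [|apply continuous_const].
      apply (continuous_mult (K := R_AbsRing)); [apply continuous_const|apply continuous_id].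
    + apply Hg. lra.
Qed.

Lemma Cint_halves g : cont_on 0 1 g ->
  Cint g 0 1 = (/ 2 * Cint (fun t => g (/ 2 * t)%R) 0 1
                + / 2 * Cint (fun t => g (/ 2 * t + / 2)%R) 0 1)%C.
Proof.
  intros Hg. unfold Cint.
  rewrite (RInt_halves (fun t => Re (g t))) by (intros; now apply cont_R_Re, Hg).
  rewrite (RInt_halves (fun t => Im (g t))) by (intros; now apply cont_R_Im, Hg).
  unfold Cplus, Cmult, Cinv, RtoC; simpl. f_equal; field.
Qed.

Lemma Cint_reverse g : cont_on 0 1 g -> Cint (fun t => g (1 - t)%R) 0 1 = Cint g 0 1.
Proof.
  intros Hg. unfold Cint. f_equal.
  - apply (RInt_reverse (fun t => Re (g t))). intros; now apply cont_R_Re, Hg.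
  - apply (RInt_reverse (fun t => Im (g t))). intros; now apply cont_R_Im, Hg.
Qed.

(** * Goursat's theorem and primitives *)

Ltac cont_tac :=
  repeat first
    [ assumption | apply cont_const | apply cont_param
    | apply cont_plus | apply cont_minus | apply cont_mult | apply cont_opp ].

(** The integral of f over the oriented segment from z to w. *)
Definition seg (f : C -> C) (z w : C) : C :=
  ((w - z) * Cint (fun t : R => f (z + t * (w - z))%C) 0 1)%C.

Definition cont_seg (f : C -> C) (z w : C) : Prop :=
  forall t : R, 0 <= t <= 1 -> cont zid f (z + t * (w - z))%C.

Lemma cont_seg_on f z w : cont_seg f z w -> cont_on 0 1 (fun t : R => f (z + t * (w - z))%C).
Proof.
  intros H t Ht. apply (cont_comp RtoC f); [now apply H|]. cont_tac.
Qed.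

Lemma seg_reverse f z w : cont_seg f z w -> seg f w z = (- seg f z w)%C.
Proof.
  intros H. unfold seg. rewrite <- (Cint_reverse (fun t : R => f (z + t * (w - z))%C)).
  2: now apply cont_seg_on.
  rewrite (Cint_ext 0 1 (fun t : R => f (w + t * (z - w))%C)
    (fun t => f (z + (1 - t)%R * (w - z))%C)); [ring|lra|].
  intros t _. f_equal. rewrite RtoC_minus. ring.
Qed.

Lemma seg_halves f z w : cont_seg f z w ->
  seg f z w = (seg f z (/ 2 * (z + w)) + seg f (/ 2 * (z + w)) w)%C.
Proof.
  intros H. unfold seg. rewrite Cint_halves by now apply cont_seg_on.
  assert (N : RtoC 2 <> 0) by (apply RtoC_neq; lra).
  rewrite (Cint_ext 0 1 (fun t : R => f (z + t * (/ 2 * (z + w) - z))%C)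
            (fun t : R => f (z + (/ 2 * t)%R * (w - z))%C)) by
    (try lra; intros t _; f_equal; rewrite RtoC_mult, RtoC_inv by lra; field; auto).
  rewrite (Cint_ext 0 1 (fun t : R => f (/ 2 * (z + w) + t * (w - / 2 * (z + w)))%C)
            (fun t : R => f (z + (/ 2 * t + / 2)%R * (w - z))%C)) by
    (try lra; intros t _; f_equal; rewrite RtoC_plus, RtoC_mult, RtoC_inv by lra; field; auto).
  field; auto.
Qed.

Lemma seg_bound f z w M : cont_seg f z w ->
  (forall t : R, 0 <= t <= 1 -> Cmod (f (z + t * (w - z))%C) <= M) ->
  Cmod (seg f z w) <= 2 * Cmod (w - z) * M.
Proof.
  intros H HM. unfold seg. rewrite Cmod_mult.
  assert (B := Cint_bound 0 1 _ M ltac:(lra) (cont_seg_on _ _ _ H) HM).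
  assert (P := Cmod_ge_0 (w - z)). nra.
Qed.

Lemma seg_FTC F f z w : cont_seg f z w ->
  (forall t : R, 0 <= t <= 1 -> der zid F (z + t * (w - z))%C (f (z + t * (w - z))%C)) ->
  seg f z w = (F w - F z)%C.
Proof.
  intros H HF. unfold seg.
  rewrite <- Cint_scal; [|lra|now apply cont_seg_on].
  rewrite (Cint_FTC 0 1 (fun t : R => F (z + t * (w - z))%C)).
  - replace (z + 1 * (w - z))%C with w by ring.
    replace (z + 0 * (w - z))%C with z by ring. reflexivity.
  - lra.
  - intros t Ht. rewrite Cmult_comm.
    apply (der_comp RtoC F (fun t : R => z + t * (w - z))%C); [now apply HF|].
    apply der_eq with (0 + (1 * (w - z) + t * 0))%C; [|ring].
    apply der_plus; [apply der_const|].
    apply (der_mult RtoC RtoC (fun _ => w - z)%C); [apply der_param|apply der_const].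
  - intros t Ht. apply cont_mult; [apply cont_const|]. now apply cont_seg_on.
Qed.

Lemma seg_minus f g z w : cont_seg f z w -> cont_seg g z w ->
  seg (fun x => f x - g x)%C z w = (seg f z w - seg g z w)%C.
Proof.
  intros Hf Hg. unfold seg. rewrite Cint_minus; [ring|lra| |]; now apply cont_seg_on.
Qed.

Definition triangle_integral (f : C -> C) (a b c : C) : C := (seg f a b + seg f b c + seg f c a)%C.

(** An affine function has a primitive. *)
Lemma tri_affine u v a b c : triangle_integral (fun z => u + v * z)%C a b c = 0.
Proof.
  assert (E : forall z w, seg (fun z => u + v * z)%C z w =
    ((u * w + v * / 2 * (w * w)) - (u * z + v * / 2 * (z * z)))%C).
  { intros z w. apply (seg_FTC (fun z => u * z + v * / 2 * (z * z))%C).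
    - intros t _. apply cont_plus; [apply cont_const|].
      apply cont_mult; [apply cont_const|apply (cont_param zid)].
    - intros t _. set (x := (z + t * (w - z))%C).
      apply der_eq with (u * 1 + v * / 2 * (1 * x + x * 1))%C.
      + apply (der_plus zid (fun z => u * z)%C); apply der_scal; [apply (der_param zid)|].
        apply (der_mult zid zid zid); apply (der_param zid).
      + field. }
  unfold triangle_integral. rewrite !E. ring.
Qed.

Lemma Cmod_convex r (z w : C) (t : R) : 0 <= t <= 1 -> Cmod z <= r -> Cmod w <= r ->
  Cmod (z + t * (w - z)) <= r.
Proof.
  intros Ht Hz Hw. replace (z + t * (w - z))%C with ((1 - t)%R * z + t * w)%C
    by (rewrite RtoC_minus; ring).
  eapply Rle_trans; [apply Cmod_triangle|]. rewrite !Cmod_mult, !Cmod_R.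
  rewrite !Rabs_pos_eq by lra. nra.
Qed.

Lemma Cmod_convex_lt r (z w : C) (t : R) : 0 <= t <= 1 -> Cmod z < r -> Cmod w < r ->
  Cmod (z + t * (w - z)) < r.
Proof.
  intros Ht Hz Hw. eapply Rle_lt_trans; [|exact (Rmax_lub_lt _ _ _ Hz Hw)].
  apply Cmod_convex; auto using Rmax_l, Rmax_r.
Qed.

Lemma Cmod_midpoint r (z w : C) : Cmod z <= r -> Cmod w <= r -> Cmod (/ 2 * (z + w)) <= r.
Proof.
  intros Hz Hw. replace (/ 2 * (z + w))%C with (z + (/ 2)%R * (w - z))%C.
  - apply Cmod_convex; auto. lra.
  - rewrite RtoC_inv by lra. field.
Qed.

Lemma Cmod_half z : Cmod (/ 2 * z) = / 2 * Cmod z.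
Proof. rewrite Cmod_mult, <- RtoC_inv, Cmod_R, Rabs_pos_eq by lra. reflexivity. Qed.

Lemma geometric_limit_R (v : nat -> R) K :
  (forall n k, Rabs (v (n + k)%nat - v n) <= K / 2 ^ n) ->
  exists l, forall n, Rabs (v n - l) <= K / 2 ^ n.
Proof.
  intros H.
  assert (S : forall eps, 0 < eps -> exists N, K / 2 ^ N < eps).
  { intros eps He. assert (K0 : 0 <= K).
    { assert (Q := H 0%nat 0%nat). simpl in Q. assert (P := Rabs_pos (v 0%nat - v 0%nat)). lra. }
    destruct (pow_lt_1_zero (/ 2) ltac:(rewrite Rabs_pos_eq; lra) (eps / (K + 1))) as [N HN].
    { apply Rdiv_lt_0_compat; lra. }
    exists N. specialize (HN N (Nat.le_refl _)). rewrite Rabs_pos_eq in HN by (apply pow_le; lra).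
    rewrite pow_inv in HN.
    apply Rmult_lt_compat_r with (r := K + 1) in HN; [|lra].
    unfold Rdiv in HN at 1. rewrite Rmult_assoc, Rinv_l in HN by lra.
    assert (P : 0 < / 2 ^ N) by (apply Rinv_0_lt_compat, pow_lt; lra).
    unfold Rdiv. nra. }
  destruct (Rcomplete.R_complete v) as [l Hl].
  { intros eps He. destruct (S (eps / 2)) as [N HN]; [lra|]. exists N. intros n m Hn Hm.
    unfold R_dist. assert (A := H N (n - N)%nat). assert (B := H N (m - N)%nat).
    replace (N + (n - N))%nat with n in A by lia. replace (N + (m - N))%nat with m in B by lia.
    replace (v n - v m) with ((v n - v N) - (v m - v N)) by ring.
    eapply Rle_lt_trans; [apply Rabs_triang|]. rewrite Rabs_Ropp. lra. }
  exists l. intros n. apply Rnot_lt_le. intros P.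
  destruct (Hl (Rabs (v n - l) - K / 2 ^ n)) as [N HN]; [lra|].
  specialize (HN (n + N)%nat ltac:(lia)). unfold R_dist in HN.
  assert (A := H n N). assert (T := Rabs_triang (v (n + N)%nat - l) (- (v (n + N)%nat - v n))).
  replace (v (n + N)%nat - l + - (v (n + N)%nat - v n)) with (v n - l) in T by ring.
  rewrite Rabs_Ropp in T. lra.
Qed.

(** The factor 4 is 2 from summing the geometric series times 2 from passing to the
    two components. *)
Lemma geometric_limit (u : nat -> C) K :
  (forall n, Cmod (u (S n) - u n) <= K / 2 ^ n) ->
  exists p, forall n, Cmod (u n - p) <= 4 * K / 2 ^ n.
Proof.
  intros H.
  assert (I : forall n k, Cmod (u (n + k)%nat - u n) <= 2 * K / 2 ^ n * (1 - / 2 ^ k)).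
  { intros n k. induction k as [|k IH].
    - rewrite Nat.add_0_r. replace (u n - u n)%C with (RtoC 0) by ring. rewrite Cmod_0.
      simpl. right. field. apply pow_nonzero; lra.
    - eapply Rle_trans; [apply (Cmod_tri3 _ (u (n + k)%nat))|].
      rewrite Nat.add_succ_r. specialize (H (n + k)%nat). rewrite pow_add in H.
      assert (P1 := pow_nonzero 2 n ltac:(lra)). assert (P2 := pow_nonzero 2 k ltac:(lra)).
      simpl pow. eapply Rle_trans; [apply Rplus_le_compat; [exact H|exact IH]|].
      right. field. auto. }
  assert (K0 : 0 <= K).
  { specialize (H 0%nat). simpl in H. assert (Q := Cmod_ge_0 (u 1%nat - u 0%nat)). lra. }
  assert (I' : forall n k, Cmod (u (n + k)%nat - u n) <= 2 * K / 2 ^ n).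
  { intros n k. eapply Rle_trans; [apply I|].
    assert (P1 : 0 < / 2 ^ k) by (apply Rinv_0_lt_compat, pow_lt; lra).
    assert (P2 : 0 < / 2 ^ n) by (apply Rinv_0_lt_compat, pow_lt; lra).
    assert (0 <= 2 * K / 2 ^ n) by (unfold Rdiv; nra). nra. }
  destruct (geometric_limit_R (fun n => Re (u n)) (2 * K)) as [l1 H1].
  { intros n k. eapply Rle_trans; [|apply (I' n k)].
    change (Re (u (n + k)%nat) - Re (u n)) with (Re (u (n + k)%nat - u n)%C). apply re_le_Cmod. }
  destruct (geometric_limit_R (fun n => Im (u n)) (2 * K)) as [l2 H2].
  { intros n k. eapply Rle_trans; [|apply (I' n k)].
    change (Im (u (n + k)%nat) - Im (u n)) with (Im (u (n + k)%nat - u n)%C). apply im_le_Cmod. }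
  exists (l1, l2). intros n. eapply Rle_trans; [apply Cmod_le_sum|].
  specialize (H1 n). specialize (H2 n).
  change (Re (u n - (l1, l2))%C) with (Re (u n) - l1).
  change (Im (u n - (l1, l2))%C) with (Im (u n) - l2).
  replace (4 * K / 2 ^ n) with (2 * K / 2 ^ n + 2 * K / 2 ^ n)
    by (field; apply pow_nonzero; lra). lra.
Qed.

Definition holo (r : R) (f : C -> C) : Prop :=
  forall z, Cmod z < r -> exists l, der zid f z l.

Lemma holo_cont r f z : holo r f -> Cmod z < r -> cont zid f z.
Proof. intros H Hz. destruct (H z Hz) as [l Hl]. exact (der_cont _ _ _ _ Hl). Qed.

Lemma holo_cont_seg r f z w : holo r f -> Cmod z < r -> Cmod w < r -> cont_seg f z w.
Proof. intros H Hz Hw t Ht. apply (holo_cont r); auto. now apply Cmod_convex_lt. Qed.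

Definition perimeter (a b c : C) : R := Cmod (b - a) + Cmod (c - b) + Cmod (a - c).

(** The inner edges are traversed in both directions. *)
Lemma tri_subdivide r f a b c : holo r f -> Cmod a < r -> Cmod b < r -> Cmod c < r ->
  let p := (/ 2 * (a + b))%C in let q := (/ 2 * (b + c))%C in let s := (/ 2 * (c + a))%C in
  triangle_integral f a b c =
    (triangle_integral f a p s + triangle_integral f p b q +
     triangle_integral f s q c + triangle_integral f p q s)%C.
Proof.
  intros H Ha Hb Hc p q s. unfold triangle_integral.
  assert (M : forall z w, Cmod z < r -> Cmod w < r -> Cmod (/ 2 * (z + w)) < r).
  { intros z w Hz Hw. eapply Rle_lt_trans; [|exact (Rmax_lub_lt _ _ _ Hz Hw)].
    apply Cmod_midpoint; auto using Rmax_l, Rmax_r. }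
  assert (Hp := M a b Ha Hb). assert (Hq := M b c Hb Hc). assert (Hs := M c a Hc Ha).
  rewrite (seg_halves f a b), (seg_halves f b c), (seg_halves f c a)
    by (apply (holo_cont_seg r); auto).
  fold p q s in Hp, Hq, Hs |- *.
  rewrite (seg_reverse f p s), (seg_reverse f p q), (seg_reverse f q s)
    by (apply (holo_cont_seg r); auto).
  ring.
Qed.

Lemma pigeonhole4 (a b c d : C) :
  let s := Cmod (a + b + c + d) / 4 in
  s <= Cmod a \/ s <= Cmod b \/ s <= Cmod c \/ s <= Cmod d.
Proof.
  intros s. apply NNPP. intros N.
  assert (T1 := Cmod_triangle (a + b + c) d). assert (T2 := Cmod_triangle (a + b) c).
  assert (T3 := Cmod_triangle a b).
  destruct (Rle_lt_dec s (Cmod a)); [tauto|]. destruct (Rle_lt_dec s (Cmod b)); [tauto|].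
  destruct (Rle_lt_dec s (Cmod c)); [tauto|]. destruct (Rle_lt_dec s (Cmod d)); [tauto|].
  unfold s in *. lra.
Qed.

(** One of the four triangles cut out by the midpoints keeps a quarter of the integral,
    while the perimeter is halved. *)
Lemma tri_shrink r rho f a b c : holo r f -> rho < r ->
  Cmod a <= rho -> Cmod b <= rho -> Cmod c <= rho ->
  exists a' b' c', Cmod a' <= rho /\ Cmod b' <= rho /\ Cmod c' <= rho /\
    perimeter a' b' c' = perimeter a b c / 2 /\ Cmod (a' - a) <= perimeter a b c /\
    Cmod (triangle_integral f a b c) / 4 <= Cmod (triangle_integral f a' b' c').
Proof.
  intros H Hr Ha Hb Hc.
  assert (E := tri_subdivide r f a b c H ltac:(lra) ltac:(lra) ltac:(lra)). simpl in E.
  assert (Hp := Cmod_midpoint rho a b Ha Hb). assert (Hq := Cmod_midpoint rho b c Hb Hc).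
  assert (Hs := Cmod_midpoint rho c a Hc Ha).
  assert (N : RtoC 2 <> 0) by (apply RtoC_neq; lra).
  assert (Q1 := Cmod_ge_0 (b - a)). assert (Q2 := Cmod_ge_0 (c - b)).
  assert (Q3 := Cmod_ge_0 (a - c)).
  assert (W : forall x y z, x = (/ 2 * (y - z))%C -> Cmod x = / 2 * Cmod (y - z)).
  { intros x y z ->. apply Cmod_half. }
  rewrite E. set (p := (/ 2 * (a + b))%C) in *. set (q := (/ 2 * (b + c))%C) in *.
  set (s := (/ 2 * (c + a))%C) in *.
  destruct (pigeonhole4 (triangle_integral f a p s) (triangle_integral f p b q) (triangle_integral f s q c) (triangle_integral f p q s))
    as [K|[K|[K|K]]];
  eexists _, _, _; (split; [|split; [|split; [|split; [|split; [|exact K]]]]]); auto;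
  unfold perimeter.
  - rewrite (W (p - a)%C b a), (W (s - p)%C c b), (W (a - s)%C a c)
      by (unfold p, q, s; field; auto). field.
  - replace (a - a)%C with (RtoC 0) by ring. rewrite Cmod_0. lra.
  - rewrite (W (b - p)%C b a), (W (q - b)%C c b), (W (p - q)%C a c)
      by (unfold p, q, s; field; auto). field.
  - rewrite (W (p - a)%C b a) by (unfold p; field; auto). lra.
  - rewrite (W (q - s)%C b a), (W (c - q)%C c b), (W (s - c)%C a c)
      by (unfold p, q, s; field; auto). field.
  - rewrite (W (s - a)%C c a) by (unfold s; field; auto). rewrite (Cmod_minus_sym c a). lra.
  - rewrite (W (q - p)%C c a), (W (s - q)%C a b), (W (p - s)%C b c)
      by (unfold p, q, s; field; auto).
    rewrite (Cmod_minus_sym c a), (Cmod_minus_sym a b), (Cmod_minus_sym b c). field.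
  - rewrite (W (p - a)%C b a) by (unfold p; field; auto). lra.
Qed.

(** Repeated subdivision gives triangles of perimeter L / 2^n with integral at least
    eta / 4^n that shrink to a point p.  Near p, f is affine up to eps |z - p|, and
    affine functions contribute nothing, so the n-th integral is at most
    12 eps (L / 2^n)^2.  A small eps contradicts eta > 0. *)
Theorem goursat r f a b c : holo r f -> Cmod a < r -> Cmod b < r -> Cmod c < r ->
  triangle_integral f a b c = 0.
Proof.
  intros H Ha Hb Hc. apply Cmod_eq_0. apply Rle_antisym; [|apply Cmod_ge_0].
  apply Rnot_lt_le. intros P. set (eta := Cmod (triangle_integral f a b c)) in *.
  set (rho := Rmax (Cmod a) (Rmax (Cmod b) (Cmod c))).
  assert (Hr : rho < r) by (repeat apply Rmax_lub_lt; auto).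
  assert (Ra : Cmod a <= rho) by apply Rmax_l.
  assert (Rb : Cmod b <= rho) by (eapply Rle_trans; [|apply Rmax_r]; apply Rmax_l).
  assert (Rc : Cmod c <= rho) by (eapply Rle_trans; [|apply Rmax_r]; apply Rmax_r).
  set (good := fun T : C * C * C => let '(x, y, z) := T in
    Cmod x <= rho /\ Cmod y <= rho /\ Cmod z <= rho).
  set (per := fun T : C * C * C => let '(x, y, z) := T in perimeter x y z).
  set (I := fun T : C * C * C => let '(x, y, z) := T in triangle_integral f x y z).
  set (v := fun T : C * C * C => fst (fst T)).
  assert (Step : forall T, exists T', good T -> good T' /\ per T' = per T / 2 /\
    Cmod (v T' - v T) <= per T /\ Cmod (I T) / 4 <= Cmod (I T')).
  { intros [[x y] z]. destruct (classic (good (x, y, z))) as [[G1 [G2 G3]]|N].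
    - destruct (tri_shrink r rho f x y z H Hr G1 G2 G3) as [x' [y' [z' Q]]].
      exists (x', y', z'). intros _. simpl. tauto.
    - exists (x, y, z). tauto. }
  set (next := fun T => proj1_sig (constructive_indefinite_description _ (Step T))).
  assert (Hnext : forall T, good T -> good (next T) /\ per (next T) = per T / 2 /\
    Cmod (v (next T) - v T) <= per T /\ Cmod (I T) / 4 <= Cmod (I (next T))).
  { intros T. unfold next. destruct (constructive_indefinite_description _ (Step T)); auto. }
  set (T := fun n => Nat.iter n next (a, b, c)).
  set (L := perimeter a b c).
  assert (HT : forall n, good (T n) /\ per (T n) = L / 2 ^ n /\ eta / 4 ^ n <= Cmod (I (T n))).
  { induction n as [|n [G [E1 E2]]].
    - unfold T; simpl. fold L eta. split; [auto|]. split; [field|lra].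
    - change (T (S n)) with (next (T n)). destruct (Hnext _ G) as [G' [F1 [_ F2]]].
      split; [auto|]. split.
      + rewrite F1, E1. simpl. field. apply pow_nonzero; lra.
      + eapply Rle_trans; [|exact F2]. simpl.
        replace (eta / (4 * 4 ^ n)) with (eta / 4 ^ n / 4) by (field; apply pow_nonzero; lra).
        lra. }
  destruct (geometric_limit (fun n => v (T n)) L) as [p Hp].
  { intros n. destruct (HT n) as [G [E _]]. rewrite <- E. apply Hnext; auto. }
  assert (L0 : 0 <= L).
  { unfold L, perimeter. assert (Q1 := Cmod_ge_0 (b - a)). assert (Q2 := Cmod_ge_0 (c - b)).
    assert (Q3 := Cmod_ge_0 (a - c)). lra. }
  assert (Small : forall eps, 0 < eps -> exists n, L / 2 ^ n < eps).
  { intros eps He. destruct (pow_lt_1_zero (/ 2) ltac:(rewrite Rabs_pos_eq; lra)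
      (eps / (L + 1))) as [N HN]; [apply Rdiv_lt_0_compat; lra|].
    exists N. specialize (HN N (Nat.le_refl _)). rewrite Rabs_pos_eq in HN by (apply pow_le; lra).
    rewrite pow_inv in HN. apply Rmult_lt_compat_r with (r := L + 1) in HN; [|lra].
    unfold Rdiv in HN at 1. rewrite Rmult_assoc, Rinv_l in HN by lra.
    assert (Q : 0 < / 2 ^ N) by (apply Rinv_0_lt_compat, pow_lt; lra). unfold Rdiv. nra. }
  assert (Hpr : Cmod p < r).
  { destruct (Small ((r - rho) / 8)) as [n Hn]; [lra|]. specialize (Hp n).
    destruct (HT n) as [G _]. destruct (T n) as [[x y] z]. destruct G as [G _].
    unfold v in Hp; simpl in Hp. rewrite Cmod_minus_sym in Hp.
    assert (Q := Cmod_rev_triangle p x). unfold Rdiv in *. lra. }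
  destruct (H p Hpr) as [l Hl].
  (* makes 12 eps L^2 smaller than eta *)
  set (eps := eta / (24 * (L * L + 1))).
  assert (He : 0 < eps) by (apply Rdiv_lt_0_compat; nra).
  destruct (Hl eps He) as [d [Pd Hd]].
  destruct (Small (d / 8)) as [n Hn]; [lra|].
  destruct (HT n) as [G [E1 E2]]. specialize (Hp n). unfold v in Hp.
  destruct (T n) as [[x y] z] eqn:ET. simpl in Hp, E1, E2, G.
  destruct G as [Gx [Gy Gz]].
  set (Ln := L / 2 ^ n) in *. replace (4 * L / 2 ^ n) with (4 * Ln) in Hp by (unfold Ln; field; apply pow_nonzero; lra).
  set (g := fun w => (f w - ((f p - l * p) + l * w))%C).
  assert (Q1 := Cmod_ge_0 (y - x)). assert (Q2 := Cmod_ge_0 (z - y)).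
  assert (Q3 := Cmod_ge_0 (x - z)). unfold perimeter in E1.
  assert (Bseg : forall u w, Cmod u <= rho -> Cmod w <= rho -> Cmod (u - x) <= Ln ->
     Cmod (w - u) <= Ln -> cont_seg g u w /\ Cmod (seg g u w) <= 2 * Cmod (w - u) * (eps * (6 * Ln))).
  { intros u w Hu Hw Hux Hwu.
    assert (Cg : cont_seg g u w).
    { intros t Ht. unfold g. apply cont_minus.
      - apply (holo_cont_seg r f u w); auto; lra.
      - apply cont_plus; [apply cont_const|].
        apply cont_mult; [apply cont_const|apply (cont_param zid)]. }
    split; auto. apply seg_bound; auto. intros t Ht.
    set (q := (u + t * (w - u))%C).
    assert (Hq : Cmod (q - p) <= 6 * Ln).
    { replace (q - p)%C with (t * (w - u) + ((u - x) + (x - p)))%C by (unfold q; ring).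
      eapply Rle_trans; [apply Cmod_triangle|].
      assert (Q := Cmod_triangle (u - x) (x - p)).
      rewrite Cmod_mult, Cmod_R, Rabs_pos_eq by lra.
      assert (Q' := Cmod_ge_0 (w - u)). nra. }
    specialize (Hd q). unfold zid in Hd. unfold g.
    replace (f q - (f p - l * p + l * q))%C with (f q - f p - l * (q - p))%C by ring.
    eapply Rle_trans; [apply Hd; lra|]. apply Rmult_le_compat_l; lra. }
  destruct (Bseg x y) as [C1 B1]; auto; try lra.
  { replace (x - x)%C with (RtoC 0) by ring. rewrite Cmod_0. lra. }
  destruct (Bseg y z) as [C2 B2]; auto; try lra.
  destruct (Bseg z x) as [C3 B3]; auto; try lra.
  { rewrite Cmod_minus_sym. lra. }
  assert (Etri : triangle_integral f x y z = triangle_integral g x y z).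
  { assert (A := tri_affine (f p - l * p) l x y z). unfold triangle_integral in *.
    assert (Cf : forall u w, Cmod u <= rho -> Cmod w <= rho -> cont_seg f u w)
      by (intros u w Hu Hw; apply (holo_cont_seg r); auto; lra).
    assert (Ca : forall u w, cont_seg (fun w => (f p - l * p) + l * w)%C u w).
    { intros u w t _. apply cont_plus; [apply cont_const|].
        apply cont_mult; [apply cont_const|apply (cont_param zid)]. }
    unfold g. rewrite !seg_minus by auto.
    replace (seg f x y + seg f y z + seg f z x)%C with
      (seg f x y + seg f y z + seg f z x - 0)%C by ring.
    rewrite <- A. ring. }
  rewrite Etri in E2. unfold triangle_integral in E2.
  assert (T1 := Cmod_triangle (seg g x y + seg g y z) (seg g z x)).
  assert (T2 := Cmod_triangle (seg g x y) (seg g y z)).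
  assert (F : eta / 4 ^ n <= 12 * eps * (Ln * Ln)).
  { assert (2 * (Cmod (y - x) + Cmod (z - y) + Cmod (x - z)) * (eps * (6 * Ln)) = 12 * eps * (Ln * Ln))
      by (rewrite E1; ring). lra. }
  assert (P4 : 0 < 4 ^ n) by (apply pow_lt; lra).
  replace (Ln * Ln) with (L * L / 4 ^ n) in F.
  2:{ unfold Ln. replace 4 with (2 * 2) by ring. rewrite Rpow_mult_distr. field.
      apply pow_nonzero; lra. }
  apply Rmult_le_compat_r with (r := 4 ^ n) in F; [|lra].
  replace (eta / 4 ^ n * 4 ^ n) with eta in F by (field; lra).
  replace (12 * eps * (L * L / 4 ^ n) * 4 ^ n) with (12 * eps * (L * L)) in F by (field; lra).
  assert (G : eps * (24 * (L * L + 1)) = eta) by (unfold eps; field; nra).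
  nra.
Qed.

(** By Goursat's theorem for the triangle 0, z, w, the increment of the integral from 0
    is the integral over the segment from z to w. *)
Theorem seg_primitive r f z : holo r f -> Cmod z < r -> der zid (seg f 0) z (f z).
Proof.
  intros H Hz eps He.
  destruct (holo_cont r f z H Hz (eps / 2)) as [d [Pd Hd]]; [lra|].
  exists (Rmin d (r - Cmod z)). split; [apply Rmin_pos; lra|].
  intros w Hw. unfold zid in Hw.
  assert (A := Rmin_l d (r - Cmod z)). assert (B := Rmin_r d (r - Cmod z)).
  assert (Hwr : Cmod w < r) by (assert (T := Cmod_rev_triangle w z); lra).
  assert (r0 : Cmod 0 < r) by (rewrite Cmod_0; assert (Q := Cmod_ge_0 z); lra).
  assert (G := goursat r f 0 z w H r0 Hz Hwr). unfold triangle_integral in G.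
  rewrite (seg_reverse f 0 w) in G by (apply (holo_cont_seg r); auto).
  assert (Ez : (seg f 0 w - seg f 0 z)%C = seg f z w).
  { replace (seg f 0 w - seg f 0 z)%C with (seg f z w -
      (seg f 0 z + seg f z w + - seg f 0 w))%C by ring. rewrite G. ring. }
  rewrite Ez.
  assert (Ec : (f z * (zid w - zid z))%C = seg (fun _ => f z) z w).
  { unfold seg, zid. rewrite Cint_const by lra. rewrite Rminus_0_r. ring. }
  assert (Cf : cont_seg f z w) by (apply (holo_cont_seg r); auto).
  assert (Cc : cont_seg (fun _ => f z) z w) by (intros t _; apply cont_const).
  rewrite Ec, <- seg_minus by auto. unfold zid.
  replace (eps * Cmod (w - z)) with (2 * Cmod (w - z) * (eps / 2)) by field.
  apply seg_bound.
  - intros t Ht. apply cont_minus; auto.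
  - intros t Ht. left. apply Hd. unfold zid.
    replace (z + t * (w - z) - z)%C with (t * (w - z))%C by ring.
    rewrite Cmod_mult, Cmod_R, Rabs_pos_eq by lra.
    assert (Q := Cmod_ge_0 (w - z)). nra.
Qed.

(** * Compactness, the circle and Cauchy transforms *)

(** A Lebesgue number: radii chosen locally on a compact interval can be replaced by one
    radius. *)
Lemma uniform_radius (P : R -> R -> Prop) a b :
  (forall d d' t, P d t -> 0 < d' <= d -> P d' t) ->
  (forall t, a <= t <= b -> exists d, 0 < d /\
     forall s, a <= s <= b -> Rabs (s - t) < d -> P d s) ->
  exists d, 0 < d /\ forall t, a <= t <= b -> P d t.
Proof.
  intros Mono H.
  assert (H' : forall t, exists d : posreal, a <= t <= b ->
     forall s, a <= s <= b -> Rabs (s - t) < d -> P d s).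
  { intros t. destruct (classic (a <= t <= b)) as [I|N].
    - destruct (H t I) as [d [Pd Hd]]. exists (mkposreal d Pd). auto.
    - exists (mkposreal 1 Rlt_0_1). tauto. }
  destruct (compactness_value_1d a b
    (fun t => proj1_sig (constructive_indefinite_description _ (H' t)))) as [d Hd].
  exists d. split; [apply cond_pos|]. intros s Hs. apply NNPP. intros N.
  apply (Hd s Hs). intros [t [It [Q1 Q2]]]. apply N.
  destruct (constructive_indefinite_description _ (H' t)) as [d' Hd']. simpl in *.
  apply (Mono d'); auto. split; [apply cond_pos|auto].
Qed.

Lemma cont_on_bounded a b f : cont_on a b f ->
  exists M, 0 < M /\ forall t, a <= t <= b -> Cmod (f t) <= M.
Proof.
  intros H. destruct (uniform_radius (fun d t => Cmod (f t) <= / d) a b) as [d [P Hd]].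
  - intros d d' t Q [P1 P2]. eapply Rle_trans; [exact Q|]. now apply Rinv_le_contravar.
  - intros t Ht. destruct (H t Ht 1 Rlt_0_1) as [d [P Hd]].
    assert (M0 : 0 < Cmod (f t) + 1) by (assert (Q := Cmod_ge_0 (f t)); lra).
    exists (Rmin d (/ (Cmod (f t) + 1))).
    split; [apply Rmin_pos; auto; now apply Rinv_0_lt_compat|].
    intros s _ Hs. assert (A := Rmin_l d (/ (Cmod (f t) + 1))).
    specialize (Hd s). rewrite <- RtoC_minus, Cmod_R in Hd. specialize (Hd ltac:(lra)).
    apply Rle_trans with (/ / (Cmod (f t) + 1)).
    + rewrite Rinv_inv. assert (T := Cmod_rev_triangle (f s) (f t)). lra.
    + apply Rinv_le_contravar; [apply Rmin_pos; auto; now apply Rinv_0_lt_compat|apply Rmin_r].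
  - exists (/ d). split; [now apply Rinv_0_lt_compat|auto].
Qed.

Lemma cont_on_bounded_below a b f : cont_on a b f -> (forall t, a <= t <= b -> f t <> 0) ->
  exists m, 0 < m /\ forall t, a <= t <= b -> m <= Cmod (f t).
Proof.
  intros H N. destruct (cont_on_bounded a b (fun t => / f t)%C) as [M [P HM]].
  - intros t Ht. apply cont_inv; auto.
  - exists (/ M). split; [now apply Rinv_0_lt_compat|]. intros t Ht.
    specialize (HM t Ht). rewrite Cmod_inv in HM by auto.
    rewrite <- (Rinv_inv (Cmod (f t))). apply Rinv_le_contravar; [|exact HM].
    apply Rinv_0_lt_compat. apply Cmod_gt_0. auto.
Qed.

(** Differentiation under the integral sign, when the first-order expansion of the
    integrand is uniform in the variable of integration. *)
Lemma der_Cint {X} (e : X -> C) (k : X -> R -> C) k' x a b : a <= b ->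
  (forall eps, 0 < eps -> exists d, 0 < d /\ forall y, Cmod (e y - e x) < d ->
     cont_on a b (k y) /\ forall t, a <= t <= b ->
       Cmod (k y t - k x t - k' t * (e y - e x)) <= eps * Cmod (e y - e x)) ->
  cont_on a b k' ->
  der e (fun y => Cint (k y) a b) x (Cint k' a b).
Proof.
  intros L H Hk' eps He.
  destruct (H (eps / (2 * (b - a + 1)))) as [d [Pd Hd]]; [apply Rdiv_lt_0_compat; lra|].
  assert (Cx : cont_on a b (k x)).
  { apply Hd. replace (e x - e x)%C with (RtoC 0) by ring. rewrite Cmod_0. exact Pd. }
  exists d. split; auto. intros y Hy. destruct (Hd y Hy) as [Cy By].
  assert (Cl : cont_on a b (fun t => (e y - e x) * k' t)%C).
  { intros t Ht. apply cont_mult; [apply cont_const|auto]. }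
  assert (Cm : cont_on a b (fun t => k y t - k x t)%C).
  { intros t Ht. apply cont_minus; auto. }
  rewrite (Cmult_comm (Cint k' a b)), <- Cint_scal, <- !Cint_minus by auto.
  set (M := eps / (2 * (b - a + 1)) * Cmod (e y - e x)) in *.
  apply Rle_trans with (2 * (b - a) * M).
  - apply Cint_bound; auto.
    + intros t Ht. apply cont_minus; auto.
    + intros t Ht. rewrite (Cmult_comm (e y - e x)). auto.
  - unfold M. assert (Q := Cmod_ge_0 (e y - e x)).
    replace (2 * (b - a) * (eps / (2 * (b - a + 1)) * Cmod (e y - e x))) with
      (eps * Cmod (e y - e x) * ((b - a) / (b - a + 1))) by (field; lra).
    rewrite <- (Rmult_1_r (eps * Cmod (e y - e x))) at 2.
    apply Rmult_le_compat_l; [nra|].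
    apply Rmult_le_reg_r with (b - a + 1); [lra|]. unfold Rdiv.
    rewrite Rmult_assoc, Rinv_l by lra. lra.
Qed.

Definition cis (t : R) : C := (cos t, sin t).

Lemma Cmod_cis t : Cmod (cis t) = 1.
Proof.
  unfold Cmod, cis; simpl. replace (cos t * (cos t * 1) + sin t * (sin t * 1)) with 1.
  - apply sqrt_1.
  - assert (Q := sin2_cos2 t). unfold Rsqr in Q. lra.
Qed.

Lemma Cmod_circle r t : 0 <= r -> Cmod (r * cis t) = r.
Proof. intros H. rewrite Cmod_mult, Cmod_cis, Cmod_R, Rabs_pos_eq; lra. Qed.

Lemma cis_period : cis (2 * PI) = cis 0.
Proof. unfold cis. now rewrite cos_2PI, sin_2PI, cos_0, sin_0. Qed.

Lemma der_cis t : der RtoC cis t (Ci * cis t)%C.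
Proof.
  replace (Ci * cis t)%C with ((- sin t, cos t) : C)
    by (unfold Ci, cis, Cmult; simpl; f_equal; ring).
  apply parts_der_R; [apply is_derive_cos|apply is_derive_sin].
Qed.

Lemma cont_cis t : cont RtoC cis t.
Proof. exact (der_cont _ _ _ _ (der_cis t)). Qed.

Lemma polar z : exists t, 0 <= t <= 2 * PI /\ z = (Cmod z * cis t)%C.
Proof.
  assert (HPI := PI_RGT_0).
  destruct (classic (z = 0)) as [->|N].
  { exists 0. split; [lra|]. rewrite Cmod_0. ring. }
  assert (P := proj1 (Cmod_gt_0 z) N). set (r := Cmod z) in *.
  set (x := fst z / r). set (y := snd z / r).
  assert (Ezr : fst z ^ 2 + snd z ^ 2 = r * r).
  { unfold r, Cmod. rewrite sqrt_sqrt; [auto|]. assert (A := pow2_ge_0 (fst z)).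
    assert (B := pow2_ge_0 (snd z)). lra. }
  assert (E : x * x + y * y = 1).
  { unfold x, y. replace (fst z / r * (fst z / r) + snd z / r * (snd z / r))
      with ((fst z ^ 2 + snd z ^ 2) / (r * r)) by (field; lra). rewrite Ezr. field; lra. }
  assert (Bx : -1 <= x <= 1) by nra.
  assert (B := acos_bound x). assert (Ca := cos_acos x Bx).
  assert (Sa : sin (acos x) * sin (acos x) = y * y).
  { assert (Q := sin2_cos2 (acos x)). unfold Rsqr in Q. rewrite Ca in Q. lra. }
  assert (Sp : 0 <= sin (acos x)) by (apply sin_ge_0; lra).
  assert (Zxy : z = (r * (x, y))%C).
  { destruct z as [z1 z2]. unfold x, y, RtoC, Cmult; simpl. f_equal; field; lra. }
  destruct (Rle_lt_dec 0 y) as [Hy|Hy].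
  - exists (acos x). split; [lra|]. rewrite Zxy. f_equal. unfold cis. rewrite Ca. f_equal. nra.
  - exists (2 * PI - acos x). split; [lra|]. rewrite Zxy. f_equal. unfold cis.
    rewrite cos_minus, sin_minus, cos_2PI, sin_2PI, Ca. f_equal; [ring|]. nra.
Qed.

(** A first-order expansion with a uniform quadratic remainder on a closed disk.  It
    survives integration over a parameter, and it forces f' to be continuous. *)
Definition quad_remainder (f f' : C -> C) (rho : R) : Prop :=
  exists K, 0 < K /\ forall z w, Cmod z <= rho -> Cmod w <= rho ->
    Cmod (f w - f z - f' z * (w - z)) <= K * (Cmod (w - z) * Cmod (w - z)).

Lemma quad_der f f' rho z : quad_remainder f f' rho -> Cmod z < rho -> der zid f z (f' z).
Proof.
  intros [K [K0 H]] Hz eps He.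
  exists (Rmin (rho - Cmod z) (eps / K)). split.
  { apply Rmin_pos; [lra|]. now apply Rdiv_lt_0_compat. }
  intros w Hw. unfold zid in *.
  assert (A := Rmin_l (rho - Cmod z) (eps / K)). assert (B := Rmin_r (rho - Cmod z) (eps / K)).
  assert (T := Cmod_rev_triangle w z). assert (Q := Cmod_ge_0 (w - z)).
  eapply Rle_trans; [apply H; lra|]. rewrite <- Rmult_assoc. apply Rmult_le_compat_r; [auto|].
  apply Rle_trans with (K * (eps / K)); [apply Rmult_le_compat_l; lra|]. right. field; lra.
Qed.

(** Adding the expansions at z and at w leaves (f' w - f' z) (w - z) = O(|w - z|^2). *)
Lemma quad_cont f f' rho z : quad_remainder f f' rho -> Cmod z < rho -> cont zid f' z.
Proof.
  intros [K [K0 H]] Hz eps He.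
  exists (Rmin (rho - Cmod z) (eps / (2 * K))). split.
  { apply Rmin_pos; [lra|]. apply Rdiv_lt_0_compat; lra. }
  intros w Hw. unfold zid in *.
  assert (A := Rmin_l (rho - Cmod z) (eps / (2 * K))).
  assert (B := Rmin_r (rho - Cmod z) (eps / (2 * K))).
  assert (T := Cmod_rev_triangle w z). assert (Q := Cmod_ge_0 (w - z)).
  destruct (classic (w = z)) as [->|N].
  { replace (f' z - f' z)%C with (RtoC 0) by ring. rewrite Cmod_0. exact He. }
  assert (P := proj1 (Cmod_gt_0 _) (Cminus_eq_contra _ _ N)).
  assert (H1 := H z w ltac:(lra) ltac:(lra)). assert (H2 := H w z ltac:(lra) ltac:(lra)).
  rewrite (Cmod_minus_sym z w) in H2.
  assert (S := Cmod_triangle (f w - f z - f' z * (w - z)) (f z - f w - f' w * (z - w))).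
  replace (f w - f z - f' z * (w - z) + (f z - f w - f' w * (z - w)))%C with
    ((f' w - f' z) * (w - z))%C in S by ring.
  rewrite Cmod_mult in S.
  apply Rle_lt_trans with (2 * K * Cmod (w - z)).
  - apply Rmult_le_reg_r with (Cmod (w - z)); [auto|]. lra.
  - apply Rlt_le_trans with (2 * K * (eps / (2 * K))); [apply Rmult_lt_compat_l; lra|].
    right. field; lra.
Qed.

(** The Cauchy integral of order n of a density on the circle |z| = r. *)
Definition cauchy_transform (r : R) (phi : R -> C) (n : nat) (z : C) : C :=
  Cint (fun t => phi t * / (r * cis t - z) ^ n)%C 0 (2 * PI).

Lemma circle_gap r z t : Cmod z < r -> r - Cmod z <= Cmod (r * cis t - z).
Proof.
  intros H. assert (Q := Cmod_ge_0 z).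
  rewrite <- (Cmod_circle r t) at 1 by lra. apply Cmod_rev_triangle.
Qed.

Lemma circle_neq r z t : Cmod z < r -> (r * cis t - z)%C <> 0.
Proof. intros H. apply Cmod_gt_0. assert (Q := circle_gap r z t H). lra. Qed.

Lemma cont_pow {X} (e : X -> C) f x n : cont e f x -> cont e (fun y => f y ^ n)%C x.
Proof. intros H. induction n; simpl; cont_tac. Qed.

Lemma transform_cont_on r phi n z : Cmod z < r -> cont_on 0 (2 * PI) phi ->
  cont_on 0 (2 * PI) (fun t => phi t * / (r * cis t - z) ^ n)%C.
Proof.
  intros Hz H t Ht. apply cont_mult; auto. apply cont_inv.
  - apply cont_pow. apply cont_minus; [|apply cont_const].
    apply cont_mult; [apply cont_const|apply cont_cis].
  - apply Cpow_nz. now apply circle_neq.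
Qed.

(** With A = r cis t - z and B' = r cis t - w, the expansion of the transform of order n
    follows from that of B'^-n around A. *)
Lemma transform_quad_gen r rho phi n (k : C) B :
  0 <= rho -> rho < r -> cont_on 0 (2 * PI) phi -> 0 < B ->
  (forall A B' : C, r - rho <= Cmod A -> r - rho <= Cmod B' -> Cmod A <= 2 * r ->
     Cmod B' <= 2 * r ->
     Cmod (/ B' ^ n - / A ^ n - k * / A ^ S n * (A - B')) <= B * (Cmod (A - B') * Cmod (A - B'))) ->
  quad_remainder (cauchy_transform r phi n) (fun z => k * cauchy_transform r phi (S n) z)%C rho.
Proof.
  intros Hrho Hr Hphi HB H. assert (HPI := PI_RGT_0).
  destruct (cont_on_bounded _ _ _ Hphi) as [M [M0 HM]].
  exists (2 * (2 * PI - 0) * (M * B)). split; [apply Rmult_lt_0_compat; nra|].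
  intros z w Hz Hw. unfold cauchy_transform.
  assert (C1 := fun m => transform_cont_on r phi m w ltac:(lra) Hphi).
  assert (C2 := fun m => transform_cont_on r phi m z ltac:(lra) Hphi).
  assert (C3 : cont_on 0 (2 * PI)
    (fun t => k * (w - z) * (phi t * / (r * cis t - z) ^ S n))%C).
  { intros t Ht. apply cont_mult; [apply cont_const|now apply C2]. }
  rewrite <- Cint_minus by (auto; lra).
  replace (k * Cint (fun t => phi t * / (r * cis t - z) ^ S n) 0 (2 * PI) * (w - z))%C with
    (Cint (fun t => k * (w - z) * (phi t * / (r * cis t - z) ^ S n)) 0 (2 * PI))%C
    by (rewrite Cint_scal by (auto; lra); ring).
  rewrite <- Cint_minus; auto; try lra.
  2:{ intros t Ht. apply cont_minus; [now apply C1|now apply C2]. }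
  eapply Rle_trans.
  - apply Cint_bound with (M := M * B * (Cmod (w - z) * Cmod (w - z))); [lra| |].
    + intros t Ht. apply cont_minus; [apply cont_minus; [now apply C1|now apply C2]|now apply C3].
    + intros t Ht. set (A := (r * cis t - z)%C). set (B' := (r * cis t - w)%C).
      replace (phi t * / B' ^ n - phi t * / A ^ n - k * (w - z) * (phi t * / A ^ S n))%C
        with (phi t * (/ B' ^ n - / A ^ n - k * / A ^ S n * (A - B')))%C
        by (unfold A, B'; ring).
      rewrite Cmod_mult. replace (w - z)%C with (A - B')%C by (unfold A, B'; ring).
      assert (Q := Cmod_ge_0 (A - B')). rewrite Rmult_assoc.
      apply Rmult_le_compat; auto using Cmod_ge_0.
      assert (G1 := circle_gap r z t ltac:(lra)). assert (G2 := circle_gap r w t ltac:(lra)).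
      assert (T1 := Cmod_triangle_minus (r * cis t) z).
      assert (T2 := Cmod_triangle_minus (r * cis t) w).
      rewrite Cmod_circle in T1, T2 by lra. fold A in G1, T1. fold B' in G2, T2.
      apply H; lra.
  - right. ring.
Qed.

Lemma transform_quad1 r rho phi : 0 <= rho -> rho < r -> cont_on 0 (2 * PI) phi ->
  quad_remainder (cauchy_transform r phi 1) (fun z => 1 * cauchy_transform r phi 2 z)%C rho.
Proof.
  intros H0 H1 Hphi. set (d := r - rho). assert (d0 : 0 < d) by (unfold d; lra).
  apply (transform_quad_gen r rho phi 1 1 (/ (d * d * d))); auto.
  { apply Rinv_0_lt_compat. repeat apply Rmult_lt_0_compat; auto. }
  fold d. intros A B HA HB _ _.
  assert (NA : A <> 0) by (apply Cmod_gt_0; lra). assert (NB : B <> 0) by (apply Cmod_gt_0; lra).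
  replace (/ B ^ 1 - / A ^ 1 - 1 * / A ^ 2 * (A - B))%C with
    ((A - B) * (A - B) * / (A * A * B))%C by (simpl; field; auto).
  rewrite Cmod_mult, Rmult_comm, (Cmod_mult (A - B)).
  apply Rmult_le_compat_r; [assert (Q := Cmod_ge_0 (A - B)); nra|].
  rewrite Cmod_inv by (repeat apply Cmult_neq_0; auto). rewrite !Cmod_mult.
  apply Rinv_le_contravar; [repeat apply Rmult_lt_0_compat; auto|].
  repeat apply Rmult_le_compat; try lra; nra.
Qed.

Lemma transform_quad2 r rho phi : 0 <= rho -> rho < r -> cont_on 0 (2 * PI) phi ->
  quad_remainder (cauchy_transform r phi 2) (fun z => 2 * cauchy_transform r phi 3 z)%C rho.
Proof.
  intros H0 H1 Hphi. set (d := r - rho). assert (d0 : 0 < d) by (unfold d; lra).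
  assert (D5 : 0 < d * d * d * d * d) by (repeat apply Rmult_lt_0_compat; auto).
  apply (transform_quad_gen r rho phi 2 2 (6 * r * / (d * d * d * d * d))); auto.
  { apply Rmult_lt_0_compat; [lra|]. now apply Rinv_0_lt_compat. }
  fold d. intros A B HA HB UA UB.
  assert (NA : A <> 0) by (apply Cmod_gt_0; lra). assert (NB : B <> 0) by (apply Cmod_gt_0; lra).
  replace (/ B ^ 2 - / A ^ 2 - 2 * / A ^ 3 * (A - B))%C with
    ((A - B) * (A - B) * ((A + B + B) * / (A * A * A * B * B)))%C by (simpl; field; auto).
  rewrite Cmod_mult, Rmult_comm, (Cmod_mult (A - B)).
  apply Rmult_le_compat_r; [assert (Q := Cmod_ge_0 (A - B)); nra|].
  rewrite Cmod_mult. apply Rmult_le_compat; try apply Cmod_ge_0.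
  - assert (T1 := Cmod_triangle (A + B) B). assert (T2 := Cmod_triangle A B). lra.
  - rewrite Cmod_inv by (repeat apply Cmult_neq_0; auto). rewrite !Cmod_mult.
    apply Rinv_le_contravar; auto.
    assert (0 <= d * d * d * d) by (repeat apply Rmult_le_pos; lra).
    repeat apply Rmult_le_compat; repeat apply Rmult_le_pos; lra.
Qed.

(** * The Cauchy formula for functions with a continuous derivative *)

(** The derivative of the parametrised circle t |-> r cis t. *)
Definition vel (r : R) (t : R) : C := (r * (Ci * cis t))%C.

Lemma der_circle (r t : R) : der RtoC (fun t => r * cis t)%C t (vel r t).
Proof. apply der_scal, der_cis. Qed.

Lemma cont_vel r t : cont RtoC (vel r) t.
Proof.
  unfold vel. apply cont_mult; [apply cont_const|]. apply cont_mult; [apply cont_const|].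
  apply cont_cis.
Qed.

Lemma cont_circle (r t : R) : cont RtoC (fun t => r * cis t)%C t.
Proof. exact (der_cont _ _ _ _ (der_circle r t)). Qed.

Lemma Cmod_vel r t : 0 <= r -> Cmod (vel r t) = r.
Proof. intros H. unfold vel. rewrite !Cmod_mult, Cmod_Ci, Cmod_cis, Cmod_R, Rabs_pos_eq; lra. Qed.

(** The mean value inequality for u |-> F u - f x * u.  Both end points may vary, so the
    estimate is uniform near q. *)
Lemma strict_der R0 F f q eps :
  (forall z, Cmod z < R0 -> der zid F z (f z)) -> (forall z, Cmod z < R0 -> cont zid f z) ->
  Cmod q < R0 -> 0 < eps ->
  exists d, 0 < d /\ forall x y, Cmod (x - q) < d -> Cmod (y - q) < d ->
    Cmod (F y - F x - f x * (y - x)) <= eps * Cmod (y - x).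
Proof.
  intros HF Hf Hq He. destruct (Hf q Hq (eps / 4)) as [d [Pd Hd]]; [lra|].
  exists (Rmin d (R0 - Cmod q)). split; [apply Rmin_pos; lra|].
  intros x y Hx Hy.
  assert (A := Rmin_l d (R0 - Cmod q)). assert (B := Rmin_r d (R0 - Cmod q)).
  assert (In : forall z, Cmod (z - q) < Rmin d (R0 - Cmod q) -> Cmod z < R0).
  { intros z Hz. assert (T := Cmod_rev_triangle z q). lra. }
  assert (Seg : forall t : R, 0 <= t <= 1 ->
            Cmod (x + t * (y - x) - q) < Rmin d (R0 - Cmod q)).
  { intros t Ht. replace (x + t * (y - x) - q)%C with ((x - q) + t * ((y - q) - (x - q)))%C by ring.
    now apply Cmod_convex_lt. }
  assert (Cf : cont_seg f x y) by (intros t Ht; apply Hf, In, Seg, Ht).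
  assert (Cc : cont_seg (fun _ => f x) x y) by (intros t _; apply cont_const).
  assert (E : (F y - F x - f x * (y - x))%C = seg (fun z => f z - f x)%C x y).
  { rewrite seg_minus by auto. rewrite (seg_FTC F f) by (auto; intros; apply HF, In, Seg; auto).
    unfold seg at 1. rewrite Cint_const by lra. rewrite Rminus_0_r. ring. }
  rewrite E. replace (eps * Cmod (y - x)) with (2 * Cmod (y - x) * (eps / 2)) by field.
  apply seg_bound; [intros t Ht; apply cont_minus; auto|].
  intros t Ht. eapply Rle_trans; [apply (Cmod_tri3 _ (f q))|].
  rewrite (Cmod_minus_sym (f q)).
  assert (K1 := Hd (x + t * (y - x))%C). assert (K2 := Hd x). unfold zid in *.
  specialize (Seg t Ht). specialize (K1 ltac:(lra)). specialize (K2 ltac:(lra)). lra.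
Qed.

Lemma const_of_der_zero (k : R -> C) :
  (forall t, 0 <= t <= 1 -> der RtoC k t 0) -> k 1 = k 0.
Proof.
  intros H. assert (E := Cint_FTC 0 1 k (fun _ => RtoC 0) ltac:(lra) H).
  rewrite Cint_const in E by lra. apply Ceq_minus. rewrite <- E.
  - rewrite Rminus_0_r. ring.
  - intros t _. apply cont_const.
Qed.

Lemma closed_integral F f : (forall t, der RtoC F t (f t)) -> (forall t, cont RtoC f t) ->
  F (2 * PI) = F 0 -> Cint f 0 (2 * PI) = 0.
Proof.
  intros HF Hf E. assert (HPI := PI_RGT_0). rewrite (Cint_FTC _ _ F); auto; [|lra|intros t _; auto].
  rewrite E. ring.
Qed.

(** 1 / (z - a)^2 has a primitive along the circle, so the integral of 1 / (z - a) does not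
    depend on a; at the centre the integrand is the constant i. *)
Lemma index_circle r a : Cmod a < r -> cauchy_transform r (vel r) 1 a = (2 * PI * Ci)%C.
Proof.
  intros Ha. assert (a0 := Cmod_ge_0 a). assert (HPI := PI_RGT_0).
  assert (Cv : cont_on 0 (2 * PI) (vel r)) by (intros t _; apply cont_vel).
  assert (Z : forall z, Cmod z < r -> cauchy_transform r (vel r) 2 z = 0).
  { intros z Hz. unfold cauchy_transform.
    apply (closed_integral (fun t => - / (r * cis t - z))%C).
    - intros t. eapply der_eq.
      + apply der_opp. apply der_inv; [|now apply circle_neq].
        apply der_minus; [apply der_circle|apply der_const].
      + assert (N := circle_neq r z t Hz). simpl. field. exact N.
    - intros t. apply cont_mult; [apply cont_vel|]. apply cont_inv.
      + apply cont_pow. apply cont_minus; [apply cont_circle|apply cont_const].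
      + apply Cpow_nz. now apply circle_neq.
    - now rewrite cis_period. }
  assert (E : cauchy_transform r (vel r) 1 (1 * a)%C = cauchy_transform r (vel r) 1 (0 * a)%C).
  { apply (const_of_der_zero (fun t : R => cauchy_transform r (vel r) 1 (t * a)%C)).
    intros t Ht.
    assert (Hta : Cmod (t * a) < (Cmod a + r) / 2).
    { rewrite Cmod_mult, Cmod_R, Rabs_pos_eq by lra. nra. }
    apply der_eq with ((1 * cauchy_transform r (vel r) 2 (t * a)) * (1 * a + t * 0))%C.
    - apply (der_comp RtoC _ (fun t : R => t * a)%C).
      + apply (quad_der _ (fun z => 1 * cauchy_transform r (vel r) 2 z)%C ((Cmod a + r) / 2)); auto.
        apply transform_quad1; auto; lra.
      + apply (der_mult RtoC RtoC (fun _ => a)); [apply der_param|apply der_const].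
    - rewrite Z by lra. ring. }
  replace (1 * a)%C with a in E by ring. replace (0 * a)%C with (RtoC 0) in E by ring.
  rewrite E. unfold cauchy_transform.
  rewrite (Cint_ext _ _ _ (fun _ => Ci)); [|lra|].
  - rewrite Cint_const by lra. rewrite Rminus_0_r, RtoC_mult. ring.
  - intros t _. assert (N := circle_neq r 0 t ltac:(rewrite Cmod_0; lra)).
    replace (r * cis t - 0)%C with (r * cis t)%C in * by ring.
    assert (N1 : RtoC r <> 0) by (apply RtoC_neq; lra).
    assert (N2 : cis t <> 0) by (apply Cmod_gt_0; rewrite Cmod_cis; lra).
    unfold vel. simpl. field. auto.
Qed.

(** Shrink the circle linearly to the point a.  The derivative of the integral with
    respect to the shrinking parameter is the integral of an exact derivative over a
    closed curve, hence 0.  For the degenerate circle the integral is F a times the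
    integral of 1 / (z - a). *)
Theorem cauchy_C1 R0 r F f a :
  (forall z, Cmod z < R0 -> der zid F z (f z)) -> (forall z, Cmod z < R0 -> cont zid f z) ->
  r < R0 -> Cmod a < r ->
  cauchy_transform r (fun t => F (r * cis t) * vel r t)%C 1 a = (2 * PI * Ci * F a)%C.
Proof.
  intros HF Hf HrR Ha. assert (a0 := Cmod_ge_0 a). assert (HPI := PI_RGT_0).
  set (p := fun (t s : R) => (a + t * (r * cis s - a))%C).
  set (w := fun s => (vel r s * / (r * cis s - a) ^ 1)%C).
  assert (Cw : cont_on 0 (2 * PI) w).
  { intros s Hs. apply transform_cont_on; auto. intros s' _. apply cont_vel. }
  assert (Hp : forall t s, 0 <= t <= 1 -> Cmod (p t s) < R0).
  { intros t s Ht. apply Rle_lt_trans with r; auto. apply Cmod_convex; auto; [lra|].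
    rewrite Cmod_circle; lra. }
  assert (Cp : forall t s, cont RtoC (p t) s).
  { intros t s. unfold p. apply cont_plus; [apply cont_const|]. apply cont_mult; [apply cont_const|].
    apply cont_minus; [apply cont_circle|apply cont_const]. }
  assert (Gap : forall s, Cmod (r * cis s - a) <= 2 * r).
  { intros s. assert (T := Cmod_triangle_minus (r * cis s) a). rewrite Cmod_circle in T; lra. }
  (* p t is the circle for t = 1 and the point a for t = 0 *)
  set (K := fun t => Cint (fun s => F (p t s) * w s)%C 0 (2 * PI)).
  assert (DK : forall t, 0 <= t <= 1 -> der RtoC K t
            (Cint (fun s => f (p t s) * vel r s)%C 0 (2 * PI))).
  { intros t0 Ht0. apply (der_Cint RtoC (fun t s => F (p t s) * w s)%C); [lra| |].
    2:{ intros s _. apply cont_mult; [|apply cont_vel]. apply (cont_comp RtoC f (p t0)); auto. }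
    destruct (cont_on_bounded _ _ _ Cw) as [M [M0 HM]].
    intros eps He. set (eps' := eps / (2 * r * M)).
    assert (He' : 0 < eps') by (apply Rdiv_lt_0_compat; nra).
    destruct (uniform_radius (fun d s => forall t, Rabs (t - t0) < d -> Cmod (p t s) < R0 /\
       Cmod (F (p t s) - F (p t0 s) - f (p t0 s) * (p t s - p t0 s)) <=
         eps' * Cmod (p t s - p t0 s)) 0 (2 * PI)) as [d [Pd Hd]].
    - intros d d' s H [P1 P2] t Ht. apply H. lra.
    - intros s _.
      destruct (strict_der R0 F f (p t0 s) eps' HF Hf (Hp _ _ Ht0) He') as [d [Pd Hd]].
      set (d1 := Rmin d (R0 - Cmod (p t0 s))).
      assert (Pd1 : 0 < d1) by (apply Rmin_pos; auto; assert (Q := Hp t0 s Ht0); lra).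
      assert (A := Rmin_l d (R0 - Cmod (p t0 s))). assert (B := Rmin_r d (R0 - Cmod (p t0 s))).
      fold d1 in A, B.
      destruct (Cp t0 s (d1 / 2)) as [d2 [Pd2 Hd2]]; [lra|].
      exists (Rmin d2 (d1 / (4 * r))). split; [apply Rmin_pos; auto; apply Rdiv_lt_0_compat; lra|].
      assert (A' := Rmin_l d2 (d1 / (4 * r))). assert (B' := Rmin_r d2 (d1 / (4 * r))).
      intros s' _ Hs' t Ht. specialize (Hd2 s'). rewrite <- RtoC_minus, Cmod_R in Hd2.
      specialize (Hd2 ltac:(lra)).
      assert (Ept : (p t s' - p t0 s')%C = ((t - t0)%R * (r * cis s' - a))%C)
        by (unfold p; rewrite RtoC_minus; ring).
      assert (Bpt : Cmod (p t s' - p t0 s') < d1 / 2).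
      { rewrite Ept, Cmod_mult, Cmod_R.
        apply Rle_lt_trans with (Rabs (t - t0) * (2 * r)).
        - apply Rmult_le_compat_l; [apply Rabs_pos|apply Gap].
        - apply Rlt_le_trans with (d1 / (4 * r) * (2 * r)).
          + apply Rmult_lt_compat_r; lra.
          + right. field. lra. }
      assert (T := Cmod_tri3 (p t s') (p t0 s') (p t0 s)).
      split.
      + assert (T' := Cmod_rev_triangle (p t s') (p t0 s)). lra.
      + apply Hd; lra.
    - exists (Rmin d (Rmin d 1)). split; [repeat apply Rmin_pos; lra|]. intros t Ht.
      assert (A := Rmin_l d (Rmin d 1)).
      rewrite <- RtoC_minus, Cmod_R in *. specialize (fun s Hs => Hd s Hs t ltac:(lra)).
      split.
      + intros s Hs. apply cont_mult; [|now apply Cw]. apply (cont_comp RtoC F (p t)); auto.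
        apply (der_cont zid F _ (f (p t s))). apply HF. now apply Hd.
      + intros s Hs. destruct (Hd s Hs) as [_ Q].
        assert (N := circle_neq r a s Ha).
        replace (f (p t0 s) * vel r s * (t - t0)%R)%C with (f (p t0 s) * (p t s - p t0 s) * w s)%C.
        2:{ unfold p, w. rewrite RtoC_minus. simpl. field. exact N. }
        replace (F (p t s) * w s - F (p t0 s) * w s - f (p t0 s) * (p t s - p t0 s) * w s)%C
          with ((F (p t s) - F (p t0 s) - f (p t0 s) * (p t s - p t0 s)) * w s)%C by ring.
        rewrite Cmod_mult.
        apply Rle_trans with (eps' * (Rabs (t - t0) * (2 * r)) * M).
        * apply Rmult_le_compat; auto using Cmod_ge_0.
          eapply Rle_trans; [exact Q|]. apply Rmult_le_compat_l; [lra|].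
          replace (p t s - p t0 s)%C with ((t - t0)%R * (r * cis s - a))%C
            by (unfold p; rewrite RtoC_minus; ring).
          rewrite Cmod_mult, Cmod_R. apply Rmult_le_compat_l; [apply Rabs_pos|apply Gap].
        * right. unfold eps'. field. lra. }
  assert (Z : forall t, 0 <= t <= 1 -> Cint (fun s => f (p t s) * vel r s)%C 0 (2 * PI) = 0).
  { intros t Ht.
    assert (Cf : forall s, cont RtoC (fun s => f (p t s) * vel r s)%C s).
    { intros s. apply cont_mult; [|apply cont_vel]. apply (cont_comp RtoC f (p t)); auto. }
    destruct (Req_dec t 0) as [->|N].
    - apply (closed_integral (fun s => f a * (r * cis s))%C); auto.
      + intros s. eapply der_eq; [apply der_scal, der_circle|]. unfold p.
        replace (a + 0 * (r * cis s - a))%C with a by ring. reflexivity.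
      + now rewrite cis_period.
    - assert (N' : RtoC t <> 0) by now apply RtoC_neq.
      apply (closed_integral (fun s => / t * F (p t s))%C); auto.
      + intros s. apply der_eq with (/ t * (f (p t s) * (0 + t * (vel r s - 0))))%C.
        * apply der_scal. apply (der_comp RtoC F (p t)); [apply HF; auto|].
          unfold p. apply der_plus; [apply der_const|]. apply der_scal.
          apply der_minus; [apply der_circle|apply der_const].
        * field. exact N'.
      + unfold p. now rewrite cis_period. }
  assert (E : K 1 = K 0).
  { apply const_of_der_zero. intros t Ht. rewrite <- (Z t Ht). now apply DK. }
  assert (E1 : cauchy_transform r (fun t => F (r * cis t) * vel r t)%C 1 a = K 1).
  { unfold cauchy_transform, K. apply Cint_ext; [lra|]. intros s _. unfold p, w.
    replace (a + 1 * (r * cis s - a))%C with (r * cis s)%C by ring. ring. }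
  rewrite E1, E. unfold K.
  rewrite (Cint_ext _ _ _ (fun s => F a * w s)%C).
  - rewrite Cint_scal; auto; [|lra]. unfold w. fold (cauchy_transform r (vel r) 1 a).
    rewrite index_circle by auto. ring.
  - lra.
  - intros s _. unfold p. replace (a + 0 * (r * cis s - a))%C with a by ring. reflexivity.
Qed.

(** * Holomorphic functions on a disk *)

Lemma der_C_derive f z l : der zid f z l -> C_derive f z = l.
Proof. intros H. apply is_C_derive_unique. now apply der_is_derive. Qed.

Lemma holo_der R0 f z : holo R0 f -> Cmod z < R0 -> der zid f z (C_derive f z).
Proof. intros H Hz. destruct (H z Hz) as [l Hl]. now rewrite (der_C_derive _ _ _ Hl). Qed.

Lemma disk_nbhd r z : Cmod z < r ->
  exists d, 0 < d /\ forall w, Cmod (zid w - zid z) < d -> Cmod w < r.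
Proof.
  intros H. exists (r - Cmod z). split; [lra|]. intros w Hw. unfold zid in Hw.
  assert (T := Cmod_rev_triangle w z). lra.
Qed.

Lemma der_ext_disk r f g z l : (forall w, Cmod w < r -> f w = g w) -> Cmod z < r ->
  der zid f z l -> der zid g z l.
Proof.
  intros E Hz H. apply (der_local zid f); auto. destruct (disk_nbhd r z Hz) as [d [P Hd]].
  exists d. split; auto.
Qed.

Lemma holo_le r r' f : r <= r' -> holo r' f -> holo r f.
Proof. intros L H z Hz. apply H. lra. Qed.

Lemma quad_le f f' r r' : r <= r' -> quad_remainder f f' r' -> quad_remainder f f' r.
Proof. intros L [K [P H]]. exists K. split; auto. intros z w Hz Hw. apply H; lra. Qed.

Lemma quad_ext f f' g g' r : (forall z, Cmod z <= r -> f z = g z) ->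
  (forall z, Cmod z <= r -> f' z = g' z) -> quad_remainder f f' r -> quad_remainder g g' r.
Proof.
  intros E E' [K [P H]]. exists K. split; auto. intros z w Hz Hw.
  rewrite <- !E, <- E' by auto. auto.
Qed.

Lemma quad_scal (c : C) f f' r : c <> RtoC 0 -> quad_remainder f f' r ->
  quad_remainder (fun z => c * f z)%C (fun z => c * f' z)%C r.
Proof.
  intros N [K [P H]]. assert (Pc := proj1 (Cmod_gt_0 c) N).
  exists (Cmod c * K). split; [nra|]. intros z w Hz Hw.
  replace (c * f w - c * f z - c * f' z * (w - z))%C with (c * (f w - f z - f' z * (w - z)))%C by ring.
  rewrite Cmod_mult, Rmult_assoc. apply Rmult_le_compat_l; auto. lra.
Qed.

Lemma two_pi_i_neq : (2 * PI * Ci)%C <> 0.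
Proof.
  assert (H := PI_RGT_0). repeat apply Cmult_neq_0; [| |apply Ci_nz]; apply RtoC_neq; lra.
Qed.

(** The form f(z) dz on the circle |z| = r. *)
Definition boundary_density (f : C -> C) (r : R) (t : R) : C := (f (r * cis t) * vel r t)%C.

Lemma boundary_density_cont R0 f r : holo R0 f -> 0 <= r < R0 ->
  cont_on 0 (2 * PI) (boundary_density f r).
Proof.
  intros H Hr t _. apply cont_mult; [|apply cont_vel].
  apply (cont_comp RtoC f (fun t => r * cis t)%C); [|apply cont_circle].
  apply (holo_cont R0); auto. rewrite Cmod_circle; lra.
Qed.

(** Wherever the Cauchy formula holds for f, it can be differentiated under the integral
    sign. *)
Lemma cauchy_formula_derivative R0 r f f' z : holo R0 f -> 0 <= r < R0 ->
  (forall a, Cmod a < r -> cauchy_transform r (boundary_density f r) 1 a = (2 * PI * Ci * f a)%C) ->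
  Cmod z < r -> der zid f z (f' z) ->
  f' z = (/ (2 * PI * Ci) * cauchy_transform r (boundary_density f r) 2 z)%C.
Proof.
  intros H Hr HC Hz Hd. assert (N := two_pi_i_neq). assert (z0 := Cmod_ge_0 z).
  apply (der_unique_C f z); auto.
  apply (der_ext_disk r (fun a => / (2 * PI * Ci) * cauchy_transform r (boundary_density f r) 1 a)%C); auto.
  { intros w Hw. rewrite HC by auto. rewrite Cmult_assoc, Cinv_l by exact N. ring. }
  apply der_scal. rewrite <- (Cmult_1_l (cauchy_transform _ _ 2 z)).
  apply (quad_der _ (fun z => 1 * cauchy_transform r (boundary_density f r) 2 z)%C ((Cmod z + r) / 2)); [|lra].
  apply transform_quad1; try lra. now apply (boundary_density_cont R0).
Qed.

(** The primitive F of f has the continuous derivative f, so it satisfies the Cauchy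
    formula.  Differentiating it once represents f by a transform of order 2, and those
    have quadratic remainders. *)
Lemma holo_quad R0 f rho : holo R0 f -> 0 <= rho < R0 -> quad_remainder f (C_derive f) rho.
Proof.
  intros H Hrho. set (F := seg f 0).
  set (r := (rho + R0) / 2). set (rho' := (rho + r) / 2).
  assert (HF : holo R0 F) by (intros z Hz; exists (f z); now apply (seg_primitive R0)).
  assert (HC : forall a, Cmod a < r ->
    cauchy_transform r (boundary_density F r) 1 a = (2 * PI * Ci * F a)%C).
  { intros a Ha. apply (cauchy_C1 R0 r F f); auto; [| |unfold r; lra].
    - intros; now apply (seg_primitive R0).
    - intros; now apply (holo_cont R0). }
  assert (E : forall z, Cmod z < r ->
    f z = (/ (2 * PI * Ci) * cauchy_transform r (boundary_density F r) 2 z)%C).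
  { intros z Hz. apply (cauchy_formula_derivative R0 r F f); auto; [unfold r; lra|].
    apply (seg_primitive R0); auto. unfold r in Hz; lra. }
  assert (Q : quad_remainder f (fun z => / (2 * PI * Ci) * (2 * cauchy_transform r (boundary_density F r) 3 z))%C rho').
  { apply (quad_ext (fun z => / (2 * PI * Ci) * cauchy_transform r (boundary_density F r) 2 z)%C
      (fun z => / (2 * PI * Ci) * (2 * cauchy_transform r (boundary_density F r) 3 z))%C); auto.
    - intros z Hz. symmetry. apply E. unfold rho', r in *; lra.
    - apply quad_scal.
      + intros Z. apply C1_nz. rewrite <- (Cinv_r _ two_pi_i_neq), Z. ring.
      + apply transform_quad2; [unfold rho', r; lra|unfold rho', r; lra|].
        apply (boundary_density_cont R0); auto. unfold r; lra. }
  eapply quad_ext; [| |apply (quad_le _ _ rho rho'); [unfold rho', r; lra|exact Q]]; auto.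
  intros z Hz. symmetry. apply der_C_derive.
  apply (quad_der _ (fun z => / (2 * PI * Ci) * (2 * cauchy_transform r (boundary_density F r) 3 z))%C rho'); auto.
  unfold rho', r; lra.
Qed.

Lemma C_derive_cont R0 f z : holo R0 f -> Cmod z < R0 -> cont zid (C_derive f) z.
Proof.
  intros H Hz. assert (Q := Cmod_ge_0 z).
  apply (quad_cont f _ ((Cmod z + R0) / 2)); [|lra]. apply (holo_quad R0); auto. lra.
Qed.

Theorem cauchy_formula R0 f r a : holo R0 f -> r < R0 -> Cmod a < r ->
  cauchy_transform r (boundary_density f r) 1 a = (2 * PI * Ci * f a)%C.
Proof.
  intros H Hr Ha. apply (cauchy_C1 R0 r f (C_derive f)); auto.
  - intros; now apply (holo_der R0).
  - intros; now apply (C_derive_cont R0).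
Qed.

(** The derivative is a transform of order 2, which is differentiable again. *)
Theorem holo_C_derive R0 f : holo R0 f -> holo R0 (C_derive f).
Proof.
  intros H z Hz. assert (z0 := Cmod_ge_0 z).
  set (r := (Cmod z + R0) / 2). set (rho := (Cmod z + r) / 2).
  exists (/ (2 * PI * Ci) * (2 * cauchy_transform r (boundary_density f r) 3 z))%C.
  apply (der_ext_disk r (fun a => / (2 * PI * Ci) * cauchy_transform r (boundary_density f r) 2 a)%C).
  - intros w Hw. symmetry.
    apply (cauchy_formula_derivative R0); auto; try (unfold r in *; lra).
    + intros; apply (cauchy_formula R0); auto. unfold r; lra.
    + apply (holo_der R0); auto. unfold r in *; lra.
  - unfold r; lra.
  - apply der_scal.
    apply (quad_der _ (fun z => 2 * cauchy_transform r (boundary_density f r) 3 z)%C rho);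
      [|unfold rho, r; lra].
    apply transform_quad2; try (unfold rho, r; lra).
    apply (boundary_density_cont R0); auto. unfold r; lra.
Qed.

Lemma holo_plus r f g : holo r f -> holo r g -> holo r (fun z => f z + g z)%C.
Proof.
  intros Hf Hg z Hz. destruct (Hf z Hz) as [l Hl]. destruct (Hg z Hz) as [m Hm].
  eexists. now apply der_plus; eassumption.
Qed.

Lemma holo_mult r f g : holo r f -> holo r g -> holo r (fun z => f z * g z)%C.
Proof.
  intros Hf Hg z Hz. destruct (Hf z Hz) as [l Hl]. destruct (Hg z Hz) as [m Hm].
  eexists. now apply der_mult; eassumption.
Qed.

Lemma holo_const r c : holo r (fun _ => c).
Proof. intros z _. exists 0. apply der_const. Qed.

Lemma holo_id r : holo r (fun z => z).
Proof. intros z _. exists 1. apply (der_param zid). Qed.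

Lemma holo_scal r c f : holo r f -> holo r (fun z => c * f z)%C.
Proof. intros H. apply holo_mult; auto. apply holo_const. Qed.

Lemma holo_opp r f : holo r f -> holo r (fun z => - f z)%C.
Proof. intros H z Hz. destruct (H z Hz) as [l Hl]. eexists. apply der_opp, Hl. Qed.

Lemma holo_minus r f g : holo r f -> holo r g -> holo r (fun z => f z - g z)%C.
Proof. intros Hf Hg. apply holo_plus; auto. now apply holo_opp. Qed.

Lemma holo_inv r f : holo r f -> (forall z, Cmod z < r -> f z <> 0) -> holo r (fun z => / f z)%C.
Proof. intros H N z Hz. destruct (H z Hz) as [l Hl]. eexists. apply der_inv; eauto. Qed.

Lemma holo_pow r f n : holo r f -> holo r (fun z => f z ^ n)%C.
Proof.
  intros H. induction n; simpl; [apply holo_const|]. now apply holo_mult.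
Qed.

Lemma holo_comp r s f g : holo s f -> holo r g -> (forall z, Cmod z < r -> Cmod (g z) < s) ->
  holo r (fun z => f (g z)).
Proof.
  intros Hf Hg I z Hz. destruct (Hg z Hz) as [m Hm]. destruct (Hf (g z) (I z Hz)) as [l Hl].
  eexists. eapply der_comp; eassumption.
Qed.

Lemma Cmod_cauchy_bound R0 f r a M : holo R0 f -> r < R0 -> Cmod a < r ->
  (forall z, Cmod z = r -> Cmod (f z) <= M) -> Cmod (f a) <= 2 * r / (r - Cmod a) * M.
Proof.
  intros H Hr Ha HM. assert (a0 := Cmod_ge_0 a). assert (HPI := PI_RGT_0).
  assert (E := cauchy_formula R0 f r a H Hr Ha).
  assert (B : Cmod (cauchy_transform r (boundary_density f r) 1 a) <=
    2 * (2 * PI - 0) * (M * r * / (r - Cmod a))).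
  { apply Cint_bound; [lra| |].
    - apply transform_cont_on; auto. apply (boundary_density_cont R0); auto; lra.
    - intros t _. unfold boundary_density.
      rewrite !Cmod_mult, Cmod_vel, Cmod_inv by (try lra; apply Cpow_nz; now apply circle_neq).
      rewrite Cmod_pow, pow_1.
      assert (Q := HM (r * cis t)%C (Cmod_circle r t ltac:(lra))).
      assert (G := circle_gap r a t Ha).
      apply Rmult_le_compat.
      + apply Rmult_le_pos; [apply Cmod_ge_0|lra].
      + left. apply Rinv_0_lt_compat. lra.
      + apply Rmult_le_compat_r; lra.
      + apply Rinv_le_contravar; lra. }
  rewrite E in B. rewrite !Cmod_mult, Cmod_Ci, !Cmod_R, !Rabs_pos_eq in B by lra.
  apply Rmult_le_reg_l with (2 * PI); [lra|].
  replace (2 * PI * (2 * r / (r - Cmod a) * M)) with (2 * (2 * PI - 0) * (M * r * / (r - Cmod a)))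
    by (field; lra). lra.
Qed.

(** The crude bound |f a| <= B M holds for every power of f, that is |f a|^n <= B M^n;
    taking n-th roots removes B. *)
Theorem maximum_modulus R0 f r a M : holo R0 f -> r < R0 -> Cmod a < r ->
  (forall z, Cmod z = r -> Cmod (f z) <= M) -> Cmod (f a) <= M.
Proof.
  intros H Hr Ha HM. apply Rnot_lt_le. intros L.
  assert (a0 := Cmod_ge_0 a).
  assert (M0 : 0 <= M).
  { eapply Rle_trans; [apply Cmod_ge_0|]. apply (HM (r * cis 0)%C). apply Cmod_circle. lra. }
  set (B := 2 * r / (r - Cmod a)).
  assert (B0 : 0 < B) by (apply Rdiv_lt_0_compat; lra).
  assert (P : forall n, Cmod (f a) ^ n <= B * M ^ n).
  { intros n. rewrite <- Cmod_pow. apply (Cmod_cauchy_bound R0 (fun z => f z ^ n)%C); auto.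
    - now apply holo_pow.
    - intros z Hz. rewrite Cmod_pow. apply pow_incr. split; [apply Cmod_ge_0|auto]. }
  set (q := M / Cmod (f a)).
  assert (q1 : 0 <= q < 1).
  { split; [apply Rdiv_le_0_compat; lra|]. apply Rmult_lt_reg_r with (Cmod (f a)); [lra|].
    unfold q, Rdiv. rewrite Rmult_assoc, Rinv_l by lra. lra. }
  destruct (pow_lt_1_zero q ltac:(rewrite Rabs_pos_eq; lra) (/ B)) as [n Hn];
    [now apply Rinv_0_lt_compat|].
  specialize (Hn n (Nat.le_refl _)). rewrite Rabs_pos_eq in Hn by (apply pow_le; lra).
  specialize (P n). assert (Pf : 0 < Cmod (f a) ^ n) by (apply pow_lt; lra).
  replace (M ^ n) with (q ^ n * Cmod (f a) ^ n) in P.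
  2:{ rewrite <- Rpow_mult_distr. f_equal. unfold q. field. lra. }
  apply Rmult_lt_compat_l with (r := B) in Hn; auto. rewrite Rinv_r in Hn by lra. nra.
Qed.

Theorem minimum_modulus R0 f r a m : holo R0 f -> (forall z, Cmod z < R0 -> f z <> 0) ->
  r < R0 -> Cmod a < r -> 0 < m -> (forall z, Cmod z = r -> m <= Cmod (f z)) -> m <= Cmod (f a).
Proof.
  intros H N Hr Ha Hm HM.
  assert (Q : Cmod (/ f a) <= / m).
  { apply (maximum_modulus R0 (fun z => / f z)%C r); auto; [now apply holo_inv|].
    intros z Hz. rewrite Cmod_inv by (apply N; lra). apply Rinv_le_contravar; auto. }
  rewrite Cmod_inv in Q by (apply N; lra).
  rewrite <- (Rinv_inv m), <- (Rinv_inv (Cmod (f a))).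
  apply Rinv_le_contravar; auto. apply Rinv_0_lt_compat, Cmod_gt_0, N. lra.
Qed.

Lemma circle_min R0 f r : holo R0 f -> 0 <= r < R0 -> (forall z, Cmod z = r -> f z <> 0) ->
  exists m, 0 < m /\ forall z, Cmod z = r -> m <= Cmod (f z).
Proof.
  intros H Hr N. destruct (cont_on_bounded_below 0 (2 * PI) (fun t => f (r * cis t)%C)) as [m [P Hm]].
  - intros t _. apply (cont_comp RtoC f (fun t => r * cis t)%C); [|apply cont_circle].
    apply (holo_cont R0); auto. rewrite Cmod_circle; lra.
  - intros t _. apply N. apply Cmod_circle. lra.
  - exists m. split; auto. intros z Hz. destruct (polar z) as [t [Ht E]].
    rewrite E, Hz. now apply Hm.
Qed.

Lemma circle_max R0 f r : holo R0 f -> 0 <= r < R0 ->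
  exists M, 0 < M /\ forall z, Cmod z = r -> Cmod (f z) <= M.
Proof.
  intros H Hr. destruct (cont_on_bounded 0 (2 * PI) (fun t => f (r * cis t)%C)) as [m [P Hm]].
  - intros t _. apply (cont_comp RtoC f (fun t => r * cis t)%C); [|apply cont_circle].
    apply (holo_cont R0); auto. rewrite Cmod_circle; lra.
  - exists m. split; auto. intros z Hz. destruct (polar z) as [t [Ht E]].
    rewrite E, Hz. now apply Hm.
Qed.

(** The quadratic remainder of f is uniform along the ray, so the integral can be
    differentiated in lam. *)
Lemma holo_weighted R0 f (w : R -> C) z0 s : holo R0 f -> cont_on 0 1 w ->
  0 < s -> s * Cmod z0 <= R0 ->
  holo s (fun lam => Cint (fun t : R => w t * f (lam * (t * z0)))%C 0 1).
Proof.
  intros H Hw Hs Hz lam Hlam.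
  destruct (Req_dec (Cmod z0) 0) as [Z|N].
  { apply Cmod_eq_0 in Z. subst z0. exists 0.
    eapply der_local; [apply (der_const zid (Cint (fun t : R => w t * f 0)%C 0 1))|].
    exists 1. split; [lra|]. intros y _. apply Cint_ext; [lra|]. intros t _.
    replace (y * (t * 0))%C with (RtoC 0) by ring. reflexivity. }
  assert (k0 : 0 < Cmod z0) by (assert (Q := Cmod_ge_0 z0); lra). set (k := Cmod z0) in *.
  assert (l0 := Cmod_ge_0 lam).
  set (s' := (Cmod lam + s) / 2).
  assert (Hrho : 0 <= s' * k < R0) by (unfold s'; split; [nra|nra]).
  destruct (holo_quad R0 f (s' * k) H Hrho) as [K [K0 HK]].
  destruct (cont_on_bounded _ _ _ Hw) as [M [M0 HM]].
  assert (B : forall (y : C) (t : R), Cmod y < s' -> 0 <= t <= 1 -> Cmod (y * (t * z0)) <= s' * k).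
  { intros y t Hy Ht. rewrite !Cmod_mult, Cmod_R, Rabs_pos_eq by lra. fold k.
    assert (Q := Cmod_ge_0 y). apply Rmult_le_compat; nra. }
  assert (Cz : forall (y : C) (t : R), cont RtoC (fun t : R => y * (t * z0))%C t).
  { intros y t. apply cont_mult; [apply cont_const|]. apply cont_mult; [apply cont_param|apply cont_const]. }
  exists (Cint (fun t : R => w t * (C_derive f (lam * (t * z0)) * (t * z0)))%C 0 1).
  apply (der_Cint zid (fun (lam : C) (t : R) => w t * f (lam * (t * z0)))%C); [lra| |].
  - intros eps He. set (d := eps / (M * K * (k * k))).
    assert (Pd : 0 < d) by (apply Rdiv_lt_0_compat; auto; repeat apply Rmult_lt_0_compat; auto).
    exists (Rmin (s' - Cmod lam) d).
    split; [apply Rmin_pos; auto; unfold s'; lra|].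
    intros y Hy. unfold zid in *.
    assert (A1 := Rmin_l (s' - Cmod lam) d). assert (A2 := Rmin_r (s' - Cmod lam) d).
    assert (Hy' : Cmod y < s') by (assert (T := Cmod_rev_triangle y lam); lra).
    split.
    + intros t Ht. apply cont_mult; [now apply Hw|].
      apply (cont_comp RtoC f (fun t : R => y * (t * z0))%C); auto.
      apply (holo_cont R0); auto. eapply Rle_lt_trans; [apply B; auto|]. lra.
    + intros t Ht.
      replace (w t * f (y * (t * z0)) - w t * f (lam * (t * z0)) -
        w t * (C_derive f (lam * (t * z0)) * (t * z0)) * (y - lam))%C with
        (w t * (f (y * (t * z0)) - f (lam * (t * z0)) -
          C_derive f (lam * (t * z0)) * (y * (t * z0) - lam * (t * z0))))%C by ring.
      rewrite Cmod_mult.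
      assert (Q := HK (lam * (t * z0))%C (y * (t * z0))%C ltac:(apply B; auto; unfold s'; lra)
         ltac:(apply B; auto)).
      assert (E : Cmod (y * (t * z0) - lam * (t * z0)) <= Cmod (y - lam) * k).
      { replace (y * (t * z0) - lam * (t * z0))%C with ((y - lam) * (t * z0))%C by ring.
        rewrite !Cmod_mult, Cmod_R, Rabs_pos_eq by lra. fold k.
        assert (Q' := Cmod_ge_0 (y - lam)). apply Rmult_le_compat_l; auto. nra. }
      assert (P1 := Cmod_ge_0 (y - lam)).
      assert (P2 := Cmod_ge_0 (y * (t * z0) - lam * (t * z0))).
      apply Rle_trans with (M * (K * ((Cmod (y - lam) * k) * (Cmod (y - lam) * k)))).
      * apply Rmult_le_compat; auto using Cmod_ge_0.
        eapply Rle_trans; [exact Q|]. apply Rmult_le_compat_l; [lra|].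
        apply Rmult_le_compat; auto.
      * replace (M * (K * (Cmod (y - lam) * k * (Cmod (y - lam) * k)))) with
          (M * K * (k * k) * Cmod (y - lam) * Cmod (y - lam)) by ring.
        apply Rmult_le_compat_r; auto.
        apply Rle_trans with (M * K * (k * k) * d).
        -- apply Rmult_le_compat_l; [|lra]. left. repeat apply Rmult_lt_0_compat; auto.
        -- right. unfold d. field. lra.
  - intros t Ht. apply cont_mult; [now apply Hw|]. apply cont_mult.
    + apply (cont_comp RtoC (C_derive f) (fun t : R => lam * (t * z0))%C); auto.
      apply (C_derive_cont R0); auto. eapply Rle_lt_trans; [apply B; auto; unfold s'; lra|]. lra.
    + apply cont_mult; [apply cont_param|apply cont_const].
Qed.

Lemma ray_FTC R0 f z : holo R0 f -> Cmod z < R0 ->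
  (f z - f 0)%C = (z * Cint (fun t : R => C_derive f (t * z))%C 0 1)%C.
Proof.
  intros H Hz. assert (z0 := Cmod_ge_0 z).
  assert (E := seg_FTC f (C_derive f) 0 z).
  rewrite <- E.
  - unfold seg. f_equal; [ring|]. apply Cint_ext; [lra|]. intros t _. f_equal. ring.
  - apply (holo_cont_seg R0); auto; [now apply holo_C_derive|]. rewrite Cmod_0. lra.
  - intros t Ht. apply (holo_der R0); auto. apply Cmod_convex_lt; auto. rewrite Cmod_0. lra.
Qed.

(** The quotient is the integral of f'(t z) over 0 <= t <= 1. *)
Lemma holo_factor R0 f : 0 < R0 -> holo R0 f -> f 0 = 0 ->
  exists g, holo R0 g /\ forall z, Cmod z < R0 -> f z = (z * g z)%C.
Proof.
  intros P H Z. exists (fun z => Cint (fun t : R => 1 * C_derive f (z * (t * 1)))%C 0 1).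
  split.
  - apply (holo_weighted R0); auto; [now apply holo_C_derive|intros t _; apply cont_const|].
    rewrite Cmod_1. lra.
  - intros z Hz. replace (f z) with (f z - f 0)%C by (rewrite Z; ring).
    rewrite (ray_FTC R0 f z H Hz). f_equal. apply Cint_ext; [lra|]. intros t _.
    rewrite Cmult_1_l. f_equal. ring.
Qed.

(** * Injective holomorphic functions *)

(** A zero on every small circle forces the value 0 at the centre, so z can be factored out
    of f, and again out of the quotient.  By the maximum principle f / z^n is at most
    M / r^n, whence |f z| <= M (|z| / r)^n for all n. *)
Lemma identity_principle R0 r1 f : holo R0 f -> 0 < r1 <= R0 ->
  (forall r, 0 < r < r1 -> exists z, Cmod z = r /\ f z = 0) ->
  forall z, Cmod z < r1 -> f z = 0.
Proof.
  intros H Hr1 HZ z Hz.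
  assert (Fac : forall n, exists g, holo R0 g /\ forall w, Cmod w < R0 -> f w = (w ^ n * g w)%C).
  { induction n as [|n [g [Hg E]]].
    - exists f. split; auto. intros w _. simpl. ring.
    - assert (Hg0 : g 0 = 0).
      { apply NNPP. intros N. assert (P := proj1 (Cmod_gt_0 _) N).
        destruct (holo_cont R0 g 0 Hg ltac:(rewrite Cmod_0; lra) _ P) as [d [Pd Hd]].
        assert (Q := Rmin_pos _ _ Pd (proj1 Hr1)).
        assert (A := Rmin_l d r1). assert (B := Rmin_r d r1).
        destruct (HZ (Rmin d r1 / 2)) as [w [Ew Zw]]; [lra|].
        assert (Nw : w <> 0) by (apply Cmod_gt_0; lra).
        assert (Zg : g w = 0).
        { rewrite E in Zw by lra. apply NNPP. intros N'.
          now apply (Cmult_neq_0 _ _ (Cpow_nz w n Nw) N'). }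
        specialize (Hd w). unfold zid in Hd.
        replace (w - 0)%C with w in Hd by ring. specialize (Hd ltac:(lra)).
        rewrite Zg in Hd. replace (0 - g 0)%C with (- g 0)%C in Hd by ring.
        rewrite Cmod_opp in Hd. lra. }
      destruct (holo_factor R0 g ltac:(lra) Hg Hg0) as [k [Hk Ek]].
      exists k. split; auto. intros w Hw. rewrite E, Ek by auto. simpl. ring. }
  set (r := (Cmod z + r1) / 2). assert (z0 := Cmod_ge_0 z).
  assert (Hr : Cmod z < r < R0) by (unfold r; lra).
  destruct (circle_max R0 f r H ltac:(lra)) as [M [M0 HM]].
  assert (B : forall n, Cmod (f z) <= M * (Cmod z / r) ^ n).
  { intros n. destruct (Fac n) as [g [Hg E]].
    assert (Pr : 0 < r ^ n) by (apply pow_lt; lra).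
    assert (Q : Cmod (g z) <= M / r ^ n).
    { apply (maximum_modulus R0 g r); auto; try lra. intros w Hw.
      specialize (HM w Hw). rewrite E, Cmod_mult, Cmod_pow, Hw in HM by lra.
      apply Rmult_le_reg_l with (r ^ n); auto.
      replace (r ^ n * (M / r ^ n)) with M by (field; lra). exact HM. }
    rewrite E, Cmod_mult, Cmod_pow by lra. unfold Rdiv. rewrite Rpow_mult_distr, pow_inv.
    apply Rmult_le_compat_l with (r := Cmod z ^ n) in Q; [|apply pow_le; lra].
    replace (M * (Cmod z ^ n * / r ^ n)) with (Cmod z ^ n * (M / r ^ n)) by (field; lra). lra. }
  apply Cmod_eq_0. apply Rle_antisym; [|apply Cmod_ge_0].
  apply Rnot_lt_le. intros L.
  assert (q1 : 0 <= Cmod z / r < 1).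
  { split; [apply Rdiv_le_0_compat; lra|]. apply Rmult_lt_reg_r with r; [lra|].
    unfold Rdiv. rewrite Rmult_assoc, Rinv_l by lra. lra. }
  destruct (pow_lt_1_zero (Cmod z / r) ltac:(rewrite Rabs_pos_eq; lra) (Cmod (f z) / M))
    as [n Hn]; [now apply Rdiv_lt_0_compat|].
  specialize (Hn n (Nat.le_refl _)). rewrite Rabs_pos_eq in Hn by (apply pow_le; lra).
  apply Rmult_lt_compat_l with (r := M) in Hn; auto.
  replace (M * (Cmod (f z) / M)) with (Cmod (f z)) in Hn by (field; lra).
  specialize (B n). lra.
Qed.

Definition inj (r : R) (f : C -> C) : Prop :=
  forall z w, Cmod z < r -> Cmod w < r -> f z = f w -> z = w.

Lemma holo_shift R0 h c r : holo R0 h -> Cmod c + r <= R0 -> holo r (fun z => h (c + z)%C).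
Proof.
  intros H Hc. apply (holo_comp r R0 h (fun z => c + z)%C); auto.
  - apply holo_plus; [apply holo_const|apply holo_id].
  - intros z Hz. eapply Rle_lt_trans; [apply Cmod_triangle|]. lra.
Qed.

Lemma shift_in R0 c z : Cmod z < R0 - Cmod c -> Cmod (c + z) < R0.
Proof. intros H. eapply Rle_lt_trans; [apply Cmod_triangle|]. lra. Qed.

(** For small e > 0 the function D z = h (e + z) - h z has no zeros and is close to e h' z.
    On a circle where |h'| >= m its modulus is at least (m / 2) e, so |D 0| >= (m / 2) e by
    the minimum principle; but h' 0 = 0 makes |D 0| at most (m / 4) e. *)
Lemma inj_derive_neq_0_center R0 h : 0 < R0 -> holo R0 h -> inj R0 h -> C_derive h 0 <> 0.
Proof.
  intros HR H I Z.
  assert (Circ : exists r, 0 < r < R0 /\ forall z, Cmod z = r -> C_derive h z <> 0).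
  { apply NNPP. intros N.
    assert (V : forall z, Cmod z < R0 -> C_derive h z = 0).
    { apply (identity_principle R0 R0); [now apply holo_C_derive|lra|].
      intros r Hr. apply NNPP. intros N'. apply N. exists r. split; auto.
      intros z Hz E. apply N'. now exists z. }
    assert (M : Cmod (RtoC (R0 / 2)) = R0 / 2) by (rewrite Cmod_R, Rabs_pos_eq; lra).
    assert (E := ray_FTC R0 h (RtoC (R0 / 2)) H ltac:(lra)).
    rewrite (Cint_ext 0 1 _ (fun _ => RtoC 0)) in E; [|lra|].
    2:{ intros t Ht. apply V. rewrite Cmod_mult, M, Cmod_R, Rabs_pos_eq by lra. nra. }
    rewrite Cint_const in E by lra.
    assert (E' : h (RtoC (R0 / 2)) = h 0) by (apply Ceq_minus; rewrite E; ring).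
    apply I in E'; [|lra|rewrite Cmod_0; lra]. rewrite E', Cmod_0 in M. lra. }
  destruct Circ as [r [Hr N]].
  destruct (circle_min R0 (C_derive h) r) as [m [m0 Hm]]; auto; [now apply holo_C_derive|lra|].
  set (rho := (r + R0) / 2).
  destruct (holo_quad R0 h rho H ltac:(unfold rho; lra)) as [K [K0 HK]].
  (* small enough for the remainder K e^2 to be at most (m / 4) e *)
  set (e := Rmin ((R0 - r) / 4) (m / (4 * K))).
  assert (e0 : 0 < e) by (apply Rmin_pos; [lra|apply Rdiv_lt_0_compat; lra]).
  assert (e1 : e <= (R0 - r) / 4) by apply Rmin_l.
  assert (e2 : K * e <= m / 4).
  { apply Rle_trans with (K * (m / (4 * K))); [apply Rmult_le_compat_l; [lra|apply Rmin_r]|].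
    right. field. lra. }
  assert (Me : Cmod e = e) by (rewrite Cmod_R, Rabs_pos_eq; lra).
  set (D := fun z => (h (e + z) - h z)%C).
  assert (HD : holo (R0 - e) D).
  { apply holo_minus; [|apply (holo_le _ R0); auto; lra].
    apply (holo_shift R0); auto. lra. }
  assert (ND : forall z, Cmod z < R0 - e -> D z <> 0).
  { intros z Hz E. unfold D in E. apply Ceq_minus in E.
    apply I in E; [|apply shift_in; lra|lra].
    assert (E' : RtoC e = 0) by (replace (RtoC e) with (e + z - z)%C by ring; rewrite E; ring).
    rewrite E', Cmod_0 in Me. lra. }
  assert (Approx : forall z, Cmod z <= r -> Cmod (D z - C_derive h z * e) <= m / 4 * e).
  { intros z Hz. assert (Q := HK z (e + z)%C).
    replace (e + z - z)%C with (RtoC e) in Q by ring. rewrite Me in Q.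
    assert (T := Cmod_triangle e z).
    specialize (Q ltac:(unfold rho; lra) ltac:(unfold rho; lra)).
    unfold D. nra. }
  assert (B : m / 2 * e <= Cmod (D 0)).
  { apply (minimum_modulus (R0 - e) D r); auto; try lra; [rewrite Cmod_0; lra|nra|].
    intros z Hz. specialize (Approx z ltac:(lra)). specialize (Hm z Hz).
    assert (T := Cmod_rev_triangle (C_derive h z * e) (D z)).
    rewrite Cmod_minus_sym, Cmod_mult, Me in T. nra. }
  specialize (Approx 0 ltac:(rewrite Cmod_0; lra)). rewrite Z in Approx.
  replace (D 0 - 0 * e)%C with (D 0) in Approx by ring. nra.
Qed.

Theorem inj_derive_neq_0 R0 h z : holo R0 h -> inj R0 h -> Cmod z < R0 -> C_derive h z <> 0.
Proof.
  intros H I Hz.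
  assert (N : C_derive (fun w => h (z + w)%C) 0 <> 0).
  { apply (inj_derive_neq_0_center (R0 - Cmod z)); [lra|apply (holo_shift R0); auto; lra|].
    intros u v Hu Hv E. apply I in E; try (apply shift_in; auto).
    replace u with (z + u - z)%C by ring. rewrite E. ring. }
  replace (C_derive h z) with (C_derive (fun w => h (z + w)%C) 0); auto.
  apply der_C_derive. replace (C_derive h z) with (C_derive h z * (0 + 1))%C by ring.
  apply (der_comp zid h (fun w => z + w)%C).
  - replace (z + 0)%C with z by ring. now apply (holo_der R0).
  - apply der_plus; [apply der_const|apply (der_param zid)].
Qed.

(** On a small circle around z, |h - h z| >= m > 0.  If w with |w - h z| < m / 2 were not
    attained inside, the minimum principle for h - w would give |h z - w| >= m / 2. *)
Theorem inj_open R0 h z eps : holo R0 h -> inj R0 h -> Cmod z < R0 -> 0 < eps ->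
  exists d, 0 < d /\ forall w, Cmod (w - h z) < d ->
    exists u, Cmod u < R0 /\ Cmod (u - z) < eps /\ w = h u.
Proof.
  intros H I Hz He.
  set (s := Rmin eps (R0 - Cmod z)). assert (s0 : 0 < s) by (apply Rmin_pos; lra).
  assert (s1 : s <= eps) by apply Rmin_l. assert (s2 : s <= R0 - Cmod z) by apply Rmin_r.
  assert (Hs : forall c, holo s (fun u => h (z + u) - c)%C).
  { intros c. apply holo_minus; [|apply holo_const]. apply (holo_shift R0); auto. lra. }
  destruct (circle_min s (fun u => h (z + u) - h z)%C (s / 2)) as [m [m0 Hm]]; auto; [lra| |].
  { intros u Hu E. apply Ceq_minus, I in E; auto; [|apply shift_in; lra].
    assert (E' : u = 0) by (replace u with (z + u - z)%C by ring; rewrite E; ring).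
    rewrite E', Cmod_0 in Hu. lra. }
  exists (m / 2). split; [lra|]. intros w Hw. apply NNPP. intros N.
  assert (B : m / 2 <= Cmod (h (z + 0)%C - w)).
  { apply (minimum_modulus s (fun u => h (z + u) - w)%C (s / 2) 0); auto; try lra.
    - intros u Hu E. apply N. exists (z + u)%C. split; [apply shift_in; lra|].
      replace (z + u - z)%C with u by ring. split; [lra|]. symmetry. now apply Ceq_minus.
    - rewrite Cmod_0. lra.
    - intros u Hu. specialize (Hm u Hu).
      assert (T := Cmod_tri3 (h (z + u)%C) w (h z)). lra. }
  replace (z + 0)%C with z in B by ring. rewrite Cmod_minus_sym in B. lra.
Qed.

(** * Domination and its singular kernel *)

(** What the univalence of all maps h + conj g says about pairs of points; unlike univalence
    it can be carried to smaller disks by the maximum principle. *)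
Definition dominates (h : C -> C) : Prop :=
  forall g, holo 1 g ->
    (forall z, Cmod z < 1 -> Cmod (C_derive g z) < Cmod (C_derive h z)) ->
    forall z w, Cmod z < 1 -> Cmod w < 1 -> Cmod (g z - g w) <= Cmod (h z - h w).

Definition dot (u v : C) : R := Re u * Re v + Im u * Im v.

Lemma dot_conj u v : dot u v = Re (Cconj u * v).
Proof. unfold dot, Cconj, Cmult, Re, Im; simpl. ring. Qed.

Lemma Cmod_sqr u : Cmod u * Cmod u = dot u u.
Proof.
  unfold Cmod, dot, Re, Im. rewrite sqrt_sqrt; [ring|].
  assert (A := pow2_ge_0 (fst u)). assert (B := pow2_ge_0 (snd u)). lra.
Qed.

(** Squaring |d - 2 e j| <= |d| gives dot d j >= e |j|^2. *)
Lemma dot_of_Cmod_le d j (e : R) : 0 < e -> Cmod (d - 2 * e * j) <= Cmod d -> 0 <= dot d j.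
Proof.
  intros He H.
  assert (S : Cmod (d - 2 * e * j) * Cmod (d - 2 * e * j) <= Cmod d * Cmod d).
  { apply Rmult_le_compat; auto using Cmod_ge_0. }
  rewrite !Cmod_sqr in S.
  assert (E : dot (d - 2 * e * j) (d - 2 * e * j) = dot d d - 4 * e * dot d j + 4 * (e * e) * dot j j).
  { unfold dot, Re, Im; simpl. ring. }
  rewrite E in S. assert (P : 0 <= dot j j) by (rewrite <- Cmod_sqr; assert (Q := Cmod_ge_0 j); nra).
  nra.
Qed.

Lemma Re_lt_1 x : Cmod x <= 1 -> x <> 1 -> Re x < 1.
Proof.
  intros H N. assert (A := re_le_Cmod x). assert (B := Rle_abs (Re x)).
  destruct (Req_dec (Re x) 1) as [E|]; [|lra]. exfalso. apply N.
  assert (S : Cmod x * Cmod x <= 1 * 1) by (apply Rmult_le_compat; auto using Cmod_ge_0).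
  rewrite Cmod_sqr in S. unfold dot in S. rewrite E in S.
  assert (Im x = 0) by nra.
  destruct x as [a b]. unfold Re, Im in *. simpl in *. now subst.
Qed.

(** As Re (A - x) > e, the point A - x is closer to 2 e than to 0. *)
Lemma moebius_lt_1 (A e : R) x : 0 < e -> Re x < A - e ->
  (A - x)%C <> 0 /\ Cmod (1 - 2 * e / (A - x)) < 1.
Proof.
  intros He Hx.
  assert (N : (A - x)%C <> 0).
  { intros E. assert (E' := f_equal Re E). unfold Re in *. simpl in E'. lra. }
  split; auto.
  replace (1 - 2 * e / (A - x))%C with ((A - x - 2 * e) / (A - x))%C by (field; auto).
  assert (P := proj1 (Cmod_gt_0 _) N).
  rewrite Cmod_div by auto. apply Rmult_lt_reg_r with (Cmod (A - x)); auto.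
  unfold Rdiv. rewrite Rmult_assoc, Rinv_l, Rmult_1_r, Rmult_1_l by lra.
  apply Rnot_le_lt. intros L.
  assert (S : Cmod (A - x) * Cmod (A - x) <= Cmod (A - x - 2 * e) * Cmod (A - x - 2 * e)).
  { apply Rmult_le_compat; auto using Cmod_ge_0. }
  rewrite !Cmod_sqr in S. unfold dot, Re, Im in *. simpl in *. nra.
Qed.

Lemma cont_ray {X} (e : X -> C) f (g : X -> C) x R0 : holo R0 f -> Cmod (g x) < R0 ->
  cont e g x -> cont e (fun y => f (g y)) x.
Proof. intros H Hx Hg. apply (cont_comp e f g); auto. now apply (holo_cont R0). Qed.

Lemma Cmod_ray (t : R) z r : 0 <= t <= 1 -> Cmod z < r -> Cmod (t * z) < r.
Proof.
  intros Ht Hz. rewrite Cmod_mult, Cmod_R, Rabs_pos_eq by lra.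
  assert (Q := Cmod_ge_0 z). nra.
Qed.

(** The integral of h'(tau) / (A - tau / zeta) over the segment from 0 to z. *)
Definition ray_kernel (h : C -> C) (A : R) (zeta z : C) : C :=
  (z * Cint (fun t : R => C_derive h (t * z) * / (A - t * (z / zeta))) 0 1)%C.

(** N0 lam and D0 lam are the integrals of om(tau / zeta) h'(lam tau) and of h'(lam tau)
    from z1 to zeta through 0; lam D0 lam = h (lam zeta) - h (lam z1) does not vanish for
    lam <> 0.  On the circle |lam| = r1 domination gives |N0| <= |D0|, and the maximum principle
    carries this to lam = 1, where it is the inequality |d - 2 eps J| <= |d| for
    d = h zeta - h z1. *)
Lemma kernel_dot_ge_0 h zeta z1 A : holo 1 h -> inj 1 h -> dominates h ->
  Cmod zeta < 1 -> Cmod z1 <= Cmod zeta -> z1 <> zeta -> 1 < A -> A * Cmod zeta < 1 ->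
  0 <= dot (h zeta - h z1) (ray_kernel h A zeta zeta - ray_kernel h A zeta z1).
Proof.
  intros H I HD Hzeta Hz1 Nz HA HArho.
  set (rho := Cmod zeta) in *.
  assert (rho0 : 0 < rho).
  { apply Rnot_le_lt. intros L. apply Nz.
    rewrite (Cmod_eq_0 zeta), (Cmod_eq_0 z1); auto; apply Rle_antisym; try apply Cmod_ge_0; fold rho; lra. }
  assert (Hzr : Cmod zeta <= rho) by (unfold rho; lra).
  assert (Nzeta : zeta <> 0) by (apply Cmod_gt_0; exact rho0).
  (* |om x| < 1 for |x| < xh, and xh > 1 leaves room for |lam| > 1 *)
  set (eps := (A - 1) / 2). set (xh := A - eps).
  assert (Hxh : 1 < xh < A) by (unfold xh, eps; lra).
  assert (eps0 : 0 < eps) by (unfold eps; lra).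
  set (om := fun x => (1 - 2 * eps / (A - x))%C).
  assert (Hom : forall x, Cmod x < xh -> (A - x)%C <> 0 /\ Cmod (om x) < 1).
  { intros x Hx. apply moebius_lt_1; auto. fold xh.
    assert (Q1 := re_le_Cmod x). assert (Q2 := Rle_abs (Re x)). lra. }
  assert (omH : holo xh om).
  { apply holo_minus; [apply holo_const|]. apply holo_mult; [apply holo_const|].
    apply holo_inv; [|intros; now apply Hom]. apply holo_minus; [apply holo_const|apply holo_id]. }
  assert (H' := holo_C_derive 1 h H).
  set (x1 := (z1 / zeta)%C).
  assert (Hx1 : Cmod x1 <= 1).
  { unfold x1. rewrite Cmod_div by auto. fold rho. apply Rmult_le_reg_r with rho; auto.
    unfold Rdiv. rewrite Rmult_assoc, Rinv_l by lra. lra. }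
  assert (tx1 : forall t : R, 0 <= t <= 1 -> Cmod (t * x1) < xh)
    by (intros; apply Cmod_ray; auto; lra).
  assert (Cw1 : cont_on 0 1 (fun t : R => om (t * 1)%C)).
  { intros t Ht. apply (cont_ray RtoC om (fun t : R => t * 1)%C t xh); auto.
    - apply Cmod_ray; auto. rewrite Cmod_1. lra.
    - apply cont_mult; [apply cont_param|apply cont_const]. }
  assert (Cw2 : cont_on 0 1 (fun t : R => om (t * x1)%C)).
  { intros t Ht. apply (cont_ray RtoC om (fun t : R => t * x1)%C t xh); auto.
    apply cont_mult; [apply cont_param|apply cont_const]. }
  set (W := fun (w : R -> C) z lam => (z * Cint (fun t : R => w t * C_derive h (lam * (t * z))) 0 1)%C).
  set (N0 := fun lam => (W (fun t : R => om (t * 1)) zeta lam - W (fun t : R => om (t * x1)) z1 lam)%C).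
  set (D0 := fun lam => (W (fun _ => RtoC 1) zeta lam - W (fun _ => RtoC 1) z1 lam)%C).
  assert (Wh : forall w z, cont_on 0 1 w -> Cmod z <= rho -> holo (/ rho) (W w z)).
  { intros w z Hw Hz. apply holo_scal. apply (holo_weighted 1); auto.
    - now apply Rinv_0_lt_compat.
    - apply Rmult_le_reg_l with rho; auto. rewrite <- Rmult_assoc, Rinv_r by lra. lra. }
  assert (C1 : cont_on 0 1 (fun _ => RtoC 1)) by (intros t _; apply cont_const).
  assert (HN0 : holo (/ rho) N0) by (apply holo_minus; apply Wh; auto).
  assert (HD0 : holo (/ rho) D0) by (apply holo_minus; apply Wh; auto).
  assert (In : forall lam z, Cmod lam < / rho -> Cmod z <= rho -> Cmod (lam * z) < 1).
  { intros lam z Hl Hz. rewrite Cmod_mult. assert (Q := Cmod_ge_0 z). assert (Q' := Cmod_ge_0 lam).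
    apply Rle_lt_trans with (Cmod lam * rho); [apply Rmult_le_compat_l; auto|].
    rewrite <- (Rinv_l rho) by lra. apply Rmult_lt_compat_r; auto. }
  assert (W1 : forall lam z, Cmod lam < / rho -> Cmod z <= rho ->
    (lam * W (fun _ => RtoC 1) z lam)%C = (h (lam * z)%C - h 0)%C).
  { intros lam z Hl Hz. rewrite (ray_FTC 1 h); auto. unfold W.
    rewrite (Cint_ext 0 1 (fun t : R => 1 * C_derive h (lam * (t * z)))%C
       (fun t : R => C_derive h (t * (lam * z)))%C); [ring|lra|].
    intros t _. rewrite Cmult_1_l. f_equal. ring. }
  assert (D0E : forall lam, Cmod lam < / rho ->
    (lam * D0 lam)%C = (h (lam * zeta) - h (lam * z1))%C).
  { intros lam Hl. unfold D0.
    replace (lam * (W (fun _ => RtoC 1) zeta lam - W (fun _ => RtoC 1) z1 lam))%C with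
      (lam * W (fun _ => RtoC 1) zeta lam - lam * W (fun _ => RtoC 1) z1 lam)%C by ring.
    rewrite !W1 by auto. ring. }
  assert (ND0 : forall lam, Cmod lam < / rho -> D0 lam <> 0).
  { intros lam Hl E. destruct (classic (lam = 0)) as [->|Nl].
    - unfold D0, W in E.
      assert (Ez : forall z, Cint (fun t : R => 1 * C_derive h (0 * (t * z)))%C 0 1 = C_derive h 0).
      { intros z. rewrite (Cint_ext 0 1 _ (fun _ => C_derive h 0)); [|lra|].
        - rewrite Cint_const by lra. rewrite Rminus_0_r. ring.
        - intros t _. rewrite Cmult_1_l. f_equal. ring. }
      rewrite !Ez in E.
      assert (Nd : C_derive h 0 <> 0) by (apply (inj_derive_neq_0 1); auto; rewrite Cmod_0; lra).
      replace (zeta * C_derive h 0 - z1 * C_derive h 0)%C with ((zeta - z1) * C_derive h 0)%C in E by ring.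
      revert E. apply Cmult_neq_0; auto. apply Cminus_eq_contra. auto.
    - assert (Q := D0E lam Hl). rewrite E in Q. replace (lam * 0)%C with (RtoC 0) in Q by ring.
      symmetry in Q. apply Ceq_minus in Q. apply I in Q; try (apply In; auto).
      apply Nz. apply (f_equal (fun v => / lam * v)%C) in Q.
      rewrite !Cmult_assoc, !Cinv_l in Q by exact Nl. rewrite !Cmult_1_l in Q. auto. }
  set (r1 := / (xh * rho)).
  assert (Px : 0 < xh * rho) by nra.
  assert (Hxr : xh * rho < 1) by nra.
  assert (Hr1 : 1 < r1 < / rho).
  { unfold r1. split.
    - rewrite <- Rinv_1. apply Rinv_lt_contravar; lra.
    - apply Rinv_lt_contravar; nra. }
  (* for |lam| = r1 the weight om (z / (lam zeta)) is defined for all |z| < 1 *)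
  assert (Bd : forall lam, Cmod lam = r1 -> Cmod (N0 lam) <= Cmod (D0 lam)).
  { intros lam Hl.
    assert (Nl : lam <> 0) by (apply Cmod_gt_0; lra).
    assert (Nlz : (lam * zeta)%C <> 0) by now apply Cmult_neq_0.
    assert (Mlz : Cmod (lam * zeta) = / xh).
    { rewrite Cmod_mult, Hl. fold rho. unfold r1. field. lra. }
    assert (Mdiv : forall z, Cmod z < 1 -> Cmod (z / (lam * zeta)) < xh).
    { intros z Hz. rewrite Cmod_div, Mlz by auto. unfold Rdiv. rewrite Rinv_inv.
      assert (Q := Cmod_ge_0 z). nra. }
    set (k := fun z => (om (z / (lam * zeta)) * C_derive h z)%C).
    assert (Hk : holo 1 k).
    { apply holo_mult; auto. apply (holo_comp 1 xh om (fun z => z / (lam * zeta))%C); auto.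
      apply holo_mult; [apply holo_id|apply holo_const]. }
    set (g := seg k 0).
    assert (Hg : forall z, Cmod z < 1 -> der zid g z (k z)) by (intros; now apply (seg_primitive 1)).
    assert (Dom : Cmod (g (lam * zeta)%C - g (lam * z1)%C) <= Cmod (h (lam * zeta)%C - h (lam * z1)%C)).
    { apply HD; try (apply In; [lra|assumption]).
      - intros z Hz. exists (k z). auto.
      - intros z Hz. rewrite (der_C_derive _ _ _ (Hg z Hz)). unfold k. rewrite Cmod_mult.
        assert (P : 0 < Cmod (C_derive h z)) by (apply Cmod_gt_0, (inj_derive_neq_0 1); auto).
        assert (Q := proj2 (Hom _ (Mdiv z Hz))). nra. }
    rewrite <- (D0E lam) in Dom by lra.
    assert (Eg : (g (lam * zeta) - g (lam * z1))%C = (lam * N0 lam)%C).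
    { unfold N0, W, g, seg.
      rewrite (Cint_ext 0 1 (fun t : R => k (0 + t * (lam * zeta - 0)))%C
        (fun t : R => om (t * 1) * C_derive h (lam * (t * zeta)))%C); [|lra|].
      2:{ intros t _. unfold k. f_equal; [f_equal; field; auto|f_equal; ring]. }
      rewrite (Cint_ext 0 1 (fun t : R => k (0 + t * (lam * z1 - 0)))%C
        (fun t : R => om (t * x1) * C_derive h (lam * (t * z1)))%C); [|lra|].
      2:{ intros t _. unfold k, x1. f_equal; [f_equal; field; auto|f_equal; ring]. }
      ring. }
    rewrite Eg, !Cmod_mult in Dom. apply Rmult_le_reg_l with (Cmod lam); [lra|exact Dom]. }
  assert (Key : Cmod (N0 1 * / D0 1) <= 1).
  { apply (maximum_modulus (/ rho) (fun lam => N0 lam * / D0 lam)%C r1); try lra.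
    - apply holo_mult; auto. now apply holo_inv.
    - rewrite Cmod_1. lra.
    - intros lam Hl. assert (N := ND0 lam ltac:(lra)). assert (P := proj1 (Cmod_gt_0 _) N).
      rewrite Cmod_mult, Cmod_inv by auto. apply Rmult_le_reg_r with (Cmod (D0 lam)); auto.
      rewrite Rmult_assoc, Rinv_l by lra. specialize (Bd lam Hl). lra. }
  assert (M1 : Cmod 1 < / rho) by (rewrite Cmod_1; lra).
  assert (E1 : D0 1 = (h zeta - h z1)%C).
  { assert (Q := D0E 1 M1). rewrite !Cmult_1_l in Q. exact Q. }
  assert (N := ND0 1 M1). assert (P := proj1 (Cmod_gt_0 _) N).
  rewrite Cmod_mult, Cmod_inv in Key by auto.
  assert (Key' : Cmod (N0 1) <= Cmod (D0 1)).
  { apply Rmult_le_compat_r with (r := Cmod (D0 1)) in Key; [|lra].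
    rewrite Rmult_assoc, Rinv_l in Key by lra. lra. }
  assert (Split : forall z x, Cmod z <= rho -> (forall t : R, 0 <= t <= 1 -> Cmod (t * x) < xh) ->
    W (fun t : R => om (t * x)%C) z 1 =
    (W (fun _ => RtoC 1) z 1 - 2 * eps * (z * Cint (fun t : R => C_derive h (t * z) * / (A - t * x)) 0 1))%C).
  { intros z x Hz Hx. unfold W.
    assert (Cd : cont_on 0 1 (fun t : R => C_derive h (t * z))%C).
    { intros t Ht. apply (cont_ray RtoC (C_derive h) (fun t : R => t * z)%C t 1); auto.
      - apply Cmod_ray; auto. lra.
      - apply cont_mult; [apply cont_param|apply cont_const]. }
    assert (Ck : cont_on 0 1 (fun t : R => C_derive h (t * z) * / (A - t * x))%C).
    { intros t Ht. apply cont_mult; auto. apply cont_inv; [|now apply Hom, Hx].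
      apply cont_minus; [apply cont_const|]. apply cont_mult; [apply cont_param|apply cont_const]. }
    rewrite (Cint_ext 0 1 (fun t : R => om (t * x) * C_derive h (1 * (t * z)))%C
      (fun t : R => C_derive h (t * z) - 2 * eps * (C_derive h (t * z) * / (A - t * x)))%C); [|lra|].
    2:{ intros t Ht. rewrite Cmult_1_l. unfold om. unfold Cdiv. ring. }
    rewrite (Cint_ext 0 1 (fun t : R => 1 * C_derive h (1 * (t * z)))%C
      (fun t : R => C_derive h (t * z))%C); [|lra|].
    2:{ intros t _. now rewrite !Cmult_1_l. }
    rewrite Cint_minus, Cint_scal; auto; try lra; [ring|].
    intros t Ht. apply cont_mult; [apply cont_const|]. now apply Ck. }
  apply dot_of_Cmod_le with eps; auto. rewrite <- E1.
  replace (D0 1 - 2 * eps * (ray_kernel h A zeta zeta - ray_kernel h A zeta z1))%C with (N0 1); auto.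
  unfold N0, D0. rewrite !Split; auto.
  - unfold ray_kernel. fold x1.
    rewrite (Cint_ext 0 1 (fun t : R => C_derive h (t * zeta) * / (A - t * (zeta / zeta)))%C
      (fun t : R => C_derive h (t * zeta) * / (A - t * 1))%C); [ring|lra|].
    intros t _. do 3 f_equal. f_equal. field. exact Nzeta.
  - intros t Ht. apply Cmod_ray; auto. rewrite Cmod_1. lra.
Qed.

(** * The logarithmic divergence *)

Lemma dot_minus_r d u v : dot d (u - v) = dot d u - dot d v.
Proof. unfold dot, Re, Im; simpl. ring. Qed.

Lemma dot_le_Cmod d u : dot d u <= Cmod d * Cmod u.
Proof.
  rewrite dot_conj. eapply Rle_trans; [apply Rle_abs|]. eapply Rle_trans; [apply re_le_Cmod|].
  rewrite Cmod_mult, Cmod_conj. lra.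
Qed.

Lemma ln_primitive_bound m c A : 1 < A ->
  is_RInt (fun t => - m * / (A - t) + c) 0 1 (m * ln (A - 1) - m * ln A + c).
Proof.
  intros HA.
  replace (m * ln (A - 1) - m * ln A + c) with
    (minus (m * ln (A - 1) + c * 1) (m * ln (A - 0) + c * 0))
    by (unfold minus, plus, opp; simpl; rewrite Rminus_0_r; ring).
  apply (is_RInt_derive (V := R_CompleteNormedModule) (fun t => m * ln (A - t) + c * t)
    (fun t => - m * / (A - t) + c)).
  - intros t Ht. rewrite Rmin_left, Rmax_right in Ht by lra. auto_derive; [lra|]. field. lra.
  - intros t Ht. rewrite Rmin_left, Rmax_right in Ht by lra.
    apply (ex_derive_continuous (V := R_NormedModule)). auto_derive. lra.
Qed.

(** Let M t = dot d (f t).  Then M <= - m near t = 1, and M / (A - t) exceeds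
    - m / (A - t) by a bounded amount elsewhere; the latter integrates to m ln ((A - 1) / A). *)
Lemma log_divergence (f : R -> C) (d : C) : cont_on 0 1 f -> dot d (f 1) < 0 ->
  exists m c, 0 < m /\ forall A, 1 < A ->
    dot d (Cint (fun t : R => f t * / (A - t)%R)%C 0 1) <= m * ln (A - 1) + c.
Proof.
  intros Hf Hneg.
  assert (Cd : cont_on 0 1 (fun t => Cconj d * f t)%C).
  { intros t Ht. apply cont_mult; [apply cont_const|auto]. }
  set (M := fun t => dot d (f t)). set (m := - M 1 / 2).
  assert (m0 : 0 < m) by (unfold m, M; lra).
  destruct (cont_on_bounded _ _ _ Cd) as [B [B0 HB]].
  assert (HM : forall t, 0 <= t <= 1 -> M t <= B).
  { intros t Ht. unfold M. rewrite dot_conj. eapply Rle_trans; [apply Rle_abs|].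
    eapply Rle_trans; [apply re_le_Cmod|]. auto. }
  destruct (Cd 1 ltac:(lra) m m0) as [del [Pd Hd]].
  assert (Near : forall t, 1 - del < t <= 1 -> M t <= - m).
  { intros t Ht. specialize (Hd t). rewrite <- RtoC_minus, Cmod_R, Rabs_left1 in Hd by lra.
    specialize (Hd ltac:(lra)). assert (Q := re_le_Cmod (Cconj d * f t - Cconj d * f 1)%C).
    replace (Re (Cconj d * f t - Cconj d * f 1)%C) with (M t - M 1) in Q
      by (unfold M; rewrite !dot_conj; unfold Re; simpl; ring).
    assert (Q' := Rle_abs (M t - M 1)).
    replace (M 1) with (- 2 * m) in * by (unfold m; field). lra. }
  set (c := (B + m) / del). exists m, c. split; auto. intros A HA.
  assert (c0 : 0 < c) by (apply Rdiv_lt_0_compat; lra).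
  assert (Ck0 : cont_on 0 1 (fun t : R => f t * / (A - t)%R)%C).
  { intros t Ht. apply cont_mult; auto. apply cont_inv; [|apply RtoC_neq; lra].
    apply (cont_local RtoC (fun t : R => A - t)%C).
    - apply cont_minus; [apply cont_const|apply cont_param].
    - exists 1. split; [lra|]. intros. now rewrite RtoC_minus. }
  assert (Ck : cont_on 0 1 (fun t : R => Cconj d * (f t * / (A - t)%R))%C).
  { intros t Ht. apply cont_mult; [apply cont_const|auto]. }
  assert (EM : forall t, t <= 1 -> Re (Cconj d * (f t * / (A - t)%R))%C = M t * / (A - t)).
  { intros t Ht. unfold M. rewrite dot_conj, <- RtoC_inv, Cmult_assoc by lra. apply re_scal_r. }
  assert (E : dot d (Cint (fun t : R => f t * / (A - t)%R)%C 0 1) =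
              RInt (fun t => M t * / (A - t)) 0 1).
  { rewrite dot_conj, <- Cint_scal by (auto; lra).
    change (RInt (fun t => Re (Cconj d * (f t * / (A - t)%R))%C) 0 1 =
            RInt (fun t => M t * / (A - t)) 0 1).
    apply RInt_ext. intros t Ht. rewrite Rmin_left, Rmax_right in Ht by lra. apply EM; lra. }
  rewrite E.
  assert (B' := ln_primitive_bound m c A HA).
  assert (Hln : 0 <= ln A) by (rewrite <- ln_1; apply Rlt_le, ln_increasing; lra).
  apply Rle_trans with (RInt (fun t => - m * / (A - t) + c) 0 1).
  2:{ rewrite (is_RInt_unique _ _ _ _ B'). nra. }
  apply RInt_le; [lra| |now exists (m * ln (A - 1) - m * ln A + c)|].
  - apply (ex_RInt_ext (fun t => Re (Cconj d * (f t * / (A - t)%R))%C)).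
    + intros t Ht. rewrite Rmin_left, Rmax_right in Ht by lra.
      apply EM; lra.
    + apply (cont_on_Re 0 1 _ ltac:(lra) Ck).
  - intros t Ht. assert (P : 0 < / (A - t)) by (apply Rinv_0_lt_compat; lra).
    destruct (Rlt_le_dec (1 - del) t) as [L|L].
    + specialize (Near t ltac:(lra)). nra.
    + specialize (HM t ltac:(lra)).
      assert (Q : / (A - t) <= / del) by (apply Rinv_le_contravar; lra).
      apply Rle_trans with (B * / (A - t)); [apply Rmult_le_compat_r; lra|].
      apply Rle_trans with (- m * / (A - t) + (B + m) * / (A - t)); [right; ring|].
      apply Rplus_le_compat_l. unfold c, Rdiv. apply Rmult_le_compat_l; lra.
Qed.

(** * Support lines and convexity *)

(** If the product were negative, the singular part of the kernel at zeta would tend to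
    minus infinity as A tends to 1.  The part along the ray to z stays bounded, because
    Re (z / zeta) < 1 keeps A - t z / zeta away from 0.  This contradicts
    [kernel_dot_ge_0]. *)
Theorem support_line h zeta z : holo 1 h -> inj 1 h -> dominates h ->
  Cmod zeta < 1 -> Cmod z <= Cmod zeta ->
  0 <= dot (h zeta - h z) (zeta * C_derive h zeta).
Proof.
  intros H I HD Hzeta Hz. set (d := (h zeta - h z)%C).
  destruct (classic (z = zeta)) as [E|N].
  { unfold d. rewrite E. unfold dot, Re, Im; simpl. right. ring. }
  set (rho := Cmod zeta) in *.
  assert (rho0 : 0 < rho).
  { apply Rnot_le_lt. intros L. apply N.
    rewrite (Cmod_eq_0 zeta), (Cmod_eq_0 z); auto; apply Rle_antisym; try apply Cmod_ge_0; fold rho; lra. }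
  assert (Nzeta : zeta <> 0) by (apply Cmod_gt_0; exact rho0).
  assert (H' := holo_C_derive 1 h H).
  apply Rnot_lt_le. intros Neg.
  set (f := fun t : R => (zeta * C_derive h (t * zeta))%C).
  assert (Cray : forall y t, Cmod y < 1 -> 0 <= t <= 1 -> cont RtoC (fun t : R => C_derive h (t * y)%C) t).
  { intros y t Hy Ht. apply (cont_ray RtoC (C_derive h) (fun t : R => t * y)%C t 1); auto.
    - apply Cmod_ray; auto.
    - apply cont_mult; [apply cont_param|apply cont_const]. }
  destruct (log_divergence f d) as [m [c [m0 HL]]].
  { intros t Ht. apply cont_mult; [apply cont_const|]. now apply Cray. }
  { unfold f. now rewrite Cmult_1_l. }
  (* the kernel of the other end point stays bounded *)
  set (x := (z / zeta)%C).
  assert (Hx : Cmod x <= 1).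
  { unfold x. rewrite Cmod_div by auto. fold rho. apply Rmult_le_reg_r with rho; auto.
    unfold Rdiv. rewrite Rmult_assoc, Rinv_l by lra. lra. }
  assert (Hx1 : Re x < 1).
  { apply Re_lt_1; auto. intros E. apply N. replace z with (x * zeta)%C by (unfold x; field; auto).
    rewrite E. ring. }
  set (k := Rmin 1 (1 - Re x)). assert (k0 : 0 < k) by (apply Rmin_pos; lra).
  assert (Gap : forall A (t : R), 1 < A -> 0 <= t <= 1 -> k <= Cmod (A - t * x)).
  { intros A t HA Ht. assert (k1 := Rmin_l 1 (1 - Re x)). assert (k2 := Rmin_r 1 (1 - Re x)).
    fold k in k1, k2.
    eapply Rle_trans; [|apply re_le_Cmod]. eapply Rle_trans; [|apply Rle_abs].
    replace (Re (A - t * x)) with (A - t * Re x) by (unfold Re; simpl; ring).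
    destruct (Rle_lt_dec (Re x) 0); nra. }
  assert (Hz1 : Cmod z < 1) by lra.
  destruct (cont_on_bounded 0 1 (fun t : R => C_derive h (t * z)%C)) as [B [B0 HB]];
    [intros t Ht; now apply Cray|].
  set (c' := Cmod d * (Cmod z * (2 * (1 - 0) * (B * / k)))).
  (* for A = 1 + eta the sum m ln (A - 1) + c + c' is at most -1, and A rho < 1 *)
  set (eta := Rmin (1 - rho) (exp (- (c + c' + 1) / m))).
  assert (eta0 : 0 < eta) by (apply Rmin_pos; [lra|apply exp_pos]).
  assert (eta1 : eta <= 1 - rho) by apply Rmin_l.
  assert (eta2 : m * ln eta <= - (c + c' + 1)).
  { apply Rle_trans with (m * (- (c + c' + 1) / m)); [|right; field; lra].
    apply Rmult_le_compat_l; [lra|]. rewrite <- (ln_exp (- (c + c' + 1) / m)).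
    destruct (Rle_lt_or_eq_dec eta (exp (- (c + c' + 1) / m)) (Rmin_r _ _)) as [L|E].
    - left. now apply ln_increasing.
    - rewrite E. lra. }
  set (A := 1 + eta).
  assert (Pos := kernel_dot_ge_0 h zeta z A H I HD Hzeta Hz N ltac:(unfold A; lra)
     ltac:(fold rho; unfold A; nra)).
  fold d in Pos. rewrite dot_minus_r in Pos.
  assert (K1 : dot d (ray_kernel h A zeta zeta) <= m * ln eta + c).
  { replace eta with (A - 1) by (unfold A; ring).
    replace (ray_kernel h A zeta zeta) with (Cint (fun t : R => f t * / (A - t)%R)%C 0 1).
    - apply HL. unfold A; lra.
    - unfold ray_kernel. rewrite <- Cint_scal; [|lra|].
      + apply Cint_ext; [lra|]. intros t Ht. unfold f. rewrite RtoC_minus.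
        replace (zeta / zeta)%C with (RtoC 1) by (field; auto). rewrite Cmult_1_r. ring.
      + intros t Ht. apply cont_mult; [now apply Cray|]. apply cont_inv.
        * apply cont_minus; [apply cont_const|]. apply cont_mult; [apply cont_param|apply cont_const].
        * replace (zeta / zeta)%C with (RtoC 1) by (field; auto). rewrite Cmult_1_r, <- RtoC_minus.
          apply RtoC_neq. unfold A. lra. }
  assert (K2 : Cmod (ray_kernel h A zeta z) <= Cmod z * (2 * (1 - 0) * (B * / k))).
  { unfold ray_kernel. rewrite Cmod_mult. apply Rmult_le_compat_l; [apply Cmod_ge_0|]. fold x.
    assert (NA : forall t : R, 0 <= t <= 1 -> (A - t * x)%C <> 0).
    { intros t Ht. apply Cmod_gt_0. assert (G := Gap A t ltac:(unfold A; lra) Ht). lra. }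
    apply Cint_bound; [lra| |].
    - intros t Ht. apply cont_mult; [now apply Cray|]. apply cont_inv; auto.
      apply cont_minus; [apply cont_const|]. apply cont_mult; [apply cont_param|apply cont_const].
    - intros t Ht. rewrite Cmod_mult, Cmod_inv by auto.
      apply Rmult_le_compat; try apply Cmod_ge_0; auto.
      + left. apply Rinv_0_lt_compat, Cmod_gt_0. auto.
      + apply Rinv_le_contravar; auto. apply Gap; auto. unfold A; lra. }
  assert (K3 : - dot d (ray_kernel h A zeta z) <= c').
  { replace (- dot d (ray_kernel h A zeta z)) with (dot d (- ray_kernel h A zeta z))
      by (unfold dot, Re, Im; simpl; ring).
    eapply Rle_trans; [apply dot_le_Cmod|]. rewrite Cmod_opp. unfold c'.
    apply Rmult_le_compat_l; [apply Cmod_ge_0|exact K2]. }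
  lra.
Qed.

(** h - b has no zeros on some disk of radius greater than rho: if b = h u then |u| > rho and
    the disk of radius |u| serves, otherwise the unit disk does.  The minimum principle
    applies on a circle in between. *)
Lemma closed_disk_image h rho b : holo 1 h -> inj 1 h -> 0 <= rho < 1 ->
  (forall z, Cmod z <= rho -> h z <> b) ->
  exists m, 0 < m /\ forall z, Cmod z <= rho -> m <= Cmod (h z - b).
Proof.
  intros H I Hrho N.
  assert (Out : exists R1, rho < R1 <= 1 /\ forall z, Cmod z < R1 -> (h z - b)%C <> 0).
  { destruct (classic (exists u, Cmod u < 1 /\ h u = b)) as [[u [Hu Eu]]|N'].
    - exists (Cmod u). split.
      + split; [|lra]. apply Rnot_le_lt. intros L. now apply (N u).
      + intros z Hz E. apply Ceq_minus in E. rewrite <- Eu in E. apply I in E; try lra.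
        rewrite E in Hz. lra.
    - exists 1. split; [lra|]. intros z Hz E. apply N'. exists z. split; auto. now apply Ceq_minus. }
  destruct Out as [R1 [HR N1]]. set (r := (rho + R1) / 2).
  assert (Hb : holo R1 (fun z => h z - b)%C).
  { apply holo_minus; [apply (holo_le _ 1); auto; lra|apply holo_const]. }
  destruct (circle_min R1 (fun z => h z - b)%C r) as [m [m0 Hm]]; auto; [unfold r; lra| |].
  { intros z Hz. apply N1. unfold r in Hz; lra. }
  exists m. split; auto. intros z Hz.
  apply (minimum_modulus R1 (fun z => h z - b)%C r); auto; unfold r; lra.
Qed.

Lemma sup_exists (P : R -> Prop) : P 0 -> (forall t, P t -> t <= 1) ->
  exists s, 0 <= s <= 1 /\ (forall t, P t -> t <= s) /\
    forall eps, 0 < eps -> exists t, P t /\ s - eps < t.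
Proof.
  intros P0 P1. destruct (completeness P) as [s [U L]].
  - exists 1. intros t Ht. now apply P1.
  - now exists 0.
  - exists s. split; [split; [now apply U|apply L; intros t Ht; now apply P1]|].
    split; [exact U|]. intros eps He. apply NNPP. intros N.
    assert (Q : s <= s - eps).
    { apply L. intros t Ht. apply Rnot_lt_le. intros Lt. apply N. now exists t. }
    lra.
Qed.

(** Let x be a convex combination of points of K = h(|z| <= rho) outside K.  The segment from
    the interior point h 0 to x leaves K at some h zeta with |zeta| = rho.  The support line
    there has all of K on one side, hence x too; but h 0 is strictly on that side, so x,
    which lies beyond h zeta, is strictly on the other. *)
Theorem dominates_convex h : holo 1 h -> inj 1 h -> dominates h ->
  convex_set (image_set h unit_disk).
Proof.
  intros H I HD w1 w2 tau [z1 [Hz1 E1]] [z2 [Hz2 E2]] Htau. unfold unit_disk in *.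
  set (x := (RtoC (1 - tau) * w1 + RtoC tau * w2)%C).
  (* 1 / 2 only keeps rho positive, so that h 0 is interior to K *)
  set (rho := Rmax (/ 2) (Rmax (Cmod z1) (Cmod z2))).
  assert (Hrho : / 2 <= rho < 1) by (split; [apply Rmax_l|repeat apply Rmax_lub_lt; lra]).
  assert (B1 : Cmod z1 <= rho) by (eapply Rle_trans; [|apply Rmax_r]; apply Rmax_l).
  assert (B2 : Cmod z2 <= rho) by (eapply Rle_trans; [|apply Rmax_r]; apply Rmax_r).
  set (K := fun w => exists z, Cmod z <= rho /\ w = h z).
  assert (HK : K x -> exists z, Cmod z < 1 /\ x = h z).
  { intros [z [Hz E]]. exists z. split; [lra|auto]. }
  apply HK. apply NNPP. intros Nx.
  set (a := h 0). set (S := fun t : R => (a + t * (x - a))%C).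
  (* S t0 is the point where the segment from a to x leaves K *)
  destruct (sup_exists (fun t => 0 <= t <= 1 /\ forall s, 0 <= s <= t -> K (S s)))
    as [t0 [Ht0 [U App]]].
  { split; [lra|]. intros s Hs. replace s with 0 by lra. exists 0. rewrite Cmod_0. split; [lra|].
    unfold S. fold a. ring. }
  { intros t [Ht _]. lra. }
  assert (Below : forall s, 0 <= s < t0 -> K (S s)).
  { intros s Hs. destruct (App (t0 - s)) as [t [[Ht HtK] Lt]]; [lra|]. apply HtK. lra. }
  assert (L0 : 0 < Cmod (x - a) + 1) by (assert (Q := Cmod_ge_0 (x - a)); lra).
  assert (Dist : forall s t : R, Cmod (S s - S t) = Rabs (s - t) * Cmod (x - a)).
  { intros s t. unfold S. replace (a + s * (x - a) - (a + t * (x - a)))%C with ((s - t)%R * (x - a))%C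
      by (rewrite RtoC_minus; ring). now rewrite Cmod_mult, Cmod_R. }
  assert (Kb : K (S t0)).
  { apply NNPP. intros N.
    destruct (closed_disk_image h rho (S t0) H I ltac:(lra)) as [m [m0 Hm]].
    { intros z Hz E. apply N. now exists z. }
    destruct (App (m / (Cmod (x - a) + 1))) as [t [[Ht HtK] Lt]]; [now apply Rdiv_lt_0_compat|].
    destruct (HtK t ltac:(lra)) as [z [Hz Ez]]. specialize (Hm z Hz). rewrite <- Ez, Dist in Hm.
    specialize (U t (conj Ht HtK)). rewrite Rabs_left1 in Hm by lra.
    assert (Q : (t0 - t) * (Cmod (x - a) + 1) < m).
    { apply Rlt_le_trans with (m / (Cmod (x - a) + 1) * (Cmod (x - a) + 1)).
      - apply Rmult_lt_compat_r; lra.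
      - right. field. lra. }
    nra. }
  assert (t01 : t0 < 1).
  { destruct (Req_dec t0 1) as [E|]; [|lra]. exfalso. apply Nx. rewrite E in Kb.
    replace x with (S 1) by (unfold S; ring). exact Kb. }
  destruct Kb as [zeta [Hzeta Eb]].
  assert (Mz : Cmod zeta = rho).
  { apply Rle_antisym; auto. apply Rnot_lt_le. intros L.
    destruct (inj_open 1 h zeta (rho - Cmod zeta) H I ltac:(lra) ltac:(lra)) as [d [Pd Hd]].
    set (e := Rmin (1 - t0) (d / (Cmod (x - a) + 1)) / 2).
    assert (Pm : 0 < Rmin (1 - t0) (d / (Cmod (x - a) + 1))).
    { apply Rmin_pos; [lra|]. now apply Rdiv_lt_0_compat. }
    assert (m1 := Rmin_l (1 - t0) (d / (Cmod (x - a) + 1))).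
    assert (m2 := Rmin_r (1 - t0) (d / (Cmod (x - a) + 1))).
    assert (Q : t0 + e <= t0); [|unfold e in Q; lra].
    apply U. split; [unfold e; lra|]. intros s Hs.
    destruct (Rlt_le_dec s t0) as [Ls|Ls]; [apply Below; lra|].
    destruct (Hd (S s)) as [u [_ [Hu Eu]]].
    - rewrite <- Eb, Dist, Rabs_pos_eq by lra.
      assert (Q : (s - t0) * (Cmod (x - a) + 1) < d).
      { apply Rlt_le_trans with (d / (Cmod (x - a) + 1) * (Cmod (x - a) + 1)).
        - apply Rmult_lt_compat_r; [lra|]. unfold e in Hs. lra.
        - right. field. lra. }
      assert (Q' := Cmod_ge_0 (x - a)). nra.
    - exists u. split; auto. assert (T := Cmod_rev_triangle u zeta). lra. }
  set (nu := (zeta * C_derive h zeta)%C).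
  assert (Nnu : 0 < Cmod nu).
  { apply Cmod_gt_0. apply Cmult_neq_0; [apply Cmod_gt_0; lra|]. apply (inj_derive_neq_0 1); auto. lra. }
  assert (Sup : forall z, Cmod z <= rho -> 0 <= dot (S t0 - h z) nu).
  { intros z Hz. rewrite Eb. apply support_line; auto; lra. }
  assert (Sx : 0 <= dot (S t0 - x) nu).
  { assert (S1 := Sup z1 B1). assert (S2 := Sup z2 B2). rewrite <- E1 in S1. rewrite <- E2 in S2.
    replace (dot (S t0 - x) nu) with ((1 - tau) * dot (S t0 - w1) nu + tau * dot (S t0 - w2) nu)
      by (unfold x, dot, Re, Im; simpl; ring).
    nra. }
  (* a = h 0 is an interior point, hence strictly on one side *)
  destruct (inj_open 1 h 0 rho H I ltac:(rewrite Cmod_0; lra) ltac:(lra)) as [d [Pd Hd]].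
  set (e := d / (2 * Cmod nu)). assert (e0 : 0 < e) by (apply Rdiv_lt_0_compat; lra).
  destruct (Hd (a + e * nu)%C) as [u [_ [Hu Eu]]].
  { replace (a + e * nu - h 0)%C with (e * nu)%C by (unfold a; ring).
    rewrite Cmod_mult, Cmod_R, Rabs_pos_eq by lra. unfold e.
    replace (d / (2 * Cmod nu) * Cmod nu) with (d / 2) by (field; lra). lra. }
  replace (u - 0)%C with u in Hu by ring.
  assert (Sa := Sup u ltac:(lra)). rewrite <- Eu in Sa.
  assert (P : 0 < dot nu nu) by (rewrite <- Cmod_sqr; nra).
  assert (X1 : dot (S t0 - (a + e * nu)) nu = t0 * dot (x - a) nu - e * dot nu nu)
    by (unfold S, dot, Re, Im; simpl; ring).
  assert (X2 : dot (S t0 - x) nu = - (1 - t0) * dot (x - a) nu)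
    by (unfold S, dot, Re, Im; simpl; ring).
  rewrite X1 in Sa. rewrite X2 in Sx.
  assert (Y : dot (x - a) nu <= 0) by nra.
  assert (0 < e * dot nu nu) by nra. nra.
Qed.

(** * Open and connected sets of the plane *)

Lemma open_of_Cmod (A : C -> Prop) :
  (forall z, A z -> exists d, 0 < d /\ forall w, Cmod (w - z) < d -> A w) -> open A.
Proof.
  intros H z Hz. destruct (H z Hz) as [d [P Hd]].
  assert (P2 : 0 < d / 2) by lra.
  exists (mkposreal _ P2). intros w Hw. apply Hd.
  assert (Q := C_NormedModule_mixin_compat2 z w (mkposreal _ P2) Hw).
  change (Cmod (w - z) < sqrt 2 * (d / 2)) in Q.
  assert (sqrt 2 < 2) by (rewrite <- (sqrt_square 2) at 2 by lra; apply sqrt_lt_1; lra).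
  nra.
Qed.

Lemma Cmod_of_open (A : C -> Prop) z : open A -> A z ->
  exists d, 0 < d /\ forall w, Cmod (w - z) < d -> A w.
Proof.
  intros H Hz. destruct (H z Hz) as [d Hd]. exists d. split; [apply cond_pos|].
  intros w Hw. apply Hd. apply C_NormedModule_mixin_compat1. exact Hw.
Qed.

(** On a segment from a point of A to a point of B, take the supremum of the parameters with
    values in A.  Its value cannot be in A before the end of the segment, as A is open, so
    it is in B, and B contains nearby points of A. *)
Lemma convex_connected U : convex_set U -> connected_set U.
Proof.
  intros HU A B OA OB Cov [z1 [U1 A1]] [z2 [U2 B2]].
  set (c := fun t : R => (RtoC (1 - t) * z1 + RtoC t * z2)%C).
  assert (Uc : forall t, 0 <= t <= 1 -> U (c t)) by (intros; now apply HU).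
  assert (L0 : 0 < Cmod (z2 - z1) + 1) by (assert (Q := Cmod_ge_0 (z2 - z1)); lra).
  assert (Near : forall (W : C -> Prop) s, open W -> W (c s) ->
            exists d, 0 < d /\ forall t, Rabs (t - s) < d -> W (c t)).
  { intros W s OW Ws. destruct (Cmod_of_open W (c s) OW Ws) as [d [P Hd]].
    exists (d / (Cmod (z2 - z1) + 1)). split; [now apply Rdiv_lt_0_compat|]. intros t Ht. apply Hd.
    replace (c t - c s)%C with ((t - s)%R * (z2 - z1))%C by (unfold c; rewrite !RtoC_minus; ring).
    rewrite Cmod_mult, Cmod_R.
    apply Rmult_lt_compat_r with (r := Cmod (z2 - z1) + 1) in Ht; auto.
    replace (d / (Cmod (z2 - z1) + 1) * (Cmod (z2 - z1) + 1)) with d in Ht by (field; lra).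
    assert (Q := Rabs_pos (t - s)). lra. }
  assert (c0 : c 0 = z1) by (unfold c; rewrite Rminus_0_r; ring).
  assert (c1 : c 1 = z2) by (unfold c; replace (1 - 1) with 0 by ring; ring).
  destruct (sup_exists (fun t => 0 <= t <= 1 /\ A (c t))) as [s [Hs [Up App]]].
  { split; [lra|]. now rewrite c0. }
  { intros t [Ht _]. lra. }
  destruct (Cov (c s) (Uc s Hs)) as [As|Bs].
  - destruct (Req_dec s 1) as [E|N].
    + exists z2. rewrite E, c1 in As. auto.
    + exfalso. destruct (Near A s OA As) as [d [P Hd]].
      set (e := Rmin (1 - s) (d / 2)). assert (e0 : 0 < e) by (apply Rmin_pos; lra).
      assert (e1 : e <= 1 - s) by apply Rmin_l. assert (e2 : e <= d / 2) by apply Rmin_r.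
      assert (Q : s + e <= s); [|lra].
      apply Up. split; [lra|]. apply Hd. rewrite Rabs_pos_eq by lra. lra.
  - destruct (Near B s OB Bs) as [d [P Hd]].
    destruct (App d P) as [t [[Ht At] Lt]]. exists (c t). split; [now apply Uc|]. split; auto.
    apply Hd. specialize (Up t (conj Ht At)). rewrite Rabs_left1 by lra. lra.
Qed.

Lemma unit_disk_domain : Defs.domain unit_disk.
Proof.
  split; [exists 0; unfold unit_disk; rewrite Cmod_0; lra|]. split.
  - apply open_of_Cmod. intros z Hz. exact (disk_nbhd 1 z Hz).
  - apply convex_connected. intros p q t Hp Hq Ht. unfold unit_disk in *.
    replace (RtoC (1 - t) * p + RtoC t * q)%C with (p + t * (q - p))%C
      by (rewrite RtoC_minus; ring).
    now apply Cmod_convex_lt.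
Qed.

Lemma holo_unit_disk f : holomorphic_on unit_disk f <-> holo 1 f.
Proof.
  split; intros H z Hz; destruct (H z Hz) as [l Hl]; exists l; now apply der_is_derive.
Qed.

(** * Harmonicity *)

Lemma disk_locally_2d r x y : Cmod (x, y) < r -> locally_2d (fun u v => Cmod (u, v) < r) x y.
Proof.
  intros H. assert (P : 0 < (r - Cmod (x, y)) / 2) by lra.
  exists (mkposreal _ P). simpl. intros u v Hu Hv.
  assert (T := Cmod_rev_triangle (u, v) (x, y)). assert (S := Cmod_le_sum ((u, v) - (x, y))%C).
  change (Re ((u, v) - (x, y))%C) with (u - x) in S.
  change (Im ((u, v) - (x, y))%C) with (v - y) in S. lra.
Qed.

Lemma der_horizontal f x y l : der zid f (x, y) l -> der RtoC (fun t => f (t, y)) x l.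
Proof.
  intros H. replace l with (l * 1)%C by ring. apply (der_comp RtoC f (fun t => (t, y))); auto.
  replace (RtoC 1) with ((1, 0) : C) by reflexivity.
  apply parts_der_R; [apply (is_derive_id (K := R_AbsRing))|apply (is_derive_const (V := R_NormedModule))].
Qed.

(** The vertical derivative is i times the complex one. *)
Lemma der_vertical f x y l : der zid f (x, y) l -> der RtoC (fun t => f (x, t)) y (Ci * l)%C.
Proof.
  intros H. rewrite Cmult_comm. apply (der_comp RtoC f (fun t => (x, t))); auto.
  apply parts_der_R; [apply (is_derive_const (V := R_NormedModule))|apply (is_derive_id (K := R_AbsRing))].
Qed.

Lemma holo_Ci r f : holo r f -> holo r (fun z => Ci * C_derive f z)%C.
Proof. intros H. apply holo_scal. now apply holo_C_derive. Qed.

Lemma is_derive_Re_x r f x y : holo r f -> Cmod (x, y) < r ->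
  is_derive (fun t => Re (f (t, y))) x (Re (C_derive f (x, y))).
Proof.
  intros H Hz. apply (der_R_parts (fun t => f (t, y))), der_horizontal. now apply (holo_der r).
Qed.

Lemma is_derive_Re_y r f x y : holo r f -> Cmod (x, y) < r ->
  is_derive (fun t => Re (f (x, t))) y (Re (Ci * C_derive f (x, y))%C).
Proof.
  intros H Hz. apply (der_R_parts (fun t => f (x, t))), der_vertical. now apply (holo_der r).
Qed.

(** Both partial derivatives of Re f are real parts of holomorphic functions, f' and i f'. *)
Lemma ex_diff_n_Re r f n x y : holo r f -> Cmod (x, y) < r ->
  ex_diff_n (fun u v => Re (f (u, v))) n x y.
Proof.
  revert f. induction n as [|n IH]; intros f H Hz.
  all: assert (C2 : continuity_2d_pt (fun u v => Re (f (u, v))) x y) by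
   (intros eps; destruct (holo_cont r f (x, y) H Hz eps (cond_pos eps)) as [d [P Hd]];
    assert (P2 : 0 < d / 2) by lra; exists (mkposreal _ P2); simpl; intros u v Hu Hv;
    eapply Rle_lt_trans; [apply (re_le_Cmod (f (u, v) - f (x, y)))|]; apply Hd;
    eapply Rle_lt_trans; [apply Cmod_le_sum|];
    change (Rabs (u - x) + Rabs (v - y) < d); lra).
  - split; auto.
  - split; [exact C2|]. split; [eexists; now apply (is_derive_Re_x r)|].
    split; [eexists; now apply (is_derive_Re_y r)|]. split.
    + apply ex_diff_n_ext_loc with (fun u v => Re (C_derive f (u, v))).
      * destruct (disk_locally_2d r x y Hz) as [d Hd]. exists d. intros u v Hu Hv.
        symmetry. apply is_derive_unique. apply (is_derive_Re_x r); auto.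
      * apply IH; auto. now apply holo_C_derive.
    + apply ex_diff_n_ext_loc with (fun u v => Re (Ci * C_derive f (u, v))%C).
      * destruct (disk_locally_2d r x y Hz) as [d Hd]. exists d. intros u v Hu Hv.
        symmetry. apply is_derive_unique. apply (is_derive_Re_y r); auto.
      * apply (IH (fun z => Ci * C_derive f z)%C); auto. now apply holo_Ci.
Qed.

Lemma laplace_Re r f x y : holo r f -> Cmod (x, y) < r ->
  partial_derive 2 0 (fun u v => Re (f (u, v))) x y +
  partial_derive 0 2 (fun u v => Re (f (u, v))) x y = 0.
Proof.
  intros H Hz. unfold partial_derive. simpl.
  assert (H' := holo_C_derive r f H). destruct (disk_locally_2d r x y Hz) as [d Hd].
  assert (E1 : Derive (fun t => Derive (fun t => Re (f (t, y))) t) x = Re (C_derive (C_derive f) (x, y))).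
  { rewrite (Derive_ext_loc _ (fun t => Re (C_derive f (t, y)))).
    - apply is_derive_unique. now apply (is_derive_Re_x r).
    - exists d. intros t Ht. apply is_derive_unique. apply (is_derive_Re_x r); auto.
      apply Hd; auto. rewrite Rminus_diag, Rabs_R0. apply cond_pos. }
  assert (E2 : Derive (fun t => Derive (fun t => Re (f (x, t))) t) y =
    Re (Ci * (Ci * C_derive (C_derive f) (x, y)))%C).
  { rewrite (Derive_ext_loc _ (fun t => Re (Ci * C_derive f (x, t))%C)).
    - apply is_derive_unique.
      apply (der_R_parts (fun t => (Ci * C_derive f (x, t))%C)). apply der_scal, der_vertical.
      now apply (holo_der r).
    - exists d. intros t Ht. apply is_derive_unique. apply (is_derive_Re_y r); auto.
      apply Hd; auto. rewrite Rminus_diag, Rabs_R0. apply cond_pos. }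
  unfold Derive in E1, E2 |- *. rewrite E1, E2. unfold Ci, Re; simpl. ring.
Qed.

Lemma harmonic_Re r f u : holo r f -> (forall x y, u x y = Re (f (x, y))) ->
  real_harmonic_on (fun z => Cmod z < r) u.
Proof.
  intros H E.
  replace u with (fun x y => Re (f (x, y))).
  - intros x y Hz. split; [now apply (ex_diff_n_Re r)|now apply (laplace_Re r)].
  - apply functional_extensionality. intros x. apply functional_extensionality. auto.
Qed.

(** Re (h + conj g) = Re (h + g) and Im (h + conj g) = Re (- i (h - g)). *)
Lemma harmonic_sum h g : holo 1 h -> holo 1 g ->
  harmonic_mapping_on unit_disk (fun z => h z + Cconj (g z))%C.
Proof.
  intros Hh Hg. split; [apply unit_disk_domain|]. split.
  - apply (harmonic_Re 1 (fun z => h z + g z)%C); [now apply holo_plus|].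
    intros x y. unfold Re, Cconj; simpl. reflexivity.
  - apply (harmonic_Re 1 (fun z => - Ci * (h z - g z))%C).
    + apply holo_scal. now apply holo_minus.
    + intros x y. unfold Re, Im, Cconj, Ci; simpl. ring.
Qed.

(** * The two implications *)

(** If |g z - g w| > |h z - h w|, a multiple mu g with |mu| <= 1 satisfies
    mu (g z - g w) = - conj (h z - h w), and then h + conj (mu g) agrees at z and w. *)
Lemma univalent_dominates h : holo 1 h -> inj 1 h ->
  (forall f g : C -> C,
      harmonic_mapping_on unit_disk f ->
      holomorphic_on unit_disk g ->
      (forall z : C, unit_disk z -> f z = Cplus (h z) (Cconj (g z))) ->
      (forall z : C, unit_disk z -> (Cmod (C_derive g z) < Cmod (C_derive h z))%R) ->
      univalent_on unit_disk f) ->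
  dominates h.
Proof.
  intros H I Huniv g Hg Hlt z w Hz Hw. apply Rnot_lt_le. intros L.
  assert (Ng : (g z - g w)%C <> 0).
  { apply Cmod_gt_0. assert (Q := Cmod_ge_0 (h z - h w)). lra. }
  set (mu := (- Cconj (h z - h w) / (g z - g w))%C).
  assert (Mmu : Cmod mu <= 1).
  { unfold mu. rewrite Cmod_div, Cmod_opp, Cmod_conj by auto.
    apply Cmod_gt_0 in Ng. apply Rmult_le_reg_r with (Cmod (g z - g w)); auto.
    unfold Rdiv. rewrite Rmult_assoc, Rinv_l by lra. lra. }
  assert (Hmg : holo 1 (fun u => mu * g u)%C) by now apply holo_scal.
  assert (E : z = w).
  { apply (Huniv (fun u => h u + Cconj (mu * g u))%C (fun u => mu * g u)%C); auto.
    - now apply harmonic_sum.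
    - now apply holo_unit_disk.
    - intros u Hu. rewrite (der_C_derive (fun u => mu * g u)%C u (mu * C_derive g u)%C).
      + rewrite Cmod_mult. specialize (Hlt u Hu). assert (Q := Cmod_ge_0 (C_derive g u)). nra.
      + apply der_scal. now apply (holo_der 1).
    - apply Ceq_minus.
      replace (h z + Cconj (mu * g z) - (h w + Cconj (mu * g w)))%C with
        (h z - h w + Cconj (mu * (g z - g w)))%C.
      + replace (mu * (g z - g w))%C with (- Cconj (h z - h w))%C by (unfold mu; field; auto).
        apply injective_projections; simpl; ring.
      + apply injective_projections; simpl; ring. }
  subst w. replace (g z - g z)%C with (RtoC 0) in L by ring.
  replace (h z - h z)%C with (RtoC 0) in L by ring. lra.
Qed.

Lemma inj_image_open R0 h : holo R0 h -> inj R0 h ->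
  open (image_set h (fun z => Cmod z < R0)).
Proof.
  intros H I. apply open_of_Cmod. intros w [z [Hz ->]].
  destruct (inj_open R0 h z 1 H I Hz ltac:(lra)) as [d [P Hd]]. exists d. split; auto.
  intros v Hv. destruct (Hd v Hv) as [u [Hu [_ E]]]. now exists u.
Qed.

(** The slope of the inverse is the reciprocal of the slope of h, evaluated at the preimage;
    by [inj_open] the preimage tends to z. *)
Lemma der_inverse R0 h k z : holo R0 h -> inj R0 h -> Cmod z < R0 -> C_derive h z <> 0 ->
  (forall u, Cmod u < R0 -> k (h u) = u) -> der zid k (h z) (/ C_derive h z)%C.
Proof.
  intros H I Hz N Hk eps He.
  assert (Hd := holo_der R0 h z H Hz). apply der_slope in Hd.
  destruct Hd as [p [Cp [Ep Sp]]]. unfold zid in *.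
  assert (Np : p z <> 0) by now rewrite Ep.
  destruct (cont_inv zid p z Cp Np eps He) as [d1 [P1 H1]].
  destruct (Cp (Cmod (p z))) as [d2 [P2 H2]]; [now apply Cmod_gt_0|]. unfold zid in *.
  destruct (inj_open R0 h z (Rmin d1 d2) H I Hz ltac:(now apply Rmin_pos)) as [d [P Hd]].
  exists d. split; auto. intros w Hw. destruct (Hd w Hw) as [u [Hu [Huz E]]]. subst w.
  assert (A := Rmin_l d1 d2). assert (B := Rmin_r d1 d2).
  specialize (H1 u ltac:(lra)). specialize (H2 u ltac:(lra)).
  assert (Nu : p u <> 0).
  { intros Z. rewrite Z in H2. replace (0 - p z)%C with (- p z)%C in H2 by ring.
    rewrite Cmod_opp in H2. lra. }
  rewrite !Hk by auto.
  replace (u - z - / C_derive h z * (h u - h z))%C with ((/ p u - / p z) * (h u - h z))%C.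
  - rewrite Cmod_mult. apply Rmult_le_compat_r; [apply Cmod_ge_0|lra].
  - rewrite Sp, <- Ep. field. auto.
Qed.

(** The real mean value theorem for the projection of k on the direction k 1 - k 0. *)
Lemma mean_value (k : R -> C) (dk : R -> C) (M : R) :
  (forall t, 0 <= t <= 1 -> der RtoC k t (dk t)) -> k 1 <> k 0 ->
  (forall t, 0 <= t <= 1 -> Cmod (dk t) < M) -> Cmod (k 1 - k 0) < M.
Proof.
  intros Hk N HM. set (c := (k 1 - k 0)%C).
  assert (P : 0 < Cmod c) by (apply Cmod_gt_0; now apply Cminus_eq_contra).
  destruct (MVT_cor2 (fun t => Re (Cconj c * k t)%C) (fun t => Re (Cconj c * dk t)%C) 0 1)
    as [t [E Ht]]; [lra| |].
  { intros t Ht. apply is_derive_Reals. apply (der_R_parts (fun t => Cconj c * k t)%C).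
    apply der_scal. auto. }
  rewrite <- !dot_conj, <- dot_minus_r, Rminus_0_r, Rmult_1_r in E. fold c in E.
  rewrite <- Cmod_sqr in E. assert (Q := dot_le_Cmod c (dk t)). specialize (HM t ltac:(lra)).
  rewrite <- E in Q. apply Rmult_lt_reg_l with (Cmod c); auto. nra.
Qed.

(** If f z1 = f z2 then |g z2 - g z1| = |h z2 - h z1|.  Along the segment from h z1 to h z2
    the derivative of g o h^-1 has modulus |g'| / |h'| < 1, which makes the left side
    smaller. *)
Lemma convex_univalent h f g : holo 1 h -> inj 1 h -> holo 1 g ->
  convex_set (image_set h unit_disk) ->
  (forall z, Cmod z < 1 -> f z = (h z + Cconj (g z))%C) ->
  (forall z, Cmod z < 1 -> Cmod (C_derive g z) < Cmod (C_derive h z)) ->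
  univalent_on unit_disk f.
Proof.
  intros H I Hg Hconv Hf Hlt z1 z2 Hz1 Hz2 E. apply NNPP. intros N. unfold unit_disk in *.
  assert (Ex : forall w, exists u, (exists u, Cmod u < 1 /\ w = h u) -> Cmod u < 1 /\ w = h u).
  { intros w. destruct (classic (exists u, Cmod u < 1 /\ w = h u)) as [[u Hu]|Nw].
    - exists u. auto.
    - exists 0. tauto. }
  set (k := fun w => proj1_sig (constructive_indefinite_description _ (Ex w))).
  assert (Hk : forall u, Cmod u < 1 -> k (h u) = u).
  { intros u Hu. unfold k. destruct (constructive_indefinite_description _ (Ex (h u))) as [v Hv].
    simpl. destruct Hv as [Hv E']; [now exists u|]. apply I; auto. }
  set (c := fun t : R => (h z1 + t * (h z2 - h z1))%C).
  assert (Hc : forall t, 0 <= t <= 1 -> exists u, Cmod u < 1 /\ c t = h u).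
  { intros t Ht. destruct (Hconv (h z1) (h z2) t) as [u [Hu Eu]]; auto; [now exists z1|now exists z2|].
    exists u. split; auto. rewrite <- Eu. unfold c. rewrite RtoC_minus. ring. }
  set (D := (h z2 - h z1)%C).
  assert (ND : D <> 0).
  { intros Z. apply Ceq_minus in Z. apply N. apply I; auto. }
  assert (Eg : Cmod (g z2 - g z1) = Cmod D).
  { rewrite !Hf in E by auto. rewrite <- Cmod_conj. unfold D. rewrite (Cmod_minus_sym (h z2)).
    f_equal. replace (h z1 - h z2)%C with (h z1 + Cconj (g z1) - h z2 - Cconj (g z1))%C by ring.
    rewrite E. apply injective_projections; simpl; ring. }
  assert (c0 : k (c 0) = z1).
  { replace (c 0) with (h z1) by (unfold c; ring). auto. }
  assert (c1 : k (c 1) = z2).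
  { replace (c 1) with (h z2) by (unfold c; ring). auto. }
  assert (PD := proj1 (Cmod_gt_0 D) ND).
  assert (B : Cmod (g (k (c 1)) - g (k (c 0))) < Cmod D).
  { apply (mean_value (fun t => g (k (c t)))
      (fun t => C_derive g (k (c t)) * (/ C_derive h (k (c t)) * D))%C).
    - intros t Ht. destruct (Hc t Ht) as [u [Hu Eu]].
      assert (Ku : k (c t) = u) by (rewrite Eu; auto). rewrite Ku.
      apply (der_comp RtoC g (fun t => k (c t))).
      + rewrite Ku. now apply (holo_der 1).
      + apply (der_comp RtoC k c).
        * rewrite Eu. apply (der_inverse 1); auto. apply (inj_derive_neq_0 1); auto.
        * unfold c, D. apply der_eq with (0 + (1 * (h z2 - h z1) + t * 0))%C; [|ring].
          apply der_plus; [apply der_const|].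
          apply (der_mult RtoC RtoC (fun _ => h z2 - h z1)%C); [apply der_param|apply der_const].
    - rewrite c0, c1. intros Z. rewrite Z in Eg. replace (g z1 - g z1)%C with (RtoC 0) in Eg by ring.
      rewrite Cmod_0 in Eg. lra.
    - intros t Ht. destruct (Hc t Ht) as [u [Hu Eu]].
      assert (Ku : k (c t) = u) by (rewrite Eu; auto). rewrite Ku.
      assert (Nh : C_derive h u <> 0) by (apply (inj_derive_neq_0 1); auto).
      rewrite !Cmod_mult, Cmod_inv by auto. specialize (Hlt u Hu).
      apply Cmod_gt_0 in Nh. rewrite <- Rmult_assoc.
      rewrite <- (Rmult_1_l (Cmod D)) at 2. apply Rmult_lt_compat_r; auto.
      apply Rmult_lt_reg_r with (Cmod (C_derive h u)); auto.
      rewrite Rmult_assoc, Rinv_l by lra. lra. }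
  rewrite c0, c1 in B. lra.
Qed.

Theorem mainTheorem2 (h : C -> C)
    (h_holomorphic : holomorphic_on unit_disk h)
    (h_univalent : univalent_on unit_disk h) :
  (forall f g : C -> C,
      harmonic_mapping_on unit_disk f ->
      holomorphic_on unit_disk g ->
      (forall z : C, unit_disk z -> f z = Cplus (h z) (Cconj (g z))) ->
      (forall z : C, unit_disk z -> (Cmod (C_derive g z) < Cmod (C_derive h z))%R) ->
      univalent_on unit_disk f)
  <-> convex_domain (image_set h unit_disk).
Proof.
  assert (H : holo 1 h) by now apply holo_unit_disk.
  assert (I : inj 1 h) by exact h_univalent.
  split.
  - intros Huniv.
    assert (K : convex_set (image_set h unit_disk)).
    { apply dominates_convex; auto. now apply univalent_dominates. }
    split; [|exact K]. split; [|split].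
    + exists (h 0). exists 0. split; [|reflexivity]. unfold unit_disk. rewrite Cmod_0. lra.
    + now apply (inj_image_open 1).
    + now apply convex_connected.
  - intros [_ K] f g _ Hg Hf Hlt. apply (convex_univalent h f g); auto. now apply holo_unit_disk.
Qed.
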